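(* Let $d\ge1$ and fix an integer $\nu\ge\frac d2+1$. Define $$\mathbf f:\ \mathfrak P_{+,o}\times\mathfrak P_+\times\mathbb R_+\to-\mathscr C_+\times\mathscr M,\qquad \mathbf f(\mathbf p,\mathbf q,\lambda)=\left(-\Gamma\!\left(\Big(\tfrac PQ\Big)^{\nu}\right),\ \Gamma_0\!\left(\tfrac{\nu}{\nu-1}\Big(\tfrac PQ\Big)^{\nu-1}-\tfrac{\lambda}{P^\nu}\right)\right),$$ where $\mathbb R_+=(0,\infty)$. Then: 1. For each fixed $\lambda>0$, the map $\omega(\mathbf p,\mathbf q):=\mathbf f(\mathbf p,\mathbf q,\lambda)$ is a ($C^\infty$) diffeomorphism between $\mathfrak P_{+,o}\times\mathfrak P_+$ and $-\mathscr C_+\times\mathscr M$; consequently the regularized dual optimization problem $$\min\ J_{\nu,\lambda}(P,Q)\quad\text{s.t. }P\in\overline{\mathfrak P}_{+,o},\ Q\in\overline{\mathfrak P}_+$$ is well-posed in the sense of Hadamard with respect to the data $(\mathbf c,\mathbf m)\in\mathscr C_+\times\mathscr M$ (a solution exists, is unique, and depends continuously on $(\mathbf c,\mathbf m)$). 2. For each fixed $(-\mathbf c,\mathbf m)\in-\mathscr C_+\times\mathscr M$, the solution $(\hat{\mathbf p}_\lambda,\hat{\mathbf q}_\lambda)\in\mathfrak P_{+,o}\times\mathfrak P_+$ of the equation $\mathbf f(\mathbf p,\mathbf q,\lambda)=(-\mathbf c,\mathbf m)$ depends smoothly on $\lambda>0$.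
   Context: $\mathbb T=[0,2\pi)$, identified with the circle, so that $\boldsymbol\theta\in\mathbb T^d$ corresponds to the point $e^{i\boldsymbol\theta}=(e^{i\theta_1},\dots,e^{i\theta_d})$ of the $d$-torus; $\mathrm d\mu(\boldsymbol\theta)=(2\pi)^{-d}\prod_{j=1}^d\mathrm d\theta_j$; $\langle\mathbf k,\boldsymbol\theta\rangle=\sum_j k_j\theta_j$. The index set $\Lambda\subset\mathbb Z^d$ is fixed, finite, contains $\mathbf 0$, and satisfies $\mathbf k\in\Lambda\Rightarrow-\mathbf k\in\Lambda$; $\Lambda_0=\Lambda\setminus\{\mathbf 0\}$. Polynomials: $P(e^{i\boldsymbol\theta})=\sum_{\mathbf k\in\Lambda}p_{\mathbf k}e^{-i\langle\mathbf k,\boldsymbol\theta\rangle}$, $Q(e^{i\boldsymbol\theta})=\sum_{\mathbf k\in\Lambda}q_{\mathbf k}e^{-i\langle\mathbf k,\boldsymbol\theta\rangle}$ with real coefficients, $p_{-\mathbf k}=p_{\mathbf k}$, $q_{-\mathbf k}=q_{\mathbf k}$. $\mathfrak P_+$ is the set of such polynomials that are strictly positive at every point of $\mathbb T^d$; $\mathfrak P_{+,o}=\{P\in\mathfrak P_+:p_{\mathbf 0}=1\}$; bars denote closures in the finite-dimensional coefficient space. Polynomials are identified with their coefficient vectors: $P\in\mathfrak P_{+,o}$ with $\mathbf p=\{p_{\mathbf k}\}_{\mathbf k\in\Lambda_0}$ and $Q\in\mathfrak P_+$ with $\mathbf q=\{q_{\mathbf k}\}_{\mathbf k\in\Lambda}$,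 so $\mathfrak P_{+,o}\times\mathfrak P_+$ is an open subset of the vector space of pairs of symmetric real multisequences indexed by $\Lambda_0$ and $\Lambda$. Moment operators: $\Gamma(\Phi)=\{\int_{\mathbb T^d}e^{i\langle\mathbf k,\boldsymbol\theta\rangle}\Phi\,\mathrm d\mu\}_{\mathbf k\in\Lambda}$ for $\Phi\in L^1(\mathbb T^d)$, and $\Gamma_0$ is the same with $\Lambda$ replaced by $\Lambda_0$. Data sets: $\mathscr C_+$ is the set of all $\mathbf c=\Gamma(\Phi_0)$ where $\Phi_0\in L^1(\mathbb T^d)$ is nonnegative, strictly positive on some open ball in $\mathbb T^d$, and satisfies $\Phi_0(e^{-i\boldsymbol\theta})=\Phi_0(e^{i\boldsymbol\theta})$; $-\mathscr C_+=\{-\mathbf c:\mathbf c\in\mathscr C_+\}$; $\mathscr M=\{\mathbf m\in\mathbb R^{|\Lambda_0|}:m_{-\mathbf k}=m_{\mathbf k},\ \mathbf k\in\Lambda_0\}$. Regularized dual function (depending on the data $\mathbf c,\mathbf m$): $$J_{\nu,\lambda}(P,Q)=\frac1{\nu-1}\int_{\mathbb T^d}\frac{P^\nu}{Q^{\nu-1}}\,\mathrm d\mu+\langle\mathbf q,\mathbf c\rangle-\langle\mathbf p,\mathbf m\rangle+\frac{\lambda}{\nu-1}\int_{\mathbb T^d}\frac1{P^{\nu-1}}\,\mathrm d\mu\in(-\infty,+\infty],$$ with $\langle\mathbf q,\mathbf c\rangle=\sum_{\mathbf k\in\Lambda}q_{\mathbf k}c_{\mathbf k}$, $\langle\mathbf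 p,\mathbf m\rangle=\sum_{\mathbf k\in\Lambda}p_{\mathbf k}m_{\mathbf k}$, $p_{\mathbf 0}=1$ and $m_{\mathbf 0}$ an arbitrary fixed real number. The integrands are $[0,+\infty]$-valued, with $a/0=+\infty$ for $a>0$ (values at points where $P=Q=0$ are irrelevant since the zero set of $P$ is null); in particular $J_{\nu,\lambda}(P,0)=+\infty$. *)

(* Defs.v *)
From HB Require Import structures.
From mathcomp Require Import all_boot all_order all_algebra finmap.
From mathcomp Require Import all_classical all_reals all_analysis.
From mathcomp.real_closed Require Import complex.

Set Implicit Arguments.
Unset Strict Implicit.
Unset Printing Implicit Defensive.

Import Order.TTheory GRing.Theory Num.Theory.
Import numFieldNormedType.Exports.

Local Open Scope classical_set_scope.
Local Open Scope ring_scope.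

Section smooth.
Context {R : realType} {V W : normedModType R}.

Definition relatively_open (S A : set V) : Prop :=
  exists2 U : set V, open U & A = S `&` U.

(* [S] is meant to be a linear subspace of a finite-dimensional [V] and [A] a
   relatively open subset of [S]; only derivatives in the directions of [S] are
   taken, so the values of [f] outside [A] are irrelevant. *)
Fixpoint C_on (n : nat) (S A : set V) (f : V -> W) : Prop :=
  {within A, continuous f} /\
  if n is n'.+1 then
    forall v, S v ->
      (forall x, A x -> derivable f x v) /\ C_on n' S A (fun x => 'D_v f x)
  else True.

Definition smooth_on (S A : set V) (f : V -> W) : Prop :=
  forall n, C_on n S A f.

End smooth.

Definition diffeomorphism {R : realType} {V W : normedModType R}
    (S A : set V) (T B : set W) (f : V -> W) : Prop :=
  [/\ relatively_open S A, relatively_open T B, set_bij A B f,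
      smooth_on S A f
    & exists2 g : W -> V, {in A, cancel f g} & smooth_on T B g].

Definition minimizer {R : realType} {V : Type} (X : set V) (J : V -> \bar R)
    (x : V) : Prop :=
  X x /\ forall y, X y -> (J x <= J y)%E.

Definition hadamard_well_posed {R : realType} {V D : topologicalType}
    (data : set D) (X : set V) (J : D -> V -> \bar R) : Prop :=
  exists2 sol : D -> V,
    forall t, data t ->
      minimizer X (J t) (sol t) /\
      (forall x, minimizer X (J t) x -> x = sol t)
    & {within data, continuous sol}.

Section torus_measure.
Variable R : realType.

Lemma two_pi_gt0 : 0 < 2 * pi :> R.
Proof. by rewrite mulr_gt0// pi_gt0. Qed.

Definition uniform_angle : probability (measurableTypeR R) R :=
  uniform_prob two_pi_gt0.

Definition cons_angle n (x : measurableTypeR R * n.-tuple R) : n.+1.-tuple R :=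
  [tuple of x.1 :: x.2].

Lemma measurable_cons_angle n : measurable_fun [set: _] (@cons_angle n).
Proof. exact: measurable_cons. Qed.

HB.instance Definition _ n := isMeasurableFun.Build _ _ _ _ (@cons_angle n)
  (@measurable_cons_angle n).

(* The measure [(2 pi)^-d dtheta_1 ... dtheta_d] on the cube [0, 2 pi]^d, as an
   iterated product of normalized Lebesgue measures on [0, 2 pi]. *)
Fixpoint torus_measure (d : nat) : probability (d.-tuple R) R :=
  if d is n.+1 then
    distribution (uniform_angle \x torus_measure n)%E (@cons_angle n)
  else \d_([tuple] : 0.-tuple R).

End torus_measure.

Section torus_functions.
Variables (R : realType) (d : nat).
Implicit Types (th : d.-tuple R) (k : 'rV[int]_d).

Definition dotp k th : R := \sum_(j < d) (k 0 j)%:~R * tnth th j.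

Definition opp_angle th : d.-tuple R := [tuple - tnth th j | j < d].

(* Functions on the torus are the functions of the angles that only depend on
   the angles modulo [2 pi]. *)
Definition torus_fun (T : Type) (F : d.-tuple R -> T) : Prop :=
  forall th th' : d.-tuple R,
    (forall j, exists n : int, tnth th' j = tnth th j + n%:~R * (2 * pi)) ->
    F th' = F th.

Definition torus : set (d.-tuple R) :=
  [set th | forall j, 0 <= tnth th j < 2 * pi].

Definition open_ball (a : d.-tuple R) (r : R) : set (d.-tuple R) :=
  [set th | \sum_(j < d) (tnth th j - tnth a j) ^+ 2 < r ^+ 2].

Definition cexp (x : R) : R[i] := (cos x +i* sin x)%C.

Definition Cintegral (F : d.-tuple R -> R[i]) : R[i] :=
  ((\int[torus_measure R d]_th complex.Re (F th)) +i*
   (\int[torus_measure R d]_th complex.Im (F th)))%C.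

Definition moment (Phi : d.-tuple R -> R) k : R[i] :=
  Cintegral (fun th => cexp (dotp k th) * (Phi th)%:C%C).

End torus_functions.

(* Real multisequences indexed by a finite set [L] of multi-indices are row
   vectors, so as to carry the usual normed space structure. *)
Definition mseq (R : realType) (d : nat) (L : {fset 'rV[int]_d}) : Type :=
  'rV[R]_#|{: L}|.

Section mseq.
Variables (R : realType) (d : nat).
Implicit Types (L : {fset 'rV[int]_d}) (k : 'rV[int]_d).

Definition coef L (p : mseq R L) k : R :=
  if insub k is Some k' then p 0 (enum_rank (k' : L)) else 0.

Definition mkmseq L (F : 'rV[int]_d -> R) : mseq R L :=
  \row_i F (val (enum_val i : L)).

Lemma coef_mkmseq L F k : k \in L -> coef (mkmseq L F) k = F k.
Proof. by move=> kL; rewrite /coef insubT mxE enum_rankK. Qed.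

Lemma mkmseq_coef L (p : mseq R L) : mkmseq L (coef p) = p.
Proof.
by apply/rowP => i; rewrite mxE /coef valK enum_valK.
Qed.

Definition symmetric_mseq L : set (mseq R L) :=
  [set p | forall k, k \in L -> coef p (- k) = coef p k].
Arguments symmetric_mseq : clear implicits.

Definition pairing L (p q : mseq R L) : R := \sum_(k <- L) coef p k * coef q k.

Definition trigpolyC L (p : mseq R L) (th : d.-tuple R) : R[i] :=
  \sum_(k <- L) (coef p k)%:C%C * cexp (- dotp k th).

(* The values of a trigonometric polynomial with symmetric coefficients are
   real; see [trigpolyC_real]. *)
Definition trigpoly L (p : mseq R L) (th : d.-tuple R) : R :=
  complex.Re (trigpolyC p th).

Lemma trigpolyC_real L (p : mseq R L) th :
  (forall k, k \in L -> - k \in L) -> symmetric_mseq L p ->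
  trigpolyC p th = (trigpoly p th)%:C%C.
Proof.
move=> symL symp.
suff Im0 : complex.Im (trigpolyC p th) = 0.
  by rewrite /trigpoly; case: (trigpolyC p th) Im0 => a b /= ->.
have ImE : complex.Im (trigpolyC p th) =
    - \sum_(k <- L) coef p k * sin (dotp k th).
  rewrite /trigpolyC -sumrN; elim/big_ind2 : _ => //.
    by move=> x [a b] y [a' b'] /= <- <-.
  by move=> k _; rewrite /cexp /= cosN sinN mulrN mul0r addr0.
have sumN : \sum_(k <- L) coef p k * sin (dotp k th) =
    - \sum_(k <- L) coef p k * sin (dotp k th).
  have LN : perm_eq L [seq - k | k <- L].
    apply: uniq_perm => //.
      by rewrite map_inj_uniq ?fset_uniq//; exact: oppr_inj.
    move=> k; apply/idP/mapP => [kL|[k' k'L ->]]; last exact: symL.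
    by exists (- k); rewrite ?opprK//; exact: symL.
  rewrite {1}(perm_big _ LN) /= big_map -sumrN big_seq [RHS]big_seq.
  apply: eq_bigr => k kL; rewrite symp//.
  suff -> : dotp (- k) th = - dotp k th by rewrite sinN mulrN.
  by rewrite /dotp -sumrN; apply: eq_bigr => j _; rewrite mxE mulrNz mulNr.
rewrite ImE; set S := \sum_(k <- L) _ in sumN *.
have : S *+ 2 == 0 by rewrite mulr2n {1}sumN addNr.
by rewrite mulrn_eq0 /= => /eqP ->; rewrite oppr0.
Qed.

End mseq.

Arguments symmetric_mseq R {d} L.

Section data.
Variables (R : realType) (d : nat) (Lam : {fset 'rV[int]_d}).

Definition Lam0 : {fset 'rV[int]_d} := (Lam `\ 0)%fset.

Definition Pplus : set (mseq R Lam) :=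
  [set q | symmetric_mseq R Lam q /\ forall th, torus th -> 0 < trigpoly q th].

(* Restores the entry at 0: [a = 1] for the coefficients of [P], [a = m_0] for
   the data [m]. *)
Definition extend (a : R) (p : mseq R Lam0) : mseq R Lam :=
  mkmseq Lam (fun k => if k == 0 then a else coef p k).

Definition Pplus_o : set (mseq R Lam0) := [set p | Pplus (extend 1 p)].

(* In particular the moments of [Phi] are real. *)
Definition is_moments (L : {fset 'rV[int]_d}) (Phi : d.-tuple R -> R)
    (c : mseq R L) : Prop :=
  forall k, k \in L -> moment Phi k = (coef c k)%:C%C.

(* The moments are real, and [is_moments Phi (Gamma L Phi)] holds, when [Phi] is
   an even function on the torus. *)
Definition Gamma (L : {fset 'rV[int]_d}) (Phi : d.-tuple R -> R) : mseq R L :=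
  mkmseq L (fun k => complex.Re (moment Phi k)).

Definition Cplus : set (mseq R Lam) :=
  [set c | exists Phi : d.-tuple R -> R,
    [/\ torus_fun Phi,
        (torus_measure R d).-integrable setT (EFin \o Phi),
        (forall th, 0 <= Phi th),
        (exists a r, 0 < r /\ forall th, open_ball a r th -> 0 < Phi th)
      & (forall th, Phi (opp_angle th) = Phi th)] /\
    is_moments Phi c].

Definition negCplus : set (mseq R Lam) := [set c | Cplus (- c)].

Section dual.
Variable nu : nat.

Definition density (p : mseq R Lam0) (q : mseq R Lam) (th : d.-tuple R) : R :=
  (trigpoly (extend 1 p) th / trigpoly q th) ^+ nu.

Definition cepstral (p : mseq R Lam0) (q : mseq R Lam) (lam : R)
    (th : d.-tuple R) : R :=
  nu%:R / (nu%:R - 1) * (trigpoly (extend 1 p) th / trigpoly q th) ^+ nu.-1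
  - lam / trigpoly (extend 1 p) th ^+ nu.

Definition moment_map (lam : R) (x : mseq R Lam0 * mseq R Lam) :
    mseq R Lam * mseq R Lam0 :=
  (- Gamma Lam (density x.1 x.2), Gamma Lam0 (cepstral x.1 x.2 lam)).

(* The integrands are computed in the extended reals, where [0^-1 = +oo] and
   [0 * +oo = 0]. *)
Definition dual_fun (lam m0 : R) (cm : mseq R Lam * mseq R Lam0)
    (x : mseq R Lam0 * mseq R Lam) : \bar R :=
  let P := trigpoly (extend 1 x.1) in
  let Q := trigpoly x.2 in
  (((nu%:R - 1)^-1)%:E *
     \int[torus_measure R d]_th ((P th ^+ nu)%:E / (Q th ^+ nu.-1)%:E)
   + (pairing x.2 cm.1 - pairing (extend 1 x.1) (extend m0 cm.2))%:E
   + (lam / (nu%:R - 1))%:E *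
     \int[torus_measure R d]_th ((P th ^+ nu.-1)%:E)^-1)%E.

End dual.
End data.

Arguments Pplus R {d} Lam.
Arguments Pplus_o R {d} Lam.
Arguments Cplus R {d} Lam.
Arguments negCplus R {d} Lam.

(* Main.v *)
(** The moment map is the gradient of the dual function, up to the data.
    With n = nu - 1, the integrand P^(n+1) / Q^n is jointly convex, being the
    perspective of u^(n+1), and its sum with lam / P^n is strictly convex along
    symmetric pairs, because a nonzero trigonometric polynomial does not vanish on
    an open set.  So the moment map is strictly monotone, hence injective, and its
    Jacobian is invertible on symmetric pairs.

    Surjectivity comes from minimizing the dual function.  A data vector c is in
    C_+ exactly when <q, c> > 0 for every nonzero nonnegative polynomial Q, so the
    linear term controls q; and p is bounded because a nonnegative polynomial with
    p_0 = 1 is.  Near its minimum a trigonometric polynomial grows at most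
    quadratically, so that int 1 / P^n is infinite when P has a zero and 2n >= d;
    quantitatively, a bound on int 1 / P^n and on the coefficients bounds P from
    below.  Applied to P, and then to Q, this shows that the sublevel sets of the
    dual function are compact subsets of the open domain.

    The solution is continuous in (lam, c, m) by monotonicity.  Its derivatives
    along lines are given by the inverse of the Jacobian, whose entries are integrals
    of rational functions of P and Q; the algebra generated by such integrals is
    stable under differentiation, whence smoothness of every order. *)

Require Import Defs.
From HB Require Import structures.
From mathcomp Require Import all_boot all_order all_algebra finmap.
From mathcomp Require Import all_classical all_reals all_analysis.
From mathcomp.real_closed Require Import complex.
From mathcomp Require Import ring lra.

Set Implicit Arguments.
Unset Strict Implicit.
Unset Printing Implicit Defensive.

Import Order.TTheory GRing.Theory Num.Theory.
Import numFieldNormedType.Exports measurable_realfun.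

Local Open Scope classical_set_scope.
Local Open Scope ring_scope.

(** * Integration on the torus *)

(** The domain is open only relative to the symmetric sequences, and a polynomial read through its
    cosines ignores the antisymmetric part of its coefficients. So smoothness is taken along
    symmetric directions, and the Hessian is completed by an antisymmetric projector before being
    inverted. The solution map is differentiated directly: an increment of the moment map is exactly
    the increment of the coordinates times a secant matrix, which converges to the Hessian because
    the solution is already known to be continuous; inverting the secant matrix gives the difference
    quotient. Both claims are restrictions of one solution map, smooth jointly in [lam] and the
    data. That positivity on nonnegative polynomials puts [c] in [Cplus] is itself a consequence of
    the dual problem: it is solved with [lam = 1] and zero cepstral data, and (P/Q)^nu at the
    solution is the required density. The lower bounds come in a forced order: P first, from the
    regularizing integral; only then does P^nu exceed a positive constant, so that the first
    integral controls Q. *)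

Section angle_measure.
Variable R : realType.

(** With [0^-1 = 0] the inverse is discontinuous at 0, so the point 0 and its open complement are
    treated separately. *)
Lemma measurable_invr : measurable_fun [set: R] (fun x : R => x^-1).
Proof.
rewrite (_ : [set: R] = [set 0] `|` [set x | x != 0]); last first.
  apply/seteqP; split => // x _ /=.
  by have [->|x0] := eqVneq x 0; [left|right].
have oD : open [set x : R | x != 0] by exact: open_neq.
apply/measurable_funU => //; first exact: open_measurable.
split; first by apply: measurable_fun_set1.
apply: open_continuous_measurable_fun => // x; rewrite inE /= => x0.
exact: inv_continuous.
Qed.

Lemma measurable_funVr d (T : measurableType d) (f : T -> R) :
  measurable_fun setT f -> measurable_fun setT (fun x => (f x)^-1).
Proof. by move=> mf; apply: (measurableT_comp measurable_invr). Qed.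

Lemma measurable_inveE d (T : measurableType d) (f : T -> R) :
  measurable_fun setT f -> measurable_fun setT (fun x => ((f x)%:E)^-1)%E.
Proof.
move=> mf.
rewrite (_ : (fun x => _) =
    (fun x => if f x == 0%R then +oo%E else ((f x)^-1)%:E)); last first.
  by apply/funext => x; rewrite inver.
apply: measurable_fun_ifT => //.
  exact: measurable_fun_eqr.
by apply/measurable_EFinP; exact: measurable_funVr.
Qed.

Definition reflection (c : R) (x : measurableTypeR R) : measurableTypeR R := c - x.

Lemma measurable_reflection c : measurable_fun setT (reflection c).
Proof. by apply: measurable_funB. Qed.

HB.instance Definition _ c := isMeasurableFun.Build _ _ _ _ (reflection c)
  (measurable_reflection c).

Lemma lebesgue_measure_reflection (c : R) (A : set R) : measurable A ->
  pushforward lebesgue_measure (reflection c) A = lebesgue_measure A.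
Proof.
move=> mA; apply/esym/lebesgue_measure_unique => //= _ [[a b]] _ <-.
rewrite /pushforward.
rewrite (_ : _ @^-1` _ = `[c - b, c - a[%classic); last first.
  apply/seteqP; rewrite /reflection; split => x /=; rewrite !in_itv/=; lra.
rewrite !lebesgue_measure_itv/= !lte_fin.
rewrite ltrD2l ltrN2; case: ifPn => // _; rewrite -!EFinB; congr (_%:E); lra.
Qed.

Lemma integral_uniform_angle_reflect (f : R -> \bar R) :
  measurable_fun [set: R] f -> (forall x, 0 <= f x)%E ->
  (\int[uniform_angle R]_x f (2 * pi - x)%R = \int[uniform_angle R]_x f x)%E.
Proof.
move=> mf f0; rewrite !integral_uniform//; last first.
  by apply: (measurableT_comp mf); exact: measurable_reflection.
congr (_ * _)%E.
pose J : set R := `[0, 2 * pi]%classic.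
transitivity (\int[pushforward lebesgue_measure (reflection (2 * pi)%R)]_(x in J) f x)%E.
  rewrite ge0_integral_pushforward//; last 2 first.
  - exact: measurable_itv.
  - exact: measurable_funTS.
  rewrite (_ : _ @^-1` _ = J)//.
  by apply/seteqP; rewrite /J /reflection; split => x /=; rewrite !in_itv/=; lra.
by apply: eq_measure_integral => //= A mA AS; exact: lebesgue_measure_reflection.
Qed.

(** The representative of the opposite angle that stays in the cube [[0, 2 pi]^d] carrying the
    measure. *)
Definition reflect_angle d (th : d.-tuple R) : d.-tuple R :=
  [tuple 2 * pi - tnth th j | j < d].

Lemma measurable_reflect_angle d :
  measurable_fun [set: d.-tuple R] (@reflect_angle d).
Proof.
apply/measurable_fun_tnthP => i.
rewrite (_ : _ \o _ = (fun th : d.-tuple R => 2 * pi - tnth th i)); last first.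
  by apply/funext => th /=; rewrite tnth_mktuple.
by apply: measurable_funB => //; exact: measurable_tnth.
Qed.

(** Induction on the dimension by Tonelli, from the invariance of Lebesgue measure on the interval
    [[0, 2 pi]] under [x |-> 2 * pi - x]. *)
Lemma integral_torus_reflect d (f : d.-tuple R -> \bar R) :
  measurable_fun setT f -> (forall th, 0 <= f th)%E ->
  (\int[torus_measure R d]_th f (reflect_angle th) =
   \int[torus_measure R d]_th f th)%E.
Proof.
elim: d f => [|d IH] f mf f0.
  by apply: eq_integral => th _; rewrite !(tuple0 th) (tuple0 (reflect_angle _)).
have mfr : measurable_fun setT (fun th => f (reflect_angle th)).
  by apply: (measurableT_comp mf); exact: measurable_reflect_angle.
have mfc : measurable_fun setT (f \o @cons_angle R d).
  by apply: measurableT_comp.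
rewrite /= !ge0_integral_distribution//.
rewrite !fubini_tonelli1//=; last by apply: measurableT_comp.
rewrite /fubini_F/=.
pose F x := (\int[torus_measure R d]_y f (cons_angle (x, y)))%E.
rewrite -[RHS](@integral_uniform_angle_reflect F); first last.
- by move=> x; exact: integral_ge0.
- exact: (@measurable_fun_fubini_tonelli_F _ _ _ _ _ _ (fun p => f (cons_angle p))).
apply: eq_integral => x _; rewrite /F.
rewrite -(IH (fun y => f (cons_angle (2 * pi - x, y)))) //; last first.
  by apply: measurableT_comp => //; exact: (@measurableT_comp _ _ _ _ _ _ (@cons_angle R d)).
apply: eq_integral => y _; congr (f _).
apply: eq_from_tnth => i; rewrite tnth_mktuple.
by case: (unliftP ord0 i) => [j|] ->; rewrite ?tnth0 ?tnthS ?tnth_mktuple.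
Qed.

Definition box d (a b : 'I_d -> R) : set (d.-tuple R) :=
  [set th | forall j, a j < tnth th j <= b j].

Lemma measurable_box d (a b : 'I_d -> R) : measurable (box a b).
Proof.
rewrite (_ : box a b =
  \bigcap_(j in [set: 'I_d]) ((fun th => tnth th j) @^-1` `]a j, b j])).
  apply: fin_bigcap_measurable => // j _.
  by rewrite -[X in measurable X]setTI; apply: measurable_tnth.
apply/seteqP; split => th /= H j; first by move=> _; rewrite /= in_itv/=.
by have := H j I; rewrite /= in_itv.
Qed.

Lemma torus_measure_box d (a b : 'I_d -> R) :
  (forall j, 0 <= a j) -> (forall j, a j <= b j) -> (forall j, b j <= 2 * pi) ->
  torus_measure R d (box a b) = (\prod_(j < d) ((b j - a j) / (2 * pi)))%:E.
Proof.
have pi0 : 0 < 2 * pi :> R by exact: two_pi_gt0.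
elim: d a b => [|d IH] a b a0 ab b2.
  rewrite big_ord0 /= diracE mem_set// => -[]//.
have -> : torus_measure R d.+1 (box a b) =
  (uniform_angle R \x torus_measure R d)%E
    (`]a ord0, b ord0] `*` box (fun j => a (lift ord0 j)) (fun j => b (lift ord0 j))).
  transitivity ((uniform_angle R \x torus_measure R d)%E
    (@cons_angle R d @^-1` box a b)); first by [].
  congr (_ _); apply/seteqP; split => -[x y] /=.
    move=> H; split => /=; first by have := H ord0; rewrite in_itv/= tnth0.
    by move=> j; have := H (lift ord0 j); rewrite tnthS.
  move=> [/= xab yab] i; rewrite in_itv/= in xab.
  by case: (unliftP ord0 i) => [j|] ->; rewrite ?tnth0 ?tnthS.
rewrite product_measure1E//; last exact: measurable_box.
rewrite big_ord_recl EFinM; congr (_ * _)%E; last by apply: IH.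
rewrite /uniform_angle/=.
have -> : uniform_prob (two_pi_gt0 R) `]a ord0, b ord0]%classic =
  (\int[uniform_prob (two_pi_gt0 R)]_x (\1_(`]a ord0, b ord0]%classic) x)%:E)%E.
  by rewrite integral_indic//= setIT.
rewrite integral_uniform//; last first.
  by apply/measurable_EFinP; exact: measurable_indic.
rewrite integral_indic//= subr0.
rewrite (_ : _ `&` _ = `]a ord0, b ord0]%classic); last first.
  apply/seteqP; split => x /=; rewrite !in_itv/=; first by case.
  move=> /andP[h1 h2]; split; first by rewrite h1 h2.
  by rewrite (le_trans (a0 _) (ltW h1)) (le_trans h2 (b2 _)).
rewrite lebesgue_measure_itv/= lte_fin; case: ltP => H.
  by rewrite -EFinB -EFinM mulrC.
have -> : b ord0 = a ord0 by apply/eqP; rewrite eq_le H ab.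
by rewrite subrr mule0 mul0r.
Qed.

End angle_measure.

(** * Bounded measurable functions on a probability space *)

Section bounded_measurable.
Context {R : realType} {disp : measure_display} {T : measurableType disp}.
Variable mu : probability T R.
Implicit Types f g : T -> R.

(** Such functions form an algebra and are integrable for any probability, so integrability of
    expressions in P, Q and their inverses becomes a structural check. *)
Definition bmeas f := measurable_fun setT f /\ exists C, forall t, `|f t| <= C.

Lemma bmeas_cst c : bmeas (fun=> c).
Proof. by split; [exact: measurable_cst | exists `|c|]. Qed.

Lemma bmeasD f g : bmeas f -> bmeas g -> bmeas (fun t => f t + g t).
Proof.
move=> [mf [C fC]] [mg [D gD]]; split; first exact: measurable_funD.
by exists (C + D) => t; rewrite (le_trans (ler_normD _ _))// lerD.
Qed.

Lemma bmeasN f : bmeas f -> bmeas (fun t => - f t).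
Proof.
move=> [mf [C fC]]; split; first exact: measurableT_comp.
by exists C => t; rewrite normrN.
Qed.

Lemma bmeasM f g : bmeas f -> bmeas g -> bmeas (fun t => f t * g t).
Proof.
move=> [mf [C fC]] [mg [D gD]]; split; first exact: measurable_funM.
by exists (C * D) => t; rewrite normrM ler_pM.
Qed.

Lemma bmeasB f g : bmeas f -> bmeas g -> bmeas (fun t => f t - g t).
Proof. by move=> bf bg; apply: bmeasD => //; exact: bmeasN. Qed.

Lemma bmeasX f n : bmeas f -> bmeas (fun t => f t ^+ n).
Proof.
move=> bf; elim: n => [|n IH]; first exact: bmeas_cst.
rewrite (_ : (fun t => _) = (fun t => f t * f t ^+ n)); first exact: bmeasM.
by apply/funext => t; rewrite exprS.
Qed.

Lemma bmeas_sum (I : Type) (s : seq I) (F : I -> T -> R) :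
  (forall i, bmeas (F i)) -> bmeas (fun t => \sum_(i <- s) F i t).
Proof.
move=> bF; elim: s => [|i s IH].
  by under eq_fun do rewrite big_nil; exact: bmeas_cst.
by under eq_fun do rewrite big_cons; exact: bmeasD.
Qed.

Lemma bmeasV f c : 0 < c -> (forall t, c <= f t) -> bmeas f ->
  bmeas (fun t => (f t)^-1).
Proof.
move=> c0 cf [mf _]; split; first exact: measurable_funVr.
exists c^-1 => t; have f0 := lt_le_trans c0 (cf t).
by rewrite ger0_norm ?invr_ge0 ?(ltW f0)// lef_pV2 ?posrE.
Qed.

Lemma bmeas_integrable f : bmeas f -> mu.-integrable setT (EFin \o f).
Proof.
move=> [mf [C fC]]; apply: measurable_bounded_integrable => //.
  by rewrite (le_lt_trans (probability_le1 _ _)) ?ltry.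
exists C; split; first exact: num_real.
by move=> x Cx t _ /=; rewrite (le_trans (fC t))// ltW.
Qed.

Lemma bmeas_integrableM f g : bmeas f -> mu.-integrable setT (EFin \o g) ->
  mu.-integrable setT (EFin \o (fun t => f t * g t)).
Proof.
move=> [mf [C fC]] ig.
have mg : measurable_fun setT g by apply/measurable_EFinP; exact: measurable_int ig.
apply: (le_integrable measurableT _ _ (integrableZl measurableT C ig)).
  by apply/measurable_EFinP; exact: measurable_funM.
move=> t _ /=; rewrite lee_fin !normrM ler_wpM2r//.
by rewrite (le_trans (fC t))// ler_norm.
Qed.

Lemma EFin_Rintegral f : mu.-integrable setT (EFin \o f) ->
  (\int[mu]_t f t)%:E = (\int[mu]_t (f t)%:E)%E.
Proof. by move=> fi; rewrite /Rintegral fineK// integrable_fin_num. Qed.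

Lemma Rintegral_cstT c : \int[mu]_t (fun=> c) t = c.
Proof.
rewrite (@Rintegral_cst _ _ _ mu)//= (_ : mu setT = 1%E) ?mulr1//.
exact: probability_setT.
Qed.

Lemma Rintegral_sum (I : Type) (s : seq I) (F : I -> T -> R) :
  (forall i, mu.-integrable setT (EFin \o F i)) ->
  \int[mu]_t (\sum_(i <- s) F i t) = \sum_(i <- s) \int[mu]_t F i t.
Proof.
move=> iF; elim: s => [|i s IH].
  rewrite big_nil; under eq_Rintegral do rewrite big_nil.
  exact: Rintegral_cstT.
rewrite big_cons -IH -RintegralD//.
  by apply: eq_Rintegral => t _; rewrite big_cons.
rewrite (_ : EFin \o _ = (fun t => \sum_(i <- s) (F i t)%:E)%E); last first.
  by apply/funext => t /=; rewrite -sumEFin.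
by apply: (@integrable_sum _ _ _ mu _ measurableT _ s predT (fun i t => (F i t)%:E)) => j _;
  exact: iF.
Qed.

Lemma norm_Rintegral_le f C : bmeas f -> (forall t, `|f t| <= C) ->
  `|\int[mu]_t f t| <= C.
Proof.
move=> bf fC; have fi := bmeas_integrable bf.
rewrite (le_trans (le_normr_Rintegral _ fi))//.
rewrite -[leRHS]Rintegral_cstT; apply: le_Rintegral => //.
  exact: integrable_norm.
exact/bmeas_integrable/bmeas_cst.
Qed.

(** A nonnegative function with zero integral vanishes almost everywhere, hence somewhere in any set
    of positive measure. *)
Lemma Rintegral_gt0 f A : mu.-integrable setT (EFin \o f) ->
  (forall t, 0 <= f t) -> measurable A -> (0 < mu A)%E ->
  (forall t, A t -> 0 < f t) -> 0 < \int[mu]_t f t.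
Proof.
move=> fi f0 mA A0 fA; rewrite lt_neqAle Rintegral_ge0// andbT.
apply/negP => /eqP/esym I0.
have : (\int[mu]_t `|(f t)%:E| = 0)%E.
  under eq_integral => t _ do rewrite gee0_abs ?lee_fin//.
  by rewrite -EFin_Rintegral// I0.
have mf := measurable_int _ fi.
move=> /(ae_eq_integral_abs _ measurableT mf).1 [B [mB B0 AB]].
have : (mu A <= mu B)%E.
  apply: le_measure; rewrite ?inE// => t At; apply: AB => /= /(_ I) [ft].
  by have := fA t At; rewrite ft ltxx.
by rewrite B0 leNgt A0.
Qed.

End bounded_measurable.

Section torus_integral.
Context {R : realType} {d : nat}.
Local Notation mu := (torus_measure R d).

Lemma reflect_angle_torus_fun (f : d.-tuple R -> R) th : torus_fun f ->
  f (reflect_angle th) = f (opp_angle th).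
Proof.
move=> tf; apply: tf => j; exists 1; rewrite /reflect_angle !tnth_mktuple.
by rewrite mul1r addrC.
Qed.

(** This makes the moments of even functions real. The change of variables is stated for nonnegative
    integrands, so it is applied to [f + C] with [C] a bound of [f]: it gives that [C - f] and
    [f + C] have the same integral. *)
Lemma Rintegral_odd (f : d.-tuple R -> R) : torus_fun f -> bmeas f ->
  (forall th, f (opp_angle th) = - f th) -> \int[mu]_th f th = 0.
Proof.
move=> tf bf fN; have [mf [C fC]] := bf.
have C1 th : 0 <= f th + C.
  by have := fC th; rewrite ler_norml => /andP[? _]; lra.
have H := @integral_torus_reflect R d (fun th => (f th + C)%:E).
have bC := bmeas_cst C : @bmeas R _ (d.-tuple R) (fun=> C).
have bD := bmeasD bf bC.
have bD' := bmeasB bC bf.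
have : (\int[mu]_th (C - f th) = \int[mu]_th (f th + C)).
  apply/EFin_inj; rewrite !EFin_Rintegral; try exact: bmeas_integrable.
  rewrite -H; last 2 first.
  - by apply/measurable_EFinP; case: bD.
  - by move=> th; rewrite lee_fin.
  by apply: eq_integral => th _; rewrite reflect_angle_torus_fun// fN addrC.
rewrite RintegralB ?RintegralD//; try exact: bmeas_integrable.
rewrite Rintegral_cstT; lra.
Qed.
End torus_integral.

(** * Trigonometric polynomials *)

Section trigonometry.
Variable R : realType.
Implicit Types x y t : R.

Lemma sin_dist x y : `|sin x - sin y| <= `|x - y|.
Proof.
wlog xy : x y / y < x => [H|].
  have [xy|xy|->] := ltgtP x y; last by rewrite !subrr.
    by rewrite distrC (distrC x); exact: H.
  exact: H.
have [|c _ ->] := @MVT _ sin cos y x xy (fun z _ => is_derive_sin z).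
  by apply: continuous_subspaceT => z; exact: continuous_sin.
by rewrite normrM ler_piMl// cos_max.
Qed.

Lemma cos_dist x y : `|cos x - cos y| <= `|x - y|.
Proof.
rewrite -!sinDpihalf (le_trans (sin_dist _ _))//.
by rewrite opprD addrACA subrr addr0.
Qed.

(** From [1 - cos t = 2 * sin (t / 2) ^+ 2]. This is the source of the quadratic growth of
    polynomials near a minimum. *)
Lemma one_sub_cos_le t : 1 - cos t <= t ^+ 2.
Proof.
have -> : t = (t / 2) *+ 2 by rewrite (mulr2n (t / 2)); lra.
rewrite cos_mulr2n cos2sin2.
have := sin_dist (t / 2) 0; rewrite sin0 !subr0 => H.
have : sin (t / 2) ^+ 2 <= (t / 2) ^+ 2.
  by rewrite -[leLHS]real_normK ?num_real// -[leRHS]real_normK ?num_real// lerXn2r// nnegrE.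
rewrite (mulr2n (1 - _)) (mulr2n (t / 2)); have := sqr_ge0 (t / 2); rewrite !expr2; lra.
Qed.

Lemma cosD_int x (n : int) : cos (x + n%:~R * (2 * pi)) = cos x.
Proof.
have -> : 2 * pi = pi *+ 2 :> R by rewrite mulr_natl.
case: n => n.
  by rewrite -pmulrn mulr_natl; apply: periodicn; exact: cosD2pi.
rewrite NegzE mulrNz -pmulrn mulNr mulr_natl.
by rewrite -[x in RHS](subrK ((pi *+ 2) *+ n.+1)) [RHS](periodicn (@cosD2pi R)).
Qed.

Lemma sinD_int x (n : int) : sin (x + n%:~R * (2 * pi)) = sin x.
Proof.
by rewrite -[RHS]cosBpihalf -(cosD_int _ n) -[LHS]cosBpihalf; congr cos; ring.
Qed.

Lemma cexpD x y : cexp (x + y) = cexp x * cexp y.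
Proof. by rewrite /cexp cosD sinD; simpc; congr (_ +i* _)%C; rewrite addrC. Qed.

Lemma cexp0 : cexp (0 : R) = 1.
Proof. by rewrite /cexp cos0 sin0. Qed.

Lemma cexp_neq0 x : cexp x != 0.
Proof.
apply/eqP => x0; have := cexpD x (- x); rewrite subrr cexp0 x0 mul0r => /eqP.
by rewrite oner_eq0.
Qed.

Lemma cexp_neq x y : 0 < `|x - y| < pi -> cexp x != cexp y.
Proof.
wlog xy : x y / y < x => [H h|].
  have [xy|xy|e] := ltgtP x y; last by rewrite e subrr normr0 ltxx in h.
    by rewrite eq_sym; apply: H => //; rewrite distrC.
  exact: H.
rewrite (gtr0_norm (_ : 0 < x - y)); last by rewrite subr_gt0.
move=> h; have := sin_gt0_pi h; rewrite sinB => s0.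
by apply/eqP => -[cE sE]; rewrite cE sE mulrC subrr ltxx in s0.
Qed.

End trigonometry.

(** * Characters of the torus *)

Section characters.
Variables (R : realType) (d : nat).
Implicit Types (k : 'rV[int]_d) (x y h : 'I_d -> R) (th : d.-tuple R).

(** The same form as [dotp], for increments of angles; these are plain functions so that they add
    and negate pointwise. *)
Definition phase k x : R := \sum_(j < d) (k 0 j)%:~R * x j.

Definition shift th x : d.-tuple R := [tuple tnth th j + x j | j < d].

Lemma phaseD k x y : phase k (fun j => x j + y j) = phase k x + phase k y.
Proof. by rewrite -big_split; apply: eq_bigr => j _; rewrite /= mulrDr. Qed.

Lemma phaseN k x : phase k (fun j => - x j) = - phase k x.
Proof. by rewrite -sumrN; apply: eq_bigr => j _; rewrite mulrN. Qed.

Lemma dotp_shift k th x : dotp k (shift th x) = dotp k th + phase k x.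
Proof.
rewrite /dotp -big_split; apply: eq_bigr => j _.
by rewrite tnth_mktuple mulrDr.
Qed.

Lemma dotp_opp k th : dotp k (opp_angle th) = - dotp k th.
Proof. by rewrite -sumrN; apply: eq_bigr => j _; rewrite tnth_mktuple mulrN. Qed.

Lemma dotp_oppl k th : dotp (- k) th = - dotp k th.
Proof. by rewrite -sumrN; apply: eq_bigr => j _; rewrite mxE mulrNz mulNr. Qed.

Lemma phase_delta k i t : phase k (fun j => if j == i then t else 0) = (k 0 i)%:~R * t.
Proof.
rewrite /phase (bigD1 i)//= eqxx big1 ?addr0// => j /negPf ->.
by rewrite mulr0.
Qed.

Lemma norm_phase k x r : (forall j, `|x j| <= r) ->
  `|phase k x| <= (\sum_(j < d) `|(k 0 j)%:~R|) * r.
Proof.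
move=> xr; rewrite (le_trans (ler_norm_sum _ _ _))// mulr_suml.
by apply: ler_sum => j _; rewrite normrM ler_wpM2l.
Qed.

(* The difference [f (x + h) - cexp (- phase k0 h) * f x] kills the frequency
   [k0], and preserves any other one for a suitable small [h]. *)
Lemma characters_independent (S : seq 'rV[int]_d) (c : 'rV[int]_d -> R[i]) r :
  uniq S -> 0 < r ->
  (forall x, (forall j, `|x j| < r) -> \sum_(k <- S) c k * cexp (- phase k x) = 0) ->
  forall k, k \in S -> c k = 0.
Proof.
elim: S c r => [//|k0 S IH] c r /= /andP[k0S uS] r0 c0.
have cS k : k \in S -> c k = 0.
  move=> kS.
  have : k != k0 by apply: contraNneq k0S => <-.
  have [i ki|kk] := pickP (fun i => k 0 i != k0 0 i); last first.
    move=> /eqP[]; apply/rowP => i; apply/eqP; move: (kk i).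
    by move/negbT; rewrite negbK.
  move=> _; pose n : R := `|(k 0 i)%:~R - (k0 0 i)%:~R|.
  have n0 : 0 < n by rewrite normr_gt0 subr_eq0 eqr_int.
  (* [t < r / 2] keeps translated points in the cube; [t < pi / n] keeps the two phases less than
     [pi] apart, so that their exponentials differ. *)
  pose t : R := Num.min (r / 2 / 2) (pi / n / 2).
  have pi0 := pi_gt0 R.
  have pn0 : 0 < pi / n by rewrite divr_gt0.
  have t0 : 0 < t by rewrite /t lt_min; apply/andP; split; lra.
  have tr : t < r / 2 by rewrite /t gt_min; apply/orP; left; lra.
  have tn : t < pi / n by rewrite /t gt_min; apply/orP; right; lra.
  pose h j : R := if j == i then t else 0.
  have hr j : `|h j| < r / 2.
    by rewrite /h; case: ifP => _; rewrite ?normr0 ?gtr0_norm//; lra.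
  have neq : cexp (- phase k h) - cexp (- phase k0 h) != 0.
    rewrite subr_eq0; apply: cexp_neq; rewrite !phase_delta opprK addrC -mulrBl.
    rewrite normrM (gtr0_norm t0) distrC -/n mulr_gt0//=.
    by rewrite mulrC -ltr_pdivlMr.
  have := IH (fun k => c k * (cexp (- phase k h) - cexp (- phase k0 h))) (r / 2) uS.
  move=> /(_ _ _ k kS) H.
  apply/eqP; rewrite -(mulIr_eq0 _ (mulIf neq)); apply/eqP; apply: H; first lra.
  move=> x xr.
  have e1 : \sum_(k <- k0 :: S) c k * cexp (- phase k (fun j => x j + h j)) = 0.
    apply: c0 => j; rewrite (le_lt_trans (ler_normD _ _))//.
    by have := xr j; have := hr j; lra.
  have e2 : \sum_(k <- k0 :: S) c k * cexp (- phase k x) = 0.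
    by apply: c0 => j; have := xr j; lra.
  have : \sum_(k <- k0 :: S) c k * (cexp (- phase k h) - cexp (- phase k0 h)) *
      cexp (- phase k x) = 0.
    transitivity (\sum_(k <- k0 :: S) c k * cexp (- phase k (fun j => x j + h j)) -
        cexp (- phase k0 h) * \sum_(k <- k0 :: S) c k * cexp (- phase k x)).
      rewrite mulr_sumr -sumrB; apply: eq_bigr => l _.
      by rewrite phaseD opprD cexpD; ring.
    by rewrite e1 e2 mulr0 subrr.
  by rewrite big_cons subrr mulr0 mul0r add0r.
move=> k; rewrite inE => /orP[/eqP ->|]; last exact: cS.
(* Only the frequency [k0] is left, and its character does not vanish at the origin. *)
have := c0 (fun=> 0); rewrite big_cons big_seq big1 => [|l lS]; last first.
  by rewrite cS// mul0r.
rewrite addr0 => /(_ _)/eqP; rewrite mulf_eq0 (negPf (cexp_neq0 _)) orbF.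
by move=> H; apply/eqP/H => j; rewrite normr0.
Qed.

(* Averaging over [th + h] and [th - h] with [phase k0 h = pi / 2] kills the
   frequency [k0] and preserves nonnegativity. *)
Lemma ge0_cos_sum_eq0 (S : seq 'rV[int]_d) (c : 'rV[int]_d -> R) :
  0 \notin S -> (forall th, 0 <= \sum_(k <- S) c k * cos (dotp k th)) ->
  forall th, \sum_(k <- S) c k * cos (dotp k th) = 0.
Proof.
elim: S c => [|k0 S IH] c; first by move=> _ _ th; rewrite big_nil.
rewrite inE negb_or eq_sym => /andP[k00 S0] c0.
have [i ki|kk] := pickP (fun i => k0 0 i != 0); last first.
  move/eqP: k00 => []; apply/rowP => i; rewrite mxE; apply/eqP; move: (kk i).
  by move/negbT; rewrite negbK.
have ki0 : (k0 0 i)%:~R != 0 :> R by rewrite intr_eq0.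
pose h j : R := if j == i then pi / 2 / (k0 0 i)%:~R else 0.
have k0h : cos (phase k0 h) = 0.
  by rewrite phase_delta mulrC divfK// cos_pihalf.
pose f th := \sum_(k <- k0 :: S) c k * cos (dotp k th).
have fE th : f (shift th h) + f (shift th (fun j => - h j)) =
    2 * \sum_(k <- S) (c k * cos (phase k h)) * cos (dotp k th).
  transitivity (2 * \sum_(k <- k0 :: S) (c k * cos (phase k h)) * cos (dotp k th)).
    rewrite mulr_sumr -big_split; apply: eq_bigr => k _ /=.
    by rewrite !dotp_shift phaseN cosD cosB; ring.
  by rewrite big_cons k0h mulr0 mul0r add0r.
have /IH H : 0 \notin S by [].
have {}H := H (fun k => c k * cos (phase k h)).
(* At the midpoint [th'] the two translates are nonnegative with zero sum, so both vanish; one of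
   them is the value at [th]. *)
move=> th; pose th' := shift th (fun j => - h j).
have -> : th = shift th' h.
  by apply: eq_from_tnth => j; rewrite !tnth_mktuple subrK.
have := fE th'; rewrite H; last first.
  move=> u; have := fE u; have := c0 (shift u h); have := c0 (shift u (fun j => - h j)).
  by rewrite -/(f _) -/(f _); lra.
rewrite mulr0 -/(f _) => e; have := c0 (shift th' h).
by have := c0 (shift th' (fun j => - h j)); rewrite -/(f _) -/(f _); lra.
Qed.

End characters.

Section cvg_bigops.
Context {R : realType} {X : Type} {F : set_system X} {FF : Filter F}.

Lemma cvg_sumr (I : Type) (s : seq I) (P : pred I) (f : I -> X -> R) (l : I -> R) :
  (forall i, P i -> f i x @[x --> F] --> l i) ->
  \sum_(i <- s | P i) f i x @[x --> F] --> \sum_(i <- s | P i) l i.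
Proof. by move=> H; apply: cvg_big => //; exact: add_continuous. Qed.

Lemma cvg_prodr (I : Type) (s : seq I) (P : pred I) (f : I -> X -> R) (l : I -> R) :
  (forall i, P i -> f i x @[x --> F] --> l i) ->
  \prod_(i <- s | P i) f i x @[x --> F] --> \prod_(i <- s | P i) l i.
Proof. by move=> H; apply: cvg_big => //; exact: mul_continuous. Qed.

End cvg_bigops.

Section trigonometric_polynomials.
Variables (R : realType) (d : nat).
Implicit Types (L : {fset 'rV[int]_d}) (th t : d.-tuple R) (x : 'I_d -> R).

Definition freq L (i : 'I_#|{: L}|) : 'rV[int]_d := val (enum_val i : L).

Lemma freq_in L (i : 'I_#|{: L}|) : freq i \in L.
Proof. exact: valP. Qed.

Lemma coef_freq L (q : mseq R L) i : coef q (freq i) = q 0 i.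
Proof. by rewrite /coef /freq valK enum_valK. Qed.

Lemma sum_freq L (F : 'rV[int]_d -> R) :
  \sum_(k <- L) F k = \sum_(i < #|{: L}|) F (freq i).
Proof.
rewrite big_seq_fsetE/= (reindex (fun i : 'I_#|{: L}| => enum_val i))//=.
by exists enum_rank => i _; rewrite ?enum_valK ?enum_rankK.
Qed.

Lemma trigpolyE L (q : mseq R L) th :
  trigpoly q th = \sum_(k <- L) coef q k * cos (dotp k th).
Proof.
rewrite /trigpoly /trigpolyC; elim/big_ind2 : _ => //.
  by move=> x [a b] y [a' b'] /= <- <-.
by move=> k _; rewrite /cexp /= cosN mul0r subr0.
Qed.

Lemma trigpoly_freq L (q : mseq R L) th :
  trigpoly q th = \sum_i q 0 i * cos (dotp (freq i) th).
Proof.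
by rewrite trigpolyE sum_freq; apply: eq_bigr => i _; rewrite coef_freq.
Qed.

Lemma norm_coord n (v : 'rV[R]_n) i : `|v 0 i| <= `|v|.
Proof.
have /mapP[j Hj ->] : `|v ord0 i| \in [seq `|v x.1 x.2| | x : 'I_1 * 'I_n].
  by apply/mapP; exists (ord0, i) => //=; rewrite mem_enum.
by rewrite [leRHS]/Num.norm /= mx_normrE; apply/bigmax_geP; right => /=; exists j.
Qed.

Lemma norm_rV_le n (v : 'rV[R]_n) c : 0 <= c ->
  (forall i, `|v 0 i| <= c) -> `|v| <= c.
Proof.
move=> c0 vc; rewrite [leLHS]/Num.norm /= mx_normrE.
by apply/bigmax_leP; split => // -[i j] _ /=; rewrite ord1.
Qed.

Lemma trigpoly_le_norm L (q : mseq R L) th :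
  `|trigpoly q th| <= #|{: L}|%:R * `|q|.
Proof.
rewrite trigpoly_freq (le_trans (ler_norm_sum _ _ _))//.
rewrite mulr_natl -[X in _ *+ X]card_ord -sumr_const.
apply: ler_sum => i _; rewrite normrM (le_trans _ (norm_coord q i))//.
by rewrite ler_piMr// cos_max.
Qed.

Lemma trigpolyD L (p q : mseq R L) th :
  trigpoly (p + q) th = trigpoly p th + trigpoly q th.
Proof.
by rewrite !trigpoly_freq -big_split; apply: eq_bigr => i _; rewrite mxE mulrDl.
Qed.

Lemma trigpolyZ L a (q : mseq R L) th :
  trigpoly (a *: q) th = a * trigpoly q th.
Proof.
by rewrite !trigpoly_freq mulr_sumr; apply: eq_bigr => i _; rewrite mxE mulrA.
Qed.

Lemma trigpolyB L (p q : mseq R L) th :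
  trigpoly (p - q) th = trigpoly p th - trigpoly q th.
Proof. by rewrite -scaleN1r trigpolyD trigpolyZ mulN1r. Qed.

Lemma dotp_period (k : 'rV[int]_d) th th' :
  (forall j, exists n : int, tnth th' j = tnth th j + n%:~R * (2 * pi)) ->
  exists n : int, dotp k th' = dotp k th + n%:~R * (2 * pi).
Proof.
move=> /choice[n nE]; exists (\sum_(j < d) k 0 j * n j).
rewrite /dotp raddf_sum mulr_suml -big_split; apply: eq_bigr => j _ /=.
by rewrite nE intrM; ring.
Qed.

Lemma cos_torus_fun (k : 'rV[int]_d) : torus_fun (fun th => cos (dotp k th) : R).
Proof. by move=> th th' /(dotp_period k)[n ->]; rewrite cosD_int. Qed.

Lemma sin_torus_fun (k : 'rV[int]_d) : torus_fun (fun th => sin (dotp k th) : R).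
Proof. by move=> th th' /(dotp_period k)[n ->]; rewrite sinD_int. Qed.

Lemma trigpoly_torus_fun L (q : mseq R L) : torus_fun (trigpoly q).
Proof.
move=> th th' H; rewrite !trigpoly_freq; apply: eq_bigr => i _.
by congr (_ * _); apply: cos_torus_fun H.
Qed.

Lemma trigpoly_opp L (q : mseq R L) th : trigpoly q (opp_angle th) = trigpoly q th.
Proof.
by rewrite !trigpoly_freq; apply: eq_bigr => i _; rewrite dotp_opp cosN.
Qed.

Lemma measurable_dotp (k : 'rV[int]_d) : measurable_fun setT (fun th : d.-tuple R => dotp k th).
Proof.
apply: measurable_sum => j; apply: measurable_funM => //.
exact: measurable_tnth.
Qed.

Lemma measurable_cos_dotp (k : 'rV[int]_d) :
  measurable_fun setT (fun th : d.-tuple R => cos (dotp k th)).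
Proof.
apply: measurableT_comp; last exact: measurable_dotp.
by apply: continuous_measurable_fun; exact: continuous_cos.
Qed.

Lemma measurable_sin_dotp (k : 'rV[int]_d) :
  measurable_fun setT (fun th : d.-tuple R => sin (dotp k th)).
Proof.
apply: measurableT_comp; last exact: measurable_dotp.
by apply: continuous_measurable_fun; exact: continuous_sin.
Qed.

Lemma bmeas_cos (k : 'rV[int]_d) : bmeas (fun th : d.-tuple R => cos (dotp k th)).
Proof.
by split; [exact: measurable_cos_dotp | exists 1 => th; exact: cos_max].
Qed.

Lemma bmeas_sin (k : 'rV[int]_d) : bmeas (fun th : d.-tuple R => sin (dotp k th)).
Proof.
by split; [exact: measurable_sin_dotp | exists 1 => th; exact: sin_max].
Qed.

Lemma bmeas_trigpoly L (q : mseq R L) : bmeas (trigpoly q).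
Proof.
rewrite (_ : trigpoly q = fun th => \sum_i q 0 i * cos (dotp (freq i) th)).
  by apply: bmeas_sum => i; apply: bmeasM; [exact: bmeas_cst|exact: bmeas_cos].
by apply/funext => th; exact: trigpoly_freq.
Qed.

Definition torus_repr th : d.-tuple R :=
  [tuple tnth th j - (Num.floor (tnth th j / (2 * pi)))%:~R * (2 * pi) | j < d].

Lemma torus_repr_torus th : torus (torus_repr th).
Proof.
move=> j; have p0 := two_pi_gt0 R; rewrite tnth_mktuple.
have /andP[] := floor_itv (tnth th j / (2 * pi)).
rewrite ler_pdivlMr// ltr_pdivrMr// intrD mulrDl; lra.
Qed.

Lemma torus_repr_shift T (F : d.-tuple R -> T) th x : torus_fun F ->
  F (shift (torus_repr th) x) = F (shift th x).
Proof.
move=> tF; apply: tF => j; exists (- Num.floor (tnth th j / (2 * pi))).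
by rewrite !tnth_mktuple mulrNz; ring.
Qed.

Lemma shift0 th : shift th (fun=> 0) = th.
Proof. by apply: eq_from_tnth => j; rewrite tnth_mktuple addr0. Qed.

Lemma torus_reprE T (F : d.-tuple R -> T) th : torus_fun F ->
  F (torus_repr th) = F th.
Proof. by move=> tF; rewrite -(shift0 (torus_repr th)) torus_repr_shift// shift0. Qed.

Lemma trigpoly_min L (q : mseq R L) :
  exists2 th0, torus th0 & forall th, trigpoly q th0 <= trigpoly q th.
Proof.
(* The half-open [torus] is not compact, so the minimum is taken on the closed cube and its position
   is then reduced modulo [2 * pi]. *)
pose K : set 'rV[R]_d := [set v | forall j, `[0, 2 * pi]%classic (v 0 j)].
pose F (v : 'rV[R]_d) := trigpoly q [tuple v 0 j | j < d].
have p0 := two_pi_gt0 R.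
have cF : continuous F.
  rewrite (_ : F = fun v : 'rV[R]_d =>
      \sum_i q 0 i * cos (\sum_(j < d) (freq i 0 j)%:~R * v 0 j)); last first.
    apply/funext => v; rewrite /F trigpoly_freq; apply: eq_bigr => i _.
    congr (_ * cos _); rewrite /dotp; apply: eq_bigr => j _.
    by rewrite tnth_mktuple.
  move=> v; apply: (@cvg_sumr _ _ (nbhs v) _) => i _.
  apply: cvgM; first exact: cvg_cst.
  apply: (@continuous_cvg _ _ _ (nbhs v) _ _ cos); first exact: continuous_cos.
  apply: (@cvg_sumr _ _ (nbhs v) _) => j _; apply: cvgM; first exact: cvg_cst.
  exact: coord_continuous.
have K0 : K !=set0.
  exists 0 => j /=; rewrite mxE in_itv/= lexx/=; exact: ltW.
have cK : compact K.
  apply: (@rV_compact _ _ (fun=> `[0, 2 * pi]%classic)) => _.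
  exact: segment_compact.
have [v _ vmin] := EVT_min_rV K0 cK (continuous_subspaceT cF).
exists (torus_repr [tuple v 0 j | j < d]); first exact: torus_repr_torus.
move=> th; rewrite torus_reprE; last exact: trigpoly_torus_fun.
rewrite -[leRHS]torus_reprE; last exact: trigpoly_torus_fun.
have := vmin (\row_j tnth (torus_repr th) j); rewrite /F => H.
have -> : torus_repr th = [tuple (\row_j tnth (torus_repr th) j) 0 j | j < d].
  by apply: eq_from_tnth => j; rewrite [RHS]tnth_mktuple mxE.
apply: H; rewrite inE => j /=; rewrite mxE in_itv/=.
by have := torus_repr_torus th j; move=> /andP[-> /ltW ->].
Qed.

Definition lip_const L (q : mseq R L) : R :=
  \sum_i `|q 0 i| * \sum_(j < d) `|(freq i 0 j)%:~R|.

Lemma trigpoly_lipschitz L (q : mseq R L) th x r : (forall j, `|x j| <= r) ->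
  `|trigpoly q (shift th x) - trigpoly q th| <= lip_const q * r.
Proof.
move=> xr; rewrite !trigpoly_freq -sumrB (le_trans (ler_norm_sum _ _ _))//.
rewrite /lip_const mulr_suml; apply: ler_sum => i _.
rewrite -mulrBr normrM -mulrA ler_wpM2l//.
rewrite (le_trans (cos_dist _ _))// dotp_shift addrAC subrr add0r.
exact: norm_phase.
Qed.

(** It depends on the frequencies only, so that the growth bound near a minimum is uniform on
    bounded sets of polynomials. *)
Definition quad_const L : R :=
  \sum_(i < #|{: L}|) 2 * (\sum_(j < d) `|(freq i 0 j)%:~R|) ^+ 2.

Lemma quad_const_ge0 L : 0 <= quad_const L.
Proof. by apply: sumr_ge0 => i _; rewrite mulr_ge0// sqr_ge0. Qed.

(* The midpoint of [Q (th + x)] and [Q (th - x)] has no first order term. *)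
Lemma trigpoly_near_min L (q : mseq R L) th x (r : R) : 0 <= r ->
  (forall th', trigpoly q th <= trigpoly q th') ->
  (forall j, `|x j| <= r) ->
  trigpoly q (shift th x) <= trigpoly q th + quad_const L * `|q| * r ^+ 2.
Proof.
move=> r0 qmin xr; have := qmin (shift th (fun j => - x j)).
have : trigpoly q (shift th x) + trigpoly q (shift th (fun j => - x j)) =
    2 * trigpoly q th - \sum_i 2 * (q 0 i * cos (dotp (freq i) th) *
      (1 - cos (phase (freq i) x))).
  rewrite !trigpoly_freq mulr_sumr -big_split -sumrB; apply: eq_bigr => i _ /=.
  by rewrite !dotp_shift phaseN cosD cosB; ring.
have : - \sum_i 2 * (q 0 i * cos (dotp (freq i) th) *
      (1 - cos (phase (freq i) x))) <= quad_const L * `|q| * r ^+ 2.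
  rewrite -sumrN /quad_const !mulr_suml; apply: ler_sum => i _.
  rewrite (le_trans (ler_norm _))// normrN !normrM ger0_norm//.
  set S := \sum_(j < d) _.
  have S0 : 0 <= S by exact: sumr_ge0.
  have -> : 2 * S ^+ 2 * `|q| * r ^+ 2 = 2 * (`|q| * (1 * (S * r) ^+ 2)) by ring.
  rewrite ler_pM2l// -(mulrA `|q 0 i|); apply: ler_pM => //.
  - exact: norm_coord.
  - apply: ler_pM => //; first exact: cos_max.
    rewrite ger0_norm; last by rewrite subr_ge0; exact: cos_le1.
    rewrite (le_trans (one_sub_cos_le _))// -real_normK ?num_real//.
    rewrite lerXn2r// ?nnegrE//; last exact: norm_phase.
    by rewrite mulr_ge0.
by move=> h1 h2 h3; lra.
Qed.

(** In each coordinate the box extends from [t] towards the side with room left: for [r <= pi] it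
    stays in [[0, 2 pi]^d] without wrapping around. Since [t] is a vertex of all of these boxes,
    they are nested. *)
Definition corner t r (j : 'I_d) : R := if tnth t j < pi then tnth t j else tnth t j - r.

Definition corner_box t r : set (d.-tuple R) :=
  box (corner t r) (fun j => corner t r j + r).

Lemma measure_corner_box t r : torus t -> 0 <= r -> r <= pi ->
  torus_measure R d (corner_box t r) = ((r / (2 * pi)) ^+ d)%:E.
Proof.
move=> tt r0 rp; rewrite torus_measure_box.
- rewrite (eq_bigr (fun=> r / (2 * pi))).
    by rewrite prodr_const card_ord.
  by move=> j _; rewrite addrAC subrr add0r.
- by move=> j; rewrite /corner; have /andP[? ?] := tt j; case: ltP => ?; lra.
- by move=> j; rewrite lerDl.
- by move=> j; rewrite /corner; have /andP[? ?] := tt j; case: ltP => ?; lra.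
Qed.

Lemma corner_box_shift t r th : 0 <= r -> corner_box t r th ->
  exists2 x, th = shift t x & forall j, `|x j| <= r.
Proof.
move=> r0 H; exists (fun j => tnth th j - tnth t j).
  by apply: eq_from_tnth => j; rewrite tnth_mktuple addrC subrK.
move=> j; have /andP[] := H j.
rewrite /corner /= ler_norml; case: (ltP (tnth t j) pi) => _ h1 h2; apply/andP; split; lra.
Qed.

Lemma corner_box_sub t r s : 0 <= s -> s <= r -> corner_box t s `<=` corner_box t r.
Proof.
move=> s0 sr th H j; have /andP[] := H j.
by rewrite /corner /=; case: (ltP (tnth t j) pi) => _ h1 h2; apply/andP; split; lra.
Qed.

Lemma measurable_corner_box t r : measurable (corner_box t r).
Proof. exact: measurable_box. Qed.

End trigonometric_polynomials.

(** * Nonnegative polynomials and their zeros *)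

Section positivity.
Variables (R : realType) (d : nat) (L : {fset 'rV[int]_d}).
Hypothesis L_sym : forall k, k \in L -> - k \in L.
Implicit Types (q : mseq R L) (th t : d.-tuple R).

(** Around [t] the polynomial is a combination of characters in the increment, with the coefficients
    multiplied by [cexp (- dotp k t)], which do not vanish; the characters are independent on any
    small cube. *)
Lemma trigpoly_eq0_near q t (r : R) : symmetric_mseq R L q -> 0 < r ->
  (forall x, (forall j, `|x j| < r) -> trigpoly q (shift t x) = 0) -> q = 0.
Proof.
move=> sq r0 q0; apply/rowP => i; rewrite mxE -coef_freq.
have := @characters_independent R d L
  (fun k => (coef q k)%:C%C * cexp (- dotp k t)) r (fset_uniq _) r0 _ (freq i) (freq_in i).
move=> /(_ _)/eqP; rewrite mulf_eq0 (negPf (cexp_neq0 _)) orbF => H.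
suff /H : forall x, (forall j, `|x j| < r) ->
    \sum_(k <- L) (coef q k)%:C%C * cexp (- dotp k t) * cexp (- phase k x) = 0.
  by move=> /eqP[].
move=> x xr.
transitivity (trigpolyC q (shift t x)).
  by apply: eq_bigr => k _; rewrite dotp_shift opprD cexpD mulrA.
by rewrite trigpolyC_real// q0.
Qed.

Lemma trigpoly_eq0 q : symmetric_mseq R L q -> (forall th, trigpoly q th = 0) -> q = 0.
Proof.
by move=> sq q0; apply: (@trigpoly_eq0_near q [tuple 0 | j < d] 1).
Qed.

(** The polynomial is nonzero at some point near [t], hence, being Lipschitz, on a whole box of
    positive measure, where [f] is positive. *)
Lemma trigpoly_Rintegral_gt0 q (f : d.-tuple R -> R) t (r : R) :
  symmetric_mseq R L q -> q != 0 -> 0 < r -> torus_fun f ->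
  (torus_measure R d).-integrable setT (EFin \o f) ->
  (forall th, 0 <= f th) ->
  (forall x, (forall j, `|x j| < r) -> trigpoly q (shift t x) != 0 ->
    0 < f (shift t x)) ->
  0 < \int[torus_measure R d]_th f th.
Proof.
move=> sq q0 r0 tf fi f0 fpos.
have r20 : 0 < r / 2 by lra.
have [x xr qx] : exists2 x, (forall j, `|x j| < r / 2) & trigpoly q (shift t x) != 0.
  apply: contrapT => H; move/eqP: q0; apply; apply: (@trigpoly_eq0_near q t (r / 2)) => //.
  move=> x xr; apply/eqP; apply: contrapT => qx; apply: H; exists x => //.
  exact/negP.
set u := shift t x in qx; pose C := lip_const q + 1.
have l0 : 0 <= lip_const q by apply: sumr_ge0 => i _; rewrite mulr_ge0// sumr_ge0.
have C0 : 0 < C by rewrite /C; lra.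
have n0 : 0 < `|trigpoly q u| by rewrite normr_gt0.
(* The three bounds serve in turn to fit the box in the cube, to stay within distance [r] of [t],
   and to keep the variation of [q] below its value at [u]. *)
pose s := Num.min pi (Num.min (r / 2 / 2) (`|trigpoly q u| / C / 2)).
have pi0 := pi_gt0 R.
have qC0 : 0 < `|trigpoly q u| / C by rewrite divr_gt0.
have s0 : 0 < s by rewrite /s !lt_min pi0 /=; apply/andP; split; lra.
have sp : s <= pi by rewrite /s ge_min lexx.
have sr : s < r / 2 by rewrite /s !gt_min; apply/orP; right; apply/orP; left; lra.
have sC : C * s < `|trigpoly q u|.
  rewrite mulrC -ltr_pdivlMr// /s !gt_min; apply/orP; right; apply/orP; right; lra.
have tu := torus_repr_torus u.
apply: (@Rintegral_gt0 _ _ _ _ f (corner_box (torus_repr u) s) fi f0).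
- exact: measurable_corner_box.
- rewrite measure_corner_box ?(ltW s0)//. rewrite lte_fin exprn_gt0// divr_gt0//.
  exact: two_pi_gt0.
move=> th /(corner_box_shift (ltW s0))[y -> ys].
rewrite torus_repr_shift//.
have -> : shift u y = shift t (fun j => x j + y j).
  by apply: eq_from_tnth => j; rewrite !tnth_mktuple addrA.
apply: fpos => [j|].
  by rewrite (le_lt_trans (ler_normD _ _))//; have := xr j; have := ys j; lra.
have -> : shift t (fun j => x j + y j) = shift u y.
  by apply: eq_from_tnth => j; rewrite !tnth_mktuple addrA.
apply/eqP => qy; have := trigpoly_lipschitz q u ys.
rewrite qy sub0r normrN leNgt => /negP; apply.
by rewrite (le_lt_trans _ sC)// ler_wpM2r ?ltW// /C; lra.
Qed.

Definition Pge : set (mseq R L) :=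
  [set q | symmetric_mseq R L q /\ forall th, 0 <= trigpoly q th].

(** If the constant coefficient were at most 0, the rest would be a nonnegative cosine sum without
    constant term, hence zero, and then the whole polynomial would vanish. *)
Lemma Pge_coef0_gt0 q : 0 \in L -> Pge q -> q != 0 -> 0 < coef q 0.
Proof.
move=> L0 [sq q_ge0] q0.
pose g th := \sum_(k <- [seq k <- L | k != 0]) coef q k * cos (dotp k th).
have gE th : trigpoly q th = coef q 0 + g th.
  rewrite trigpolyE (bigD1_seq 0) ?fset_uniq//= /g big_filter; congr (_ + _).
  rewrite (_ : dotp 0 th = 0) ?cos0 ?mulr1// /dotp big1// => j _.
  by rewrite mxE mul0r.
rewrite ltNge; apply/negP => c0.
have g0 th : 0 <= g th by have := q_ge0 th; rewrite gE; lra.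
have {}g0 th : g th = 0.
  by apply: ge0_cos_sum_eq0 => //; rewrite mem_filter eqxx.
case/eqP: q0; apply: trigpoly_eq0 => // th.
by have := q_ge0 th; rewrite gE g0; lra.
Qed.

Hypothesis d_gt0 : (0 < d)%N.

(* If the minimum is at most [C r ^ 2], the integrand is at least [c r ^ (- 2 n)] on
   the shell of size [r] around a minimum point, whose volume is [c' r ^ d] with
   [d <= 2 n].  So each dyadic shell contributes a constant, and a small minimum
   leaves room for many of them. *)
Lemma trigpoly_lb_of_integral (B M : R) n : (d <= n.*2)%N -> exists2 de : R, 0 < de &
  forall q, `|q| <= B -> (forall th, 0 <= trigpoly q th) ->
    (\int[torus_measure R d]_th ((trigpoly q th ^+ n)%:E)^-1 <= M%:E)%E ->
    forall th, de <= trigpoly q th.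
Proof.
(* By [trigpoly_near_min], [C * r ^+ 2] bounds the increase of [q] at distance [r] from its minimum,
   whenever [q] has norm at most [B]. *)
move=> dn; pose C := quad_const R L * `|B| + 1.
have C0 : 0 < C.
  by have := mulr_ge0 (quad_const_ge0 R L) (normr_ge0 B); rewrite /C; lra.
have p0 := two_pi_gt0 R.
(* The contribution of one shell: the factor of the integrand that is free of [r], times the measure
   of a shell divided by [r ^+ d]. *)
pose c := ((2 * C) ^+ n)^-1 * ((1 - (2^-1) ^+ d) * ((2 * pi) ^+ d)^-1).
have d2 : 0 < 1 - (2^-1 : R) ^+ d.
  by rewrite subr_gt0 exprn_ilt1 -?lt0n// ?invr_ge0// invf_lt1// ltr1n.
have C20 : 0 < 2 * C by rewrite mulr_gt0.
have c0 : 0 < c by rewrite /c !mulr_gt0// invr_gt0 exprn_gt0.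
(* The number of shells whose total contribution exceeds [M]. *)
pose m := `|Num.ceil (`|M| / c)|.+1.
have cm : M < c * m%:R.
  rewrite mulrC -ltr_pdivrMr// (le_lt_trans (_ : _ <= `|M| / c))//.
    by rewrite ler_pM2r ?invr_gt0// ler_norm.
  have M0 : 0 <= `|M| / c by rewrite divr_ge0// ltW.
  rewrite (le_lt_trans (ceil_ge _))// /m -addn1 natrD pmulrn.
  rewrite gez0_abs ?ltrDl//.
  by rewrite -(ler_int R) (le_trans M0)// ceil_ge.
exists (C * (1 / 2 ^+ m) ^+ 2); first by rewrite mulr_gt0// exprn_gt0// divr_gt0// exprn_gt0.
move=> q qB q_ge0 intM.
have [th0 tth0 qmin] := trigpoly_min q.
move=> th; apply: le_trans (qmin th); rewrite leNgt; apply/negP => small.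
have mg : measurable_fun setT (fun th => ((trigpoly q th ^+ n)%:E)^-1)%E.
  by apply: measurable_inveE; have [] := bmeasX n (bmeas_trigpoly q).
have g0 u : (0 <= ((trigpoly q u ^+ n)%:E)^-1)%E.
  by rewrite inve_ge0 lee_fin exprn_ge0.
(* Induction on the number [k] of shells: the box of side [r] is the outer shell together with the
   box of side [r / 2], which contains the other ones. *)
suff key r k : 0 < r -> r <= 1 -> trigpoly q th0 <= C * (r / 2 ^+ k) ^+ 2 ->
    ((c * k%:R)%:E <= \int[torus_measure R d]_(u in corner_box th0 r)
       ((trigpoly q u ^+ n)%:E)^-1)%E.
  have := key 1 m ltr01 (lexx _) (ltW small); apply/negP; rewrite -ltNge.
  apply: le_lt_trans (_ : M%:E < _)%E; last by rewrite lte_fin.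
  apply: le_trans intM; apply: ge0_subset_integral => //.
  exact: measurable_corner_box.
have pi2 := pi_ge2 R.
elim: k r => [|k IH] r r0 r1 small'.
  by rewrite mulr0; exact: integral_ge0.
have r20 : 0 < r / 2 by rewrite divr_gt0.
have r2r : r / 2 <= r by rewrite ler_pdivrMr// ler_peMr ?(ltW r0)// ler1n.
have rpi : r <= pi by apply: (le_trans r1); apply: le_trans pi2; rewrite ler1n.
have e : r / 2 / 2 ^+ k = r / 2 ^+ k.+1 by rewrite exprS invfM mulrA.
have {}IH := IH (r / 2) r20 _ _; rewrite e in IH.
have {}IH := IH (le_trans r2r r1) small'.
have sub := @corner_box_sub R d th0 r (r / 2) (ltW r20) r2r.
have mb s := @measurable_corner_box R d th0 s.
have mD : measurable (corner_box th0 r `\` corner_box th0 (r / 2)).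
  exact: measurableD.
rewrite -(setDUK sub) ge0_integral_setU//; last 2 first.
- exact: measurable_funTS.
- by apply/disj_setPS; rewrite setDIK.
rewrite -addn1 natrD mulrDr mulr1 EFinD; apply: leeD => //.
pose a := ((2 * C * r ^+ 2) ^+ n)^-1.
apply: (@le_trans _ _ (\int[torus_measure R d]_(u in
    corner_box th0 r `\` corner_box th0 (r / 2)) cst a%:E u)%E); last first.
  apply: ge0_le_integral => //.
  - by move=> u _ /=; rewrite lee_fin invr_ge0 exprn_ge0// mulr_ge0// ?sqr_ge0// ltW.
  - exact: measurable_funTS.
  move=> u [/(corner_box_shift (ltW r0))[x -> xr] _] /=.
  rewrite inver; case: ifPn => [|q0]; first by rewrite leey.
  have := trigpoly_near_min (ltW r0) qmin xr.
  set Q := trigpoly q _ => QC.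
  (* [Q ^+ n != 0] implies [Q != 0] because [n] is positive, as [0 < d <= n.*2]. *)
  have Q0 : 0 < Q.
    rewrite lt_neqAle q_ge0 andbT eq_sym; apply: contraNneq q0 => Q0.
    by rewrite -/Q Q0 expr0n; case: (n) dn => //; rewrite leqNgt d_gt0.
  rewrite lee_fin lef_pV2 ?posrE ?exprn_gt0// ?mulr_gt0 ?exprn_gt0//.
  rewrite lerXn2r// ?nnegrE ?(ltW Q0)// ?mulr_ge0 ?exprn_ge0 ?(ltW r0) ?(ltW C0)//.
  apply: le_trans QC _.
  have h1 : trigpoly q th0 <= C * r ^+ 2.
    apply: le_trans small' _; rewrite ler_pM2l//.
    have k2 : 0 < 2 ^+ k.+1 :> R by rewrite exprn_gt0.
    have r2k : 0 <= r / 2 ^+ k.+1 by rewrite divr_ge0 ?ltW.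
    rewrite lerXn2r// ?nnegrE ?(ltW r0)// ler_pdivrMr// ler_peMr ?(ltW r0)//.
    by rewrite exprn_ege1// ler1n.
  have h2 : quad_const R L * `|q| * r ^+ 2 <= C * r ^+ 2.
    rewrite ler_wpM2r ?sqr_ge0// /C.
    rewrite (@le_trans _ _ (quad_const R L * `|B|)) ?lerDl//.
    by rewrite ler_wpM2l ?quad_const_ge0// (le_trans qB)// ler_norm.
  by rewrite (_ : 2 * C * r ^+ 2 = C * r ^+ 2 + C * r ^+ 2) ?lerD//; ring.
have mE s : 0 <= s -> s <= pi -> torus_measure R d (corner_box th0 s) =
    ((s / (2 * pi)) ^+ d)%:E by exact: measure_corner_box.
rewrite integral_cst//.
rewrite [X in (_ <= _ * X)%E](_ : _ =
    ((r / (2 * pi)) ^+ d - (r / 2 / (2 * pi)) ^+ d)%:E); last first.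
  rewrite measureD//; last first.
    by apply: (le_lt_trans (probability_le1 (torus_measure R d) (mb r))); rewrite ltry.
  rewrite (_ : corner_box th0 r `&` _ = corner_box th0 (r / 2)); last exact/setIidPr.
  rewrite EFinB; congr (_ - _)%E; apply: mE; rewrite ?(ltW r0) ?(ltW r20)//.
  exact: le_trans r2r rpi.
rewrite -EFinM lee_fin.
have -> : (r / (2 * pi)) ^+ d - (r / 2 / (2 * pi)) ^+ d =
    r ^+ d * ((1 - 2^-1 ^+ d) * ((2 * pi) ^+ d)^-1).
  by rewrite !exprMn !exprVn !exprMn; ring.
rewrite /c /a (mulrA _ (r ^+ d)) ler_pM2r; last by rewrite mulr_gt0// invr_gt0 exprn_gt0.
rewrite [in leRHS]exprMn invfM -mulrA ler_peMr//.
  by rewrite invr_ge0 exprn_ge0// ltW.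
(* What remains is [r ^+ n.*2 <= r ^+ d], the point where [d <= n.*2] and [r <= 1] meet. *)
rewrite mulrC ler_pdivlMr ?mul1r ?exprn_gt0 ?exprn_gt0//.
by rewrite -exprM mul2n ler_wiXn2l// ltW.
Qed.

End positivity.

(** * Differentiation under the integral sign *)

Section uniform_convergence.
Context {R : realType} {X T : Type} {F : set_system X} {FF : Filter F}.
Implicit Types (f : X -> T -> R) (g : T -> R).

(** Uniformity in [t] is what lets limits pass under the integral, in [ucvg_Rintegral]. *)
Definition ucvg f g :=
  forall e : R, 0 < e -> \forall x \near F, forall t, `|f x t - g t| <= e.

Definition ubounded g := exists C, forall t, `|g t| <= C.

Lemma uboundedP g : ubounded g -> exists2 C, 0 < C & forall t, `|g t| <= C.
Proof.
move=> [C gC]; exists (`|C| + 1) => [|t]; first by have := normr_ge0 C; lra.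
by have := ler_norm C; have := gC t; lra.
Qed.

Lemma ucvg_cst g : ucvg (fun=> g) g.
Proof. by move=> e e0; near=> x => t; rewrite subrr normr0 ltW. Unshelve. all: by end_near. Qed.

Lemma ucvgD f f' g g' : ucvg f g -> ucvg f' g' ->
  ucvg (fun x t => f x t + f' x t) (fun t => g t + g' t).
Proof.
move=> fg fg' e e0; have e20 : 0 < e / 2 by lra.
have := fg _ e20; have := fg' _ e20; apply: filterS2 => x h1 h2 t.
rewrite opprD addrACA (le_trans (ler_normD _ _))//.
by have := h1 t; have := h2 t; lra.
Qed.

Lemma ucvgM f f' g g' : ubounded g -> ubounded g' -> ucvg f g -> ucvg f' g' ->
  ucvg (fun x t => f x t * f' x t) (fun t => g t * g' t).
Proof.
move=> /uboundedP[C C0 gC] /uboundedP[D D0 gD] fg fg' e e0.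
(* The bound 1 makes [f] eventually at most [C + 1] in absolute value; the other bounds give each of
   the two terms half of [e]. *)
have h1 : 0 < Num.min 1 (e / 2 / D) by rewrite lt_min ltr01/= divr_gt0//; lra.
have h2 : 0 < e / 2 / (C + 1) by rewrite divr_gt0//; lra.
have := fg _ h1; have := fg' _ h2; apply: filterS2 => x k' k t.
have -> : f x t * f' x t - g t * g' t =
  (g t + (f x t - g t)) * (f' x t - g' t) + (f x t - g t) * g' t by ring.
rewrite (le_trans (ler_normD _ _))// !normrM.
have {}k := k t; rewrite le_min in k; have /andP[k1 k2] := k.
have : `|g t + (f x t - g t)| * `|f' x t - g' t| <= (C + 1) * (e / 2 / (C + 1)).
  by apply: ler_pM => //; rewrite (le_trans (ler_normD _ _))// lerD.
have : `|f x t - g t| * `|g' t| <= (e / 2 / D) * D by exact: ler_pM.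
have -> : (e / 2 / D) * D = e / 2 by rewrite divfK// gt_eqF.
have -> : (C + 1) * (e / 2 / (C + 1)) = e / 2.
  by rewrite mulrC divfK// gt_eqF//; lra.
lra.
Qed.

Lemma ucvg_sum (I : Type) (s : seq I) (f : I -> X -> T -> R) (g : I -> T -> R) :
  (forall i, ucvg (f i) (g i)) ->
  ucvg (fun x t => \sum_(i <- s) f i x t) (fun t => \sum_(i <- s) g i t).
Proof.
move=> H; elim: s => [|i s IH].
  move=> e e0; near=> x => t; rewrite !big_nil subrr normr0; exact: ltW.
have := ucvgD (H i) IH => K e e0; apply: filterS (K e e0) => x + t => /(_ t).
by rewrite !big_cons.
Unshelve. all: by end_near. Qed.

Lemma ucvgV f g c : 0 < c -> (forall t, c <= g t) -> ucvg f g ->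
  ucvg (fun x t => (f x t)^-1) (fun t => (g t)^-1).
Proof.
move=> c0 cg fg e e0.
have h : 0 < Num.min (c / 2) (e * (c * (c / 2))).
  by rewrite lt_min !mulr_gt0//; lra.
have := fg _ h; apply: filterS => x k t.
have := k t; rewrite le_min => /andP[k1 k2].
have gt0 := lt_le_trans c0 (cg t).
have f0 : c / 2 <= f x t.
  by move: k1; rewrite ler_norml => /andP[+ _]; have := cg t; lra.
have ft0 : 0 < f x t by lra.
have -> : (f x t)^-1 - (g t)^-1 = (g t - f x t) / (g t * f x t).
  by rewrite invfM mulrA mulrBl divff ?gt_eqF// mulrBl mul1r -mulrA (mulrC (g t)^-1) mulrA divff ?gt_eqF// mul1r.
rewrite normrM distrC normfV ler_pdivrMr; last by rewrite normr_gt0 mulf_neq0// gt_eqF.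
apply: le_trans k2 _; rewrite ler_pM2l// ger0_norm ?mulr_ge0 ?(ltW gt0) ?(ltW ft0)//.
by apply: ler_pM => //; lra.
Qed.

End uniform_convergence.

Lemma ucvg_Rintegral {R : realType} {X : Type} {F : set_system X} {FF : Filter F}
    {disp} {T : measurableType disp} (mu : probability T R) (f : X -> T -> R) g :
  ucvg (F := F) f g -> bmeas g -> (\forall x \near F, bmeas (f x)) ->
  \int[mu]_t f x t @[x --> F] --> \int[mu]_t g t.
Proof.
move=> fg bg bf; apply/cvgrPdist_le => e e0.
have := fg e e0; apply: filterS2 bf => x bfx k.
rewrite distrC -RintegralB//; [|exact: bmeas_integrable|exact: bmeas_integrable].
by apply: norm_Rintegral_le => //; exact: bmeasB.
Qed.

Lemma near_dist_le {R : realType} {V : normedModType R} (x : V) (e : R) :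
  0 < e -> \forall y \near x, `|x - y| <= e.
Proof. by move=> e0; apply: (@cvgr_dist_le _ _ _ (nbhs x) _ id x _ e e0); exact: cvg_id. Qed.

(** * Partial derivatives of integrands in the coefficients *)

Section caratheodory.
Variables (R : realType) (d : nat) (L0 L1 : {fset 'rV[int]_d}).
Local Notation V := (mseq R L0 * mseq R L1)%type.
Local Notation J := ('I_#|{: L0}| + 'I_#|{: L1}|)%type.
Local Notation T := (d.-tuple R).
Local Notation mu := (torus_measure R d).
Implicit Types (x y : V) (j : J) (Phi Psi : V -> T -> R).

(** The polynomial P with its constant coefficient 1 restored, for an arbitrary index set [L0]; see
    [numPE] for the link with [extend]. *)
Definition numP x (th : T) : R := 1 + trigpoly x.1 th.
Definition denQ x (th : T) : R := trigpoly x.2 th.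

Definition coord x j : R :=
  match j with inl i => x.1 0 i | inr i => x.2 0 i end.

(** The partial derivative of [numP] in the coordinate [j], hence zero on the coordinates of Q. *)
Definition basisP j (th : T) : R :=
  if j is inl i then cos (dotp (freq i) th) else 0.
Definition basisQ j (th : T) : R :=
  if j is inr i then cos (dotp (freq i) th) else 0.

Lemma sum_coordP (u : V) th : trigpoly u.1 th = \sum_j coord u j * basisP j th.
Proof.
rewrite trigpoly_freq big_sumType/= [X in _ + X]big1 ?addr0//.
by move=> i _; rewrite mulr0.
Qed.

Lemma sum_coordQ (u : V) th : trigpoly u.2 th = \sum_j coord u j * basisQ j th.
Proof.
rewrite trigpoly_freq big_sumType/= [X in X + _]big1 ?add0r//.
by move=> i _; rewrite mulr0.
Qed.

Lemma coordB x y j : coord (x - y) j = coord x j - coord y j.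
Proof. by case: j => i /=; rewrite !mxE. Qed.

Lemma coordZ a x j : coord (a *: x) j = a * coord x j.
Proof. by case: j => i /=; rewrite !mxE. Qed.

Lemma coord_eq x y : (forall j, coord x j = coord y j) -> x = y.
Proof.
case: x y => [p q] [p' q'] H; congr (_, _).
  by apply/rowP => i; exact: (H (inl i)).
by apply/rowP => i; exact: (H (inr i)).
Qed.

Lemma norm_fst x : `|x.1| <= `|x|.
Proof. by rewrite prod_normE le_max lexx. Qed.

Lemma norm_snd x : `|x.2| <= `|x|.
Proof. by rewrite prod_normE le_max lexx orbT. Qed.

Lemma norm_coord_le x j : `|coord x j| <= `|x|.
Proof.
case: j => i /=; rewrite (le_trans (norm_coord _ _))//.
  exact: norm_fst.
exact: norm_snd.
Qed.

Lemma pair_coord_continuous j : continuous (fun x => coord x j).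
Proof.
move=> x; apply/cvgrPdist_le => e e0; apply: filterS (near_dist_le x e0) => y xy.
by rewrite -coordB (le_trans (norm_coord_le _ _)).
Qed.

Lemma numPB x y th : numP y th - numP x th = \sum_j (coord y j - coord x j) * basisP j th.
Proof.
rewrite /numP opprD addrACA subrr add0r -trigpolyB.
rewrite (_ : y.1 - x.1 = (y - x).1)// sum_coordP.
by apply: eq_bigr => j _; rewrite coordB.
Qed.

Lemma denQB x y th : denQ y th - denQ x th = \sum_j (coord y j - coord x j) * basisQ j th.
Proof.
rewrite /denQ -trigpolyB (_ : y.2 - x.2 = (y - x).2)// sum_coordQ.
by apply: eq_bigr => j _; rewrite coordB.
Qed.

(** Symmetry is left out, so that this set is open in the whole space; intersected with [sym2] it is
    the domain of the theorem, see [domainP]. The uniform bound [de] makes inverses bounded. *)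
Definition posPQ : set V :=
  [set x | exists2 de, 0 < de & forall th, de <= numP x th /\ de <= denQ x th].

Lemma bmeas_numP x : bmeas (numP x).
Proof. by apply: bmeasD; [exact: bmeas_cst|exact: bmeas_trigpoly]. Qed.

Lemma bmeas_denQ x : bmeas (denQ x).
Proof. exact: bmeas_trigpoly. Qed.

Lemma bmeas_basisP j : bmeas (basisP j).
Proof. by case: j => i; [exact: bmeas_cos|exact: bmeas_cst]. Qed.

Lemma bmeas_basisQ j : bmeas (basisQ j).
Proof. by case: j => i; [exact: bmeas_cst|exact: bmeas_cos]. Qed.

(* A uniform Caratheodory form of differentiability: the increment of [Phi] is
   linear in the increment of the coordinates, with coefficients [K] that
   converge to the partial derivatives [dPhi]. *)
Definition cara x Phi (dPhi : J -> T -> R) : Prop :=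
  [/\ forall y, posPQ y -> bmeas (Phi y),
      forall j, bmeas (dPhi j)
    & exists K : J -> V -> T -> R,
      [/\ forall y, posPQ y -> forall th,
            Phi y th - Phi x th = \sum_j (coord y j - coord x j) * K j y th,
          forall j, ucvg (F := nbhs x) (K j) (dPhi j)
        & forall j y, posPQ y -> bmeas (K j y)]].

Lemma cara_ucvg x Phi dPhi : posPQ x -> (\forall y \near x, posPQ y) ->
  cara x Phi dPhi -> ucvg (F := nbhs x) Phi (Phi x).
Proof.
move=> Dx nD [bPhi bd [K [KE Kc _]]].
have H : ucvg (F := nbhs x) (fun y th => \sum_j (coord y j - coord x j) * K j y th)
    (fun th => \sum_j 0 * dPhi j th).
  apply: ucvg_sum => j; apply: ucvgM => //.
  - by exists 0 => _; rewrite normr0.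
  - by case: (bd j).
  move=> e e0; have := @pair_coord_continuous j x.
  move=> /cvgrPdist_le /(_ e e0); apply: filterS => y + _.
  by rewrite subr0 distrC.
move=> e e0; apply: filterS2 nD (H e e0) => y Dy + th => /(_ th).
rewrite [X in _ - X]big1 ?subr0 ?KE// => j _; exact: mul0r.
Qed.

Lemma cara_numP x : cara x numP basisP.
Proof.
split; [by move=> y _; exact: bmeas_numP|exact: bmeas_basisP|].
exists (fun j _ => basisP j); split.
- by move=> y _ th; exact: numPB.
- by move=> j; exact: ucvg_cst.
- by move=> j y _; exact: bmeas_basisP.
Qed.

Lemma cara_denQ x : cara x denQ basisQ.
Proof.
split; [by move=> y _; exact: bmeas_denQ|exact: bmeas_basisQ|].
exists (fun j _ => basisQ j); split.
- by move=> y _ th; exact: denQB.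
- by move=> j; exact: ucvg_cst.
- by move=> j y _; exact: bmeas_basisQ.
Qed.

Lemma cara_cst x (psi : T -> R) : bmeas psi ->
  cara x (fun _ => psi) (fun _ _ => 0).
Proof.
move=> bpsi; split => //; first by move=> j; exact: bmeas_cst.
exists (fun _ _ _ => 0); split.
- by move=> y _ th; rewrite subrr big1// => j _; rewrite mulr0.
- by move=> j; exact: ucvg_cst.
- by move=> j y _; exact: bmeas_cst.
Qed.

Section rules.
Variable x : V.
Hypotheses (Dx : posPQ x) (nD : \forall y \near x, posPQ y).

Lemma caraD Phi Psi dPhi dPsi : cara x Phi dPhi -> cara x Psi dPsi ->
  cara x (fun y th => Phi y th + Psi y th) (fun j th => dPhi j th + dPsi j th).
Proof.
move=> [b bd [K [KE Kc bK]]] [b' bd' [K' [KE' Kc' bK']]]; split.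
- by move=> y Dy; apply: bmeasD; [exact: b|exact: b'].
- by move=> j; exact: bmeasD.
exists (fun j y th => K j y th + K' j y th); split.
- move=> y Dy th; rewrite opprD addrACA KE// KE'// -big_split.
  by apply: eq_bigr => j _ /=; rewrite mulrDr.
- by move=> j; exact: ucvgD.
- by move=> j y Dy; apply: bmeasD; [exact: bK|exact: bK'].
Qed.

(** The increment of a product splits as [(Phi y - Phi x) * Psi y + Phi x * (Psi y - Psi x)]; the
    factor [Psi y] converges uniformly by [cara_ucvg]. *)
Lemma caraM Phi Psi dPhi dPsi : cara x Phi dPhi -> cara x Psi dPsi ->
  cara x (fun y th => Phi y th * Psi y th)
    (fun j th => dPhi j th * Psi x th + Phi x th * dPsi j th).
Proof.
move=> cPhi cPsi; have uPsi := cara_ucvg Dx nD cPsi.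
have [b bd [K [KE Kc bK]]] := cPhi; have [b' bd' [K' [KE' Kc' bK']]] := cPsi; split.
- by move=> y Dy; apply: bmeasM; [exact: b|exact: b'].
- by move=> j; apply: bmeasD; apply: bmeasM => //; [exact: b'|exact: b].
exists (fun j y th => K j y th * Psi y th + Phi x th * K' j y th); split.
- move=> y Dy th.
  rewrite (_ : Phi y th * _ - _ =
    (Phi y th - Phi x th) * Psi y th + Phi x th * (Psi y th - Psi x th)); last by ring.
  rewrite KE// KE'// mulr_suml mulr_sumr -big_split.
  by apply: eq_bigr => j _ /=; ring.
- have [_ uP] := b x Dx; have [_ uQ] := b' x Dx.
  move=> j; have [_ ud] := bd j; have [_ ud'] := bd' j.
  apply: ucvgD; apply: ucvgM => //; exact: ucvg_cst.
- move=> j y Dy; apply: bmeasD; apply: bmeasM; [exact: bK|exact: b'|exact: b|exact: bK'].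
Qed.

Lemma caraV Phi dPhi :
  (forall y, posPQ y -> exists2 c, 0 < c & forall th, c <= Phi y th) ->
  cara x Phi dPhi ->
  cara x (fun y th => (Phi y th)^-1)
    (fun j th => - dPhi j th * ((Phi x th)^-1 * (Phi x th)^-1)).
Proof.
move=> Phi_gt0 cPhi; have uPhi := cara_ucvg Dx nD cPhi.
have [b bd [K [KE Kc bK]]] := cPhi.
have bV y : posPQ y -> bmeas (fun th => (Phi y th)^-1).
  by move=> Dy; have [c c0 cP] := Phi_gt0 y Dy; apply: (bmeasV c0 cP); exact: b.
have [c c0 cP] := Phi_gt0 x Dx.
have uV := ucvgV c0 cP uPhi.
split => //.
  by move=> j; apply: bmeasM; [exact: bmeasN|apply: bmeasM; exact: bV].
exists (fun j y th => -1 * K j y th * ((Phi y th)^-1 * (Phi x th)^-1)); split.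
- move=> y Dy th; have [c' c'0 c'P] := Phi_gt0 y Dy.
  have y0 : Phi y th != 0 by rewrite gt_eqF// (lt_le_trans c'0).
  have x0 : Phi x th != 0 by rewrite gt_eqF// (lt_le_trans c0).
  rewrite (_ : (Phi y th)^-1 - _ =
    (Phi y th - Phi x th) * (- 1 * ((Phi y th)^-1 * (Phi x th)^-1))); last by field; rewrite x0 y0.
  by rewrite KE// mulr_suml; apply: eq_bigr => j _; ring.
- have [_ uP] := bV x Dx; move=> j; have [_ ud] := bd j.
  have [_ ub] : bmeas (fun th => (Phi x th)^-1 * (Phi x th)^-1) by apply: bmeasM; exact: bV.
  apply: ucvgM => //.
  + by have [] := bmeasN (bd j).
  + rewrite (_ : (fun t => - dPhi j t) = fun t => -1 * dPhi j t); last first.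
      by apply/funext => t; rewrite mulN1r.
    apply: ucvgM => //; last exact: ucvg_cst.
    by exists 1 => _; rewrite normrN1.
  + by apply: ucvgM => //; [exact: uV|exact: ucvg_cst].
- move=> j y Dy; apply: bmeasM; last by apply: bmeasM; exact: bV.
  by apply: bmeasM; [exact: bmeas_cst|exact: bK].
Qed.

Lemma cara_eq Phi dPhi dPhi' : dPhi =2 dPhi' -> cara x Phi dPhi -> cara x Phi dPhi'.
Proof. by move=> e; have -> : dPhi = dPhi' by apply/funext => j; apply/funext => t. Qed.

Lemma cara_eqf Phi Phi' dPhi : Phi =2 Phi' -> cara x Phi dPhi -> cara x Phi' dPhi.
Proof. by move=> e; have -> : Phi = Phi' by apply/funext => j; apply/funext => t. Qed.

Lemma caraX Phi dPhi n : cara x Phi dPhi ->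
  cara x (fun y th => Phi y th ^+ n)
    (fun j th => n%:R * Phi x th ^+ n.-1 * dPhi j th).
Proof.
move=> cPhi; elim: n => [|n IH].
  apply: cara_eq (cara_cst x (bmeas_cst 1)) => j t.
  by rewrite !mul0r.
apply: (@cara_eqf (fun y th => Phi y th * Phi y th ^+ n)).
  by move=> y th; rewrite exprS.
apply: cara_eq (caraM cPhi IH) => j t /=.
case: n {IH} => [|n]; first by rewrite !expr0; ring.
by rewrite exprS -[in RHS]natr1 /=; ring.
Qed.

(** Differentiation under the integral sign: the exact increment formula is linear, so it integrates
    term by term, and the coefficients converge by uniform convergence. *)
Lemma cara_Rintegral Phi dPhi : cara x Phi dPhi ->
  exists2 k : J -> V -> R,
    forall y, posPQ y -> \int[mu]_th Phi y th - \int[mu]_th Phi x th =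
      \sum_j (coord y j - coord x j) * k j y
  & forall j, k j y @[y --> x] --> \int[mu]_th dPhi j th.
Proof.
move=> [b bd [K [KE Kc bK]]].
exists (fun j y => \int[mu]_th K j y th).
  move=> y Dy; rewrite -RintegralB//; last 2 first.
  - exact/bmeas_integrable/b.
  - exact/bmeas_integrable/b.
  transitivity (\int[mu]_th (\sum_j (coord y j - coord x j) * K j y th)).
    by apply: eq_Rintegral => th _; exact: KE.
  rewrite Rintegral_sum.
    by apply: eq_bigr => j _; rewrite RintegralZl//; exact/bmeas_integrable/bK.
  by move=> j; apply/bmeas_integrable/bmeasM; [exact: bmeas_cst|exact: bK].
move=> j; apply: ucvg_Rintegral => //.
by apply: filterS nD => y Dy; exact: bK.
Qed.

End rules.

Lemma open_posPQ : open posPQ.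
Proof.
rewrite openE => x [de de0 H]; rewrite /interior.
set N : R := #|{: L0}|%:R + #|{: L1}|%:R + 1.
have N0 : 0 < N by rewrite /N ltr_wpDl// addr_ge0.
have e0 : 0 < de / 2 / N by rewrite !divr_gt0.
apply: filterS (near_dist_le x e0) => y yx.
exists (de / 2) => [|th]; first lra.
have nle n (u : R) : n%:R <= N -> u <= `|x - y| -> 0 <= u -> n%:R * u <= de / 2.
  move=> nN ux u0; have -> : de / 2 = N * (de / 2 / N) by rewrite [RHS]mulrC divfK// gt_eqF.
  by apply: ler_pM => //; exact: le_trans yx.
have h1 : `|trigpoly (x - y).1 th| <= de / 2.
  rewrite (le_trans (trigpoly_le_norm _ _))// nle ?norm_fst// /N.
  by have := ler0n R #|{: L1}|; lra.
have h2 : `|trigpoly (x - y).2 th| <= de / 2.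
  rewrite (le_trans (trigpoly_le_norm _ _))// nle ?norm_snd// /N.
  by have := ler0n R #|{: L0}|; lra.
have [HP HQ] := H th; rewrite /numP /denQ in HP HQ *.
move: h1 h2; rewrite !trigpolyB => /ler_normlW h1 /ler_normlW h2; split; lra.
Qed.

Lemma near_posPQ x : posPQ x -> \forall y \near x, posPQ y.
Proof. by move=> Dx; apply: open_nbhs_nbhs; split => //; exact: open_posPQ. Qed.

(** Inverses are those of [numP] and [denQ], bounded below on [posPQ]; hence members are bounded
    there, and the class is stable under partial derivatives by [integrand_cara]. *)
Inductive integrand : (V -> T -> R) -> Prop :=
| integrand_numP : integrand numP
| integrand_denQ : integrand denQ
| integrand_numPV : integrand (fun y th => (numP y th)^-1)
| integrand_denQV : integrand (fun y th => (denQ y th)^-1)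
| integrand_cst psi : bmeas psi -> integrand (fun _ => psi)
| integrandD Phi Psi : integrand Phi -> integrand Psi ->
    integrand (fun y th => Phi y th + Psi y th)
| integrandM Phi Psi : integrand Phi -> integrand Psi ->
    integrand (fun y th => Phi y th * Psi y th).

Lemma numP_lb y : posPQ y -> exists2 c, 0 < c & forall th, c <= numP y th.
Proof. by move=> [c c0 H]; exists c => // th; have [] := H th. Qed.

Lemma denQ_lb y : posPQ y -> exists2 c, 0 < c & forall th, c <= denQ y th.
Proof. by move=> [c c0 H]; exists c => // th; have [] := H th. Qed.

Lemma cara_numPV x : posPQ x -> cara x (fun y th => (numP y th)^-1)
  (fun j th => - basisP j th * ((numP x th)^-1 * (numP x th)^-1)).
Proof.
move=> Dx; apply: caraV => //; [exact: near_posPQ|exact: numP_lb|exact: cara_numP].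
Qed.

Lemma cara_denQV x : posPQ x -> cara x (fun y th => (denQ y th)^-1)
  (fun j th => - basisQ j th * ((denQ x th)^-1 * (denQ x th)^-1)).
Proof.
move=> Dx; apply: caraV => //; [exact: near_posPQ|exact: denQ_lb|exact: cara_denQ].
Qed.

Lemma integrand_cara Phi : integrand Phi ->
  exists2 dPhi : J -> V -> T -> R, forall j, integrand (dPhi j) &
    forall x, posPQ x -> cara x Phi (fun j => dPhi j x).
Proof.
elim=> {Phi}.
- exists (fun j _ => basisP j); last by move=> x _; exact: cara_numP.
  by move=> j; apply: integrand_cst; exact: bmeas_basisP.
- exists (fun j _ => basisQ j); last by move=> x _; exact: cara_denQ.
  by move=> j; apply: integrand_cst; exact: bmeas_basisQ.
- exists (fun j x th => - basisP j th * ((numP x th)^-1 * (numP x th)^-1)); last first.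
    exact: cara_numPV.
  move=> j; apply: integrandM; last by apply: integrandM; exact: integrand_numPV.
  by apply: integrand_cst; apply: bmeasN; exact: bmeas_basisP.
- exists (fun j x th => - basisQ j th * ((denQ x th)^-1 * (denQ x th)^-1)); last first.
    exact: cara_denQV.
  move=> j; apply: integrandM; last by apply: integrandM; exact: integrand_denQV.
  by apply: integrand_cst; apply: bmeasN; exact: bmeas_basisQ.
- move=> psi bpsi; exists (fun _ _ _ => 0); last by move=> x _; exact: cara_cst.
  by move=> j; apply: integrand_cst; exact: bmeas_cst.
- move=> Phi Psi _ [dPhi iPhi cPhi] _ [dPsi iPsi cPsi].
  exists (fun j x th => dPhi j x th + dPsi j x th) => [j|x Dx]; first exact: integrandD.
  by apply: caraD; [exact: cPhi|exact: cPsi].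
- move=> Phi Psi IPhi [dPhi iPhi cPhi] IPsi [dPsi iPsi cPsi].
  exists (fun j x th => dPhi j x th * Psi x th + Phi x th * dPsi j x th) => [j|x Dx].
    by apply: integrandD; exact: integrandM.
  by apply: caraM => //; [exact: near_posPQ|exact: cPhi|exact: cPsi].
Qed.

Lemma integrand_bmeas Phi y : integrand Phi -> posPQ y -> bmeas (Phi y).
Proof. by move=> /integrand_cara[dPhi _ H] Dy; have [b _ _] := H y Dy; exact: b. Qed.

Lemma integrandX Phi n : integrand Phi -> integrand (fun y th => Phi y th ^+ n).
Proof.
move=> iPhi; elim: n => [|n IH]; first exact: (integrand_cst (bmeas_cst 1)).
rewrite (_ : (fun y th => _) = fun y th => Phi y th * Phi y th ^+ n).
  exact: integrandM.
by apply/funext => y; apply/funext => th; rewrite exprS.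
Qed.

End caratheodory.

(** * Functions smooth along a subspace *)

Section directional.
Context {R : realType} {Y W : normedModType R}.
Implicit Types (f g : Y -> W) (y w : Y).

(** The difference quotient is convertible to that of [derivable] and ['D_w f y]; the limit appears
    as an argument, so that existence and value are proved together. *)
Definition has_deriv f y w (l : W) : Prop :=
  h^-1 *: (f (h *: w + y) - f y) @[h --> (0 : R)^'] --> l.

Lemma has_deriv_derivable f y w l : has_deriv f y w l -> derivable f y w.
Proof. by move=> H; apply/cvg_ex; exists l. Qed.

Lemma has_deriv_derive f y w l : has_deriv f y w l -> 'D_w f y = l.
Proof. by move=> H; apply: cvg_lim. Qed.

Lemma derivable_has_deriv f y w : derivable f y w -> has_deriv f y w ('D_w f y).
Proof. by []. Qed.

Lemma has_deriv_eq f g y w l : f y = g y ->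
  (\forall h \near (0 : R)^', f (h *: w + y) = g (h *: w + y)) ->
  has_deriv g y w l -> has_deriv f y w l.
Proof.
move=> e0 e; apply: cvg_trans; apply: near_eq_cvg.
by apply: filterS e => h ->; rewrite e0.
Qed.

Variables (S A : set Y).
(** Relative openness in the only form that directional derivatives require: [A] may lie in a proper
    subspace. *)
Hypothesis A_open : forall y w, A y -> S w ->
  \forall h \near (0 : R)^', A (h *: w + y).

(** By [A_open], difference quotients at points of [A] along [S] only involve values in [A] for
    small [h]. *)
Lemma C_on_eq n f g : (forall y, A y -> f y = g y) -> C_on n S A g -> C_on n S A f.
Proof.
elim: n f g => [|n IH] f g fg [cg Dg]; split => //.
- by apply: subspace_eq_continuous cg => y; rewrite inE => Ay; exact/esym/fg.
- by apply: subspace_eq_continuous cg => y; rewrite inE => Ay; exact/esym/fg.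
move=> w Sw; have [dg Cg] := Dg w Sw.
have H y : A y -> has_deriv f y w ('D_w g y).
  move=> Ay; apply: has_deriv_eq (derivable_has_deriv (dg y Ay)); first exact: fg.
  by apply: filterS (A_open Ay Sw) => h; exact: fg.
split; first by move=> y /H; exact: has_deriv_derivable.
by apply: IH Cg => y Ay; exact: has_deriv_derive (H y Ay).
Qed.

(** A class of continuous functions closed under derivation in the directions of [S] is smooth, by
    induction on the order. *)
Lemma smooth_on_class (cls : (Y -> W) -> Prop) :
  (forall f, cls f -> {within A, continuous f} /\
    forall w, S w -> exists2 f', cls f' & forall y, A y -> has_deriv f y w (f' y)) ->
  forall f, cls f -> smooth_on S A f.
Proof.
move=> H f clsf n; elim: n f clsf => [|n IH] f clsf; have [cf Df] := H f clsf.
  by split.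
split => // w Sw; have [f' clsf' f'E] := Df w Sw; split.
  by move=> y /f'E; exact: has_deriv_derivable.
by apply: C_on_eq (IH f' clsf') => y /f'E; exact: has_deriv_derive.
Qed.

End directional.

Lemma cvg_near_eq {T : Type} {U : topologicalType} {F : set_system T} {FF : Filter F}
  (f g : T -> U) (l : U) :
  f x @[x --> F] --> l -> (\forall x \near F, g x = f x) -> g x @[x --> F] --> l.
Proof.
move=> fl fg; apply: cvg_trans fl; apply: near_eq_cvg.
by apply: filterS fg => x ->.
Qed.

Section directional_scalar.
Context {R : realType} {Y : normedModType R}.
Implicit Types (f g : Y -> R) (y w : Y).

Lemma has_deriv_cst y w (c : R) : has_deriv (fun=> c : R^o) y w 0.
Proof.
rewrite /has_deriv (_ : (fun h : R => _) = fun=> 0); first exact: cvg_cst.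
by apply/funext => h; rewrite subrr scaler0.
Qed.

Lemma has_deriv_cvg f y w (l : R) : has_deriv (f : Y -> R^o) y w l ->
  f (h *: w + y) @[h --> (0 : R)^'] --> f y.
Proof.
move=> fl.
apply: (@cvg_near_eq _ _ _ _ (fun h => f y + h * (h^-1 * (f (h *: w + y) - f y)))).
  rewrite -[X in _ --> X](_ : f y + 0 * l = f y); last by rewrite mul0r addr0.
  apply: cvgD; first exact: cvg_cst.
  by apply: cvgM; [exact: nbhs_dnbhs|exact: fl].
near=> h; have hn0 : h != 0 by near: h; exact: nbhs_dnbhs_neq.
by rewrite mulrA divff// mul1r [RHS]addrC subrK.
Unshelve. all: by end_near. Qed.

Lemma has_derivD f g y w (l m : R) : has_deriv (f : Y -> R^o) y w l ->
  has_deriv (g : Y -> R^o) y w m -> has_deriv (fun z => f z + g z : R^o) y w (l + m).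
Proof.
move=> fl gm.
apply: (@cvg_near_eq _ _ _ _ (fun h => h^-1 *: (f (h *: w + y) - f y : R^o) +
    h^-1 *: (g (h *: w + y) - g y : R^o))); first exact: cvgD.
by near=> h; rewrite -scalerDr opprD addrACA.
Unshelve. all: by end_near. Qed.

Lemma has_derivM f g y w (l m : R) : has_deriv (f : Y -> R^o) y w l ->
  has_deriv (g : Y -> R^o) y w m ->
  has_deriv (fun z => f z * g z : R^o) y w (l * g y + f y * m).
Proof.
move=> fl gm; have gc := has_deriv_cvg gm.
apply: (@cvg_near_eq _ _ _ _ (fun h => h^-1 * (f (h *: w + y) - f y) * g (h *: w + y) +
    f y * (h^-1 * (g (h *: w + y) - g y)))).
  by apply: cvgD; apply: cvgM => //; exact: cvg_cst.
by near=> h; rewrite /GRing.scale /=; ring.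
Unshelve. all: by end_near. Qed.

Lemma has_derivV f y w (l : R) : f y != 0 -> has_deriv (f : Y -> R^o) y w l ->
  has_deriv (fun z => (f z)^-1 : R^o) y w (- l * ((f y)^-1 * (f y)^-1)).
Proof.
move=> fy0 fl; have fc := has_deriv_cvg fl.
apply: (@cvg_near_eq _ _ _ _ (fun h => - (h^-1 * (f (h *: w + y) - f y)) *
    ((f (h *: w + y))^-1 * (f y)^-1))).
  apply: cvgM; first exact: cvgN.
  by apply: cvgM; [exact: cvgV|exact: cvg_cst].
near=> h; have fh0 : f (h *: w + y) != 0 by near: h; exact: cvgr_neq0 fc fy0.
rewrite /GRing.scale /= -mulrN -mulrA; congr (_ * _).
by field; rewrite fh0 fy0.
Unshelve. all: by end_near. Qed.

End directional_scalar.

(** * The differential algebra generated by integrals *)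

Section integral_algebra.
Context {R : realType} {d : nat} {L0 L1 : {fset 'rV[int]_d}} {Y : normedModType R}.
Local Notation V := (mseq R L0 * mseq R L1)%type.
Local Notation J := ('I_#|{: L0}| + 'I_#|{: L1}|)%type.
Local Notation mu := (torus_measure R d).
Variables (S A : set Y) (gam : Y -> V) (lam : Y -> R).

(* This class is stable under differentiation when the derivatives of [gam] and
   [lam] belong to it; see [integral_alg_deriv]. *)
Inductive integral_alg : (Y -> R) -> Prop :=
| ialg_cst c : integral_alg (fun=> c)
| ialg_lam : integral_alg lam
| ialg_coord j : integral_alg (fun y => coord (gam y) j)
| ialg_int Phi : integrand Phi -> integral_alg (fun y => \int[mu]_th Phi (gam y) th)
| ialgD f g : integral_alg f -> integral_alg g -> integral_alg (fun y => f y + g y)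
| ialgM f g : integral_alg f -> integral_alg g -> integral_alg (fun y => f y * g y)
| ialgV f : integral_alg f -> (forall y, A y -> f y != 0) ->
    integral_alg (fun y => (f y)^-1).

Lemma ialg_sum (I : Type) (s : seq I) (f : I -> Y -> R) :
  (forall i, integral_alg (f i)) -> integral_alg (fun y => \sum_(i <- s) f i y).
Proof.
move=> H; elim: s => [|i s IH].
  by rewrite (_ : (fun y => _) = fun=> 0); [exact: ialg_cst|apply/funext => y; rewrite big_nil].
rewrite (_ : (fun y => _) = fun y => f i y + \sum_(i <- s) f i y).
  exact: ialgD.
by apply/funext => y; rewrite big_cons.
Qed.

Lemma ialg_prod (I : Type) (s : seq I) (f : I -> Y -> R) :
  (forall i, integral_alg (f i)) -> integral_alg (fun y => \prod_(i <- s) f i y).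
Proof.
move=> H; elim: s => [|i s IH].
  by rewrite (_ : (fun y => _) = fun=> 1); [exact: ialg_cst|apply/funext => y; rewrite big_nil].
rewrite (_ : (fun y => _) = fun y => f i y * \prod_(i <- s) f i y).
  exact: ialgM.
by apply/funext => y; rewrite big_cons.
Qed.

Lemma ialg_det n (M : Y -> 'M[R]_n) : (forall i j, integral_alg (fun y => M y i j)) ->
  integral_alg (fun y => \det (M y)).
Proof.
move=> HM; rewrite /determinant; apply: ialg_sum => s.
by apply: ialgM; [exact: ialg_cst|apply: ialg_prod => i; exact: HM].
Qed.

(** Cramer's formula; it agrees with [invmx] where the matrix is invertible, hence on [A]. *)
Lemma ialg_invmx n (M : Y -> 'M[R]_n) : (forall i j, integral_alg (fun y => M y i j)) ->
  (forall y, A y -> M y \in unitmx) ->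
  forall i j, exists2 f, integral_alg f & forall y, A y -> invmx (M y) i j = f y.
Proof.
move=> HM uM i j.
exists (fun y => (\det (M y))^-1 * \adj (M y) i j); last first.
  by move=> y Ay; rewrite /invmx uM// mxE.
apply: ialgM.
  apply: ialgV; first exact: ialg_det.
  by move=> y /uM; rewrite unitmxE unitfE.
rewrite (_ : (fun y => _) = fun y => (-1) ^+ (j + i) * \det (row' j (col' i (M y)))).
  apply: ialgM; first exact: ialg_cst.
  apply: ialg_det => a b.
  by rewrite (_ : (fun y => _) = fun y => M y (lift j a) (lift i b))//;
    apply/funext => y; rewrite !mxE.
by apply/funext => y; rewrite mxE.
Qed.

Hypothesis A_open : forall y w, A y -> S w ->
  \forall h \near (0 : R)^', A (h *: w + y).
Hypothesis gam_pos : forall y, A y -> posPQ (gam y).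
Hypothesis gam_cont : forall y, A y -> gam z @[z --> within A (nbhs y)] --> gam y.
Hypothesis lam_cont : forall y, A y -> lam z @[z --> within A (nbhs y)] --> lam y.
Hypothesis gam_deriv : forall w, S w -> forall j, exists2 f, integral_alg f &
  forall y, A y -> has_deriv (fun y => coord (gam y) j : R^o) y w (f y).
Hypothesis lam_deriv : forall w, S w -> exists2 f, integral_alg f &
  forall y, A y -> has_deriv (lam : Y -> R^o) y w (f y).

Lemma cara_continuous (x : V) (I : V -> R) (k : J -> V -> R) (l : J -> R) : posPQ x ->
  (forall y, posPQ y -> I y - I x = \sum_j (coord y j - coord x j) * k j y) ->
  (forall j, k j y @[y --> x] --> l j) -> I y @[y --> x] --> I x.
Proof.
move=> Dx HI Hk.
have H : I x + \sum_j (coord y j - coord x j) * k j y @[y --> x] -->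
    I x + \sum_j (coord x j - coord x j) * l j.
  apply: cvgD; first exact: cvg_cst.
  apply: (@cvg_sumr _ _ (nbhs x) _) => j _; apply: cvgM => //.
  by apply: cvgB; [exact: pair_coord_continuous|exact: cvg_cst].
rewrite big1 ?addr0 in H; last by move=> j _; rewrite subrr mul0r.
apply: (cvg_near_eq H); apply: filterS (near_posPQ Dx) => y Dy.
by rewrite -HI// addrC subrK.
Qed.

Lemma line_within y w : A y -> S w ->
  (h *: w + y) @[h --> (0 : R)^'] --> within A (nbhs y).
Proof.
move=> Ay Sw B /= HB.
have H : (h *: w + y) @[h --> (0 : R)^'] --> y.
  rewrite -[X in _ --> X](_ : 0 *: w + y = y); last by rewrite scale0r add0r.
  by apply: cvgD; [apply: cvgZr_tmp; exact: nbhs_dnbhs|exact: cvg_cst].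
by move: (H _ HB) (A_open Ay Sw); apply: filterS2 => h /[apply].
Qed.

Lemma integral_alg_deriv f : integral_alg f ->
  (forall y, A y -> f z @[z --> within A (nbhs y)] --> f y) /\
  forall w, S w -> exists2 f', integral_alg f' &
    forall y, A y -> has_deriv (f : Y -> R^o) y w (f' y).
Proof.
elim => {f}.
- move=> c; split => [y _|w _]; first exact: cvg_cst.
  by exists (fun=> 0) => [|y _]; [exact: ialg_cst|exact: has_deriv_cst].
- by split.
- move=> j; split => [y Ay|w Sw]; last exact: gam_deriv.
  by have := @pair_coord_continuous R d L0 L1 j (gam y); exact: cvg_comp (gam_cont Ay).
- move=> Phi iPhi; have [dPhi idPhi cPhi] := integrand_cara iPhi.
  have HI y : A y -> _ := fun Ay =>
    cara_Rintegral (gam_pos Ay) (near_posPQ (gam_pos Ay)) (cPhi _ (gam_pos Ay)).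
  split => [y Ay|w Sw].
    have [k kE kc] := HI y Ay.
    have := cara_continuous (gam_pos Ay) kE kc.
    exact: cvg_comp (gam_cont Ay).
  have [g Hg] := choice (fun j => let: ex_intro2 f a b := gam_deriv Sw j in
    ex_intro (fun f => integral_alg f /\
      forall y, A y -> has_deriv (fun y => coord (gam y) j : R^o) y w (f y)) f (conj a b)).
  exists (fun y => \sum_j g j y * \int[mu]_th dPhi j (gam y) th).
    by apply: ialg_sum => j; apply: ialgM; [exact: (Hg j).1|exact: ialg_int].
  move=> y Ay; have [k kE kc] := HI y Ay.
  (* Chain rule: the exact increment formula divided by [h] is a sum of difference quotients of the
     coordinates times coefficients converging to the partial derivatives. *)
  apply: (@cvg_near_eq _ _ _ _ (fun h => \sum_j
      (h^-1 * (coord (gam (h *: w + y)) j - coord (gam y) j)) * k j (gam (h *: w + y)))).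
    apply: cvg_sumr => j _; apply: cvgM; first exact: (Hg j).2.
    apply: cvg_comp (kc j); apply: cvg_comp (gam_cont Ay).
    exact: line_within.
  apply: filterS (A_open Ay Sw) => h Ah.
  rewrite kE; last exact: gam_pos.
  by rewrite /GRing.scale /= mulr_sumr; apply: eq_bigr => j _; rewrite mulrA.
- move=> f g _ [cf Df] _ [cg Dg]; split => [y Ay|w Sw].
    by apply: cvgD; [exact: cf|exact: cg].
  have [f' f'a f'E] := Df w Sw; have [g' g'a g'E] := Dg w Sw.
  exists (fun y => f' y + g' y); first exact: ialgD.
  by move=> y Ay; apply: has_derivD; [exact: f'E|exact: g'E].
- move=> f g fa [cf Df] ga [cg Dg]; split => [y Ay|w Sw].
    by apply: cvgM; [exact: cf|exact: cg].
  have [f' f'a f'E] := Df w Sw; have [g' g'a g'E] := Dg w Sw.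
  exists (fun y => f' y * g y + f y * g' y); first by apply: ialgD; exact: ialgM.
  by move=> y Ay; apply: has_derivM; [exact: f'E|exact: g'E].
- move=> f fa [cf Df] f0; split => [y Ay|w Sw].
    by apply: cvgV; [exact: f0|exact: cf].
  have [f' f'a f'E] := Df w Sw.
  exists (fun y => (-1 * f' y) * ((f y)^-1 * (f y)^-1)).
    by apply: ialgM; apply: ialgM => //; [exact: ialg_cst|exact: ialgV|exact: ialgV].
  by move=> y Ay; rewrite mulN1r; apply: has_derivV; [exact: f0|exact: f'E].
Qed.

(** Combinations of fixed vectors with coefficients in the algebra are stable under derivation, so
    [smooth_on_class] applies; this passes from scalar functions to vector-valued ones. *)
Lemma smooth_on_integral_alg {W : normedModType R} n (F : 'I_n -> Y -> R) (e : 'I_n -> W)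
    (f : Y -> W) :
  (forall i, exists2 g, integral_alg g & forall y, A y -> F i y = g y) ->
  (forall y, A y -> f y = \sum_i F i y *: e i) -> smooth_on S A f.
Proof.
move=> HF fE; have [g Hg] := choice (fun i => let: ex_intro2 g a b := HF i in
  ex_intro (fun g => integral_alg g /\ forall y, A y -> F i y = g y) g (conj a b)).
suff H : smooth_on S A (fun y => \sum_i g i y *: e i).
  move=> m; apply: (C_on_eq A_open) (H m) => y Ay.
  by rewrite fE//; apply: eq_bigr => i _; rewrite (Hg i).2.
pose cls (f : Y -> W) := exists2 g : 'I_n -> Y -> R, (forall i, integral_alg (g i)) &
  f = fun y => \sum_i g i y *: e i.
apply: (@smooth_on_class _ _ _ S A A_open cls); last first.
  by exists g => // i; exact: (Hg i).1.
move=> _ [{}g {}Hg ->]; split.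
  apply/subspace_continuousP => y Ay.
  have FF : Filter (within A (nbhs y)) by exact: within_filter.
  apply: cvg_big => [|i _]; first exact: add_continuous.
  by apply: cvgZr_tmp; exact: (integral_alg_deriv (Hg i)).1.
move=> w Sw.
have [g' Hg'] := choice (fun i => let: ex_intro2 f a b := (integral_alg_deriv (Hg i)).2 w Sw in
  ex_intro (fun f => integral_alg f /\ forall y, A y -> has_deriv (g i : Y -> R^o) y w (f y)) f (conj a b)).
exists (fun y => \sum_i g' i y *: e i).
  by exists g' => // i; exact: (Hg' i).1.
move=> y Ay.
apply: (@cvg_near_eq _ _ _ _ (fun h => \sum_i
    (h^-1 * (g i (h *: w + y) - g i y)) *: e i)).
  apply: cvg_big => [|i _]; first exact: add_continuous.
  by apply: cvgZr_tmp; exact: (Hg' i).2.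
near=> h; rewrite -sumrB scaler_sumr; apply: eq_bigr => i _.
by rewrite -scalerBl scalerA.
Unshelve. all: by end_near. Qed.

End integral_algebra.

(** * Monotonicity of the moment map *)

Section convexity_inequalities.
Variable R : realType.
Implicit Types (r s u v : R) (n : nat).

(** The Bregman divergence of [u ^+ n.+1], namely [s ^+ n.+1 - r ^+ n.+1 - n.+1%:R * r ^+ n * (s -
    r)]. *)
Definition bregman n s r := s ^+ n.+1 - n.+1%:R * r ^+ n * s + n%:R * r ^+ n.+1.

(** The recursion gives positivity by induction, its first term being the monotonicity of a
    power. *)
Lemma bregmanS n s r :
  bregman n.+1 s r = (s - r) * (s ^+ n.+1 - r ^+ n.+1) + r * bregman n s r.
Proof. by rewrite /bregman -!natr1 !exprS; ring. Qed.

Lemma exprn_mono_gt0 n s r : 0 < s -> 0 < r -> s != r ->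
  0 < (s - r) * (s ^+ n.+1 - r ^+ n.+1).
Proof.
move=> s0 r0; wlog sr : s r s0 r0 / r < s => [H|_].
  move=> sr; have [rs|rs|rs] := ltgtP r s; first exact: H.
    by rewrite -mulrNN !opprB; apply: H => //; rewrite eq_sym.
  by rewrite rs eqxx in sr.
by rewrite mulr_gt0// subr_gt0// ltrXn2r// ltW.
Qed.

Lemma bregman_ge0 n s r : 0 < s -> 0 < r -> 0 <= bregman n s r.
Proof.
move=> s0 r0; elim: n => [|n IH].
  by rewrite (_ : bregman 0 s r = 0)// /bregman; ring.
rewrite bregmanS; apply: addr_ge0; last by rewrite mulr_ge0 ?(ltW r0).
have [->|sr] := eqVneq s r; first by rewrite subrr mul0r.
by apply: ltW; exact: exprn_mono_gt0.
Qed.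

(** The index starts at 1 because [bregman 0] is identically zero: [u ^+ 1] is affine. *)
Lemma bregman_gt0 n s r : 0 < s -> 0 < r -> s != r -> 0 < bregman n.+1 s r.
Proof.
move=> s0 r0 sr; rewrite bregmanS ltr_pwDl ?exprn_mono_gt0//.
by rewrite mulr_ge0 ?bregman_ge0// ltW.
Qed.

(* The gradient of [(u, v) |-> u ^ (n + 1) / (n * v ^ n)] is monotone. *)
Lemma perspective_grad_mono n u v u' v' : (0 < n)%N ->
  0 < u -> 0 < v -> 0 < u' -> 0 < v' ->
  (n.+1%:R / n%:R * (u' * v'^-1) ^+ n - n.+1%:R / n%:R * (u * v^-1) ^+ n) * (u' - u) +
  (- (u' * v'^-1) ^+ n.+1 - - (u * v^-1) ^+ n.+1) * (v' - v) =
  n%:R^-1 * (v' * bregman n (u' * v'^-1) (u * v^-1) +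
             v * bregman n (u * v^-1) (u' * v'^-1)).
Proof.
move=> n0 u0 v0 u0' v0'.
have nn : n%:R != 0 :> R by rewrite pnatr_eq0 -lt0n.
have -> : u' - u = u' / v' * v' - u / v * v by rewrite !divfK ?gt_eqF.
move: (u / v) (u' / v') => r r'.
by rewrite /bregman !exprS -natr1; field.
Qed.

Lemma inv_pow_mono n u u' : 0 < u -> 0 < u' ->
  0 <= (- (u'^-1) ^+ n.+1 - - (u^-1) ^+ n.+1) * (u' - u) ?= iff (u == u').
Proof.
move=> u0 u0'; have [->|uu'] := eqVneq u u'.
  by split; rewrite ?subrr ?mulr0//; apply/eqP.
suff H : 0 < (- (u'^-1) ^+ n.+1 - - (u^-1) ^+ n.+1) * (u' - u).
  by split; [exact: ltW|rewrite lt_eqF].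
(* [u' - u] is [u * u'] times the difference of the inverses, which reduces the claim to the
   monotonicity of a power. *)
have -> : (- u'^-1 ^+ n.+1 - - u^-1 ^+ n.+1) * (u' - u) =
    (u * u') * ((u^-1 - u'^-1) * (u^-1 ^+ n.+1 - u'^-1 ^+ n.+1)).
  set a := u^-1 ^+ n.+1; set b := u'^-1 ^+ n.+1.
  by field; rewrite !gt_eqF.
apply: mulr_gt0; first exact: mulr_gt0.
apply: exprn_mono_gt0; rewrite ?invr_gt0//.
by apply: contra_neq uu' => /invr_inj.
Qed.

End convexity_inequalities.

(** * Gradient and Hessian in coordinates *)

Section moment_coordinates.
Variables (R : realType) (d : nat) (L0 L1 : {fset 'rV[int]_d}) (n : nat).
Hypothesis n_gt0 : (0 < n)%N.
Hypothesis L0_sym : forall k, k \in L0 -> - k \in L0.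
Hypothesis L1_sym : forall k, k \in L1 -> - k \in L1.
Local Notation V := (mseq R L0 * mseq R L1)%type.
Local Notation J := ('I_#|{: L0}| + 'I_#|{: L1}|)%type.
Local Notation T := (d.-tuple R).
Local Notation mu := (torus_measure R d).
Implicit Types (x y u : V) (i j : J) (th : T).

Definition sym2 : set V := symmetric_mseq R L0 `*` symmetric_mseq R L1.

Definition ratio x th : R := numP x th * (denQ x th)^-1.
(** [gradA1] and [gradA2] are the partial derivatives of [u ^+ n.+1 / (n%:R * v ^+ n)] at the values
    of P and Q; [gradB1] is the derivative of [1 / (n%:R * u ^+ n)]. The letters A and B separate
    the main term from the regularizing one, so that [lam] can vary. *)
Definition gradA1 x th : R := n.+1%:R / n%:R * ratio x th ^+ n.
Definition gradB1 x th : R := - (numP x th)^-1 ^+ n.+1.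
Definition gradA2 x th : R := - ratio x th ^+ n.+1.

Definition momA j x : R :=
  \int[mu]_th (gradA1 x th * basisP j th + gradA2 x th * basisQ j th).
Definition momB j x : R := \int[mu]_th (gradB1 x th * basisP j th).

Lemma integrand_ratio : integrand ratio.
Proof. by apply: integrandM; [exact: integrand_numP|exact: integrand_denQV]. Qed.

Lemma integrandN (Phi : V -> T -> R) : integrand Phi ->
  integrand (fun y th => - Phi y th).
Proof.
move=> iPhi; rewrite (_ : (fun y th => _) = fun y th => -1 * Phi y th).
  apply: (@integrandM _ _ _ _ (fun _ _ => -1)) => //.
  by apply: integrand_cst; exact: bmeas_cst.
by apply/funext => y; apply/funext => th; rewrite mulN1r.
Qed.

Lemma integrandZ (c : R) (Phi : V -> T -> R) : integrand Phi ->
  integrand (fun y th => c * Phi y th).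
Proof.
move=> iPhi; apply: (@integrandM _ _ _ _ (fun _ _ => c)) => //.
by apply: integrand_cst; exact: bmeas_cst.
Qed.

Lemma integrand_gradA1 : integrand gradA1.
Proof. by apply: integrandZ; apply: integrandX; exact: integrand_ratio. Qed.

Lemma integrand_gradA2 : integrand gradA2.
Proof. by apply: integrandN; apply: integrandX; exact: integrand_ratio. Qed.

Lemma integrand_gradB1 : integrand gradB1.
Proof. by apply: integrandN; apply: integrandX; exact: integrand_numPV. Qed.

Lemma integrand_basisP j : integrand (fun _ : V => basisP j).
Proof. by apply: integrand_cst; exact: bmeas_basisP. Qed.

Lemma integrand_basisQ j : integrand (fun _ : V => basisQ j).
Proof. by apply: integrand_cst; exact: bmeas_basisQ. Qed.

Lemma sum_coord_Rintegral u (F G : T -> R) : bmeas F -> bmeas G ->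
  \sum_j coord u j * \int[mu]_th (F th * basisP j th + G th * basisQ j th) =
  \int[mu]_th (F th * trigpoly u.1 th + G th * trigpoly u.2 th).
Proof.
move=> bF bG.
have b j : bmeas (fun th => F th * basisP j th + G th * basisQ j th).
  by apply: bmeasD; apply: bmeasM => //; [exact: bmeas_basisP|exact: bmeas_basisQ].
transitivity (\int[mu]_th (\sum_j coord u j * (F th * basisP j th + G th * basisQ j th))).
  rewrite Rintegral_sum.
    by apply: eq_bigr => j _; rewrite RintegralZl//; exact: bmeas_integrable.
  by move=> j; apply: bmeas_integrable; apply: bmeasM => //; exact: bmeas_cst.
apply: eq_Rintegral => th _; rewrite sum_coordP sum_coordQ !mulr_sumr -big_split.
by apply: eq_bigr => j _ /=; ring.
Qed.

Lemma coefD (L : {fset 'rV[int]_d}) (p q : mseq R L) k :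
  coef (p + q : mseq R L) k = coef p k + coef q k.
Proof. by rewrite /coef; case: insub => [k'|]; rewrite ?addr0// mxE. Qed.

Lemma coefN (L : {fset 'rV[int]_d}) (p : mseq R L) k : coef (- p : mseq R L) k = - coef p k.
Proof. by rewrite /coef; case: insub => [k'|]; rewrite ?oppr0// mxE. Qed.

Lemma coefZ (L : {fset 'rV[int]_d}) a (p : mseq R L) k : coef (a *: p : mseq R L) k = a * coef p k.
Proof. by rewrite /coef; case: insub => [k'|]; rewrite ?mulr0// mxE. Qed.

Lemma sym_mseqD (L : {fset 'rV[int]_d}) (p q : mseq R L) :
  symmetric_mseq R L p -> symmetric_mseq R L q ->
  symmetric_mseq R L (p + q).
Proof. by move=> sp sq k kL; rewrite !coefD sp// sq. Qed.

Lemma sym_mseqN (L : {fset 'rV[int]_d}) (p : mseq R L) :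
  symmetric_mseq R L p -> symmetric_mseq R L (- p).
Proof. by move=> sp k kL; rewrite !coefN sp. Qed.

Lemma sym_mseqZ (L : {fset 'rV[int]_d}) a (p : mseq R L) :
  symmetric_mseq R L p -> symmetric_mseq R L (a *: p).
Proof. by move=> sp k kL; rewrite !coefZ sp. Qed.

Lemma sym2D x y : sym2 x -> sym2 y -> sym2 (x + y).
Proof. by move=> [s1 s2] [s1' s2']; split; exact: sym_mseqD. Qed.

Lemma sym2B x y : sym2 x -> sym2 y -> sym2 (y - x).
Proof.
by move=> [s1 s2] [s1' s2']; split; apply: sym_mseqD => //; exact: sym_mseqN.
Qed.

Lemma sym2Z a x : sym2 x -> sym2 (a *: x).
Proof. by move=> [s1 s2]; split; exact: sym_mseqZ. Qed.

Lemma posPQ_gt0 x th : posPQ x -> 0 < numP x th /\ 0 < denQ x th.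
Proof. by move=> [de de0 H]; have [? ?] := H th; split; exact: lt_le_trans de0 _. Qed.

Lemma numP_torus_fun x : torus_fun (numP x).
Proof. by move=> th th' H; rewrite /numP (trigpoly_torus_fun _ H). Qed.

Lemma denQ_torus_fun x : torus_fun (denQ x).
Proof. exact: trigpoly_torus_fun. Qed.

(** One of the two components is a nonzero symmetric sequence, hence a nonzero polynomial; without
    symmetry an antisymmetric sequence would give the zero polynomial. *)
Lemma sym2_Rintegral_gt0 u (f : T -> R) : sym2 u -> u != 0 -> torus_fun f -> bmeas f ->
  (forall th, 0 <= f th) ->
  (forall th, trigpoly u.1 th != 0 \/ trigpoly u.2 th != 0 -> 0 < f th) ->
  0 < \int[mu]_th f th.
Proof.
move=> [s1 s2] u0 tf bf f0 fpos; have fi := @bmeas_integrable _ _ _ mu _ bf.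
have [u10|u10] := eqVneq u.1 0; last first.
  apply: (@trigpoly_Rintegral_gt0 R d L0 L0_sym u.1 f [tuple 0 | j < d] 1) => //.
  by move=> x _ ux; apply: fpos; left.
have u20 : u.2 != 0.
  by apply: contra_neq u0 => u20; case: u u10 u20 {s1 s2 fpos} => p q /= -> ->.
apply: (@trigpoly_Rintegral_gt0 R d L1 L1_sym u.2 f [tuple 0 | j < d] 1) => //.
by move=> x _ ux; apply: fpos; right.
Qed.

Definition monA x y := \sum_j (coord y j - coord x j) * (momA j y - momA j x).
Definition monB x y := \sum_j (coord y j - coord x j) * (momB j y - momB j x).

Let monA_int x y th : R :=
  (gradA1 y th - gradA1 x th) * trigpoly (y - x).1 th +
  (gradA2 y th - gradA2 x th) * trigpoly (y - x).2 th.
Let monB_int x y th : R :=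
  (gradB1 y th - gradB1 x th) * trigpoly (y - x).1 th.

Lemma bmeas_grad x : posPQ x -> [/\ bmeas (gradA1 x), bmeas (gradA2 x) & bmeas (gradB1 x)].
Proof.
move=> Dx; split; apply: (integrand_bmeas _ Dx).
- exact: integrand_gradA1.
- exact: integrand_gradA2.
- exact: integrand_gradB1.
Qed.

Let bmeas_mon_int x y : posPQ x -> posPQ y -> bmeas (monA_int x y) /\ bmeas (monB_int x y).
Proof.
move=> /bmeas_grad[a b c] /bmeas_grad[a' b' c']; split.
  by apply: bmeasD; apply: bmeasM; (try exact: bmeasB); exact: bmeas_trigpoly.
by apply: bmeasM; [exact: bmeasB|exact: bmeas_trigpoly].
Qed.

Let monAE x y : posPQ x -> posPQ y -> monA x y = \int[mu]_th monA_int x y th.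
Proof.
move=> /bmeas_grad[a b c] /bmeas_grad[a' b' c'].
rewrite /monA_int -sum_coord_Rintegral; try exact: bmeasB.
apply: eq_bigr => j _; rewrite coordB /momA -RintegralB//; last 2 first.
- by apply: bmeas_integrable; apply: bmeasD; apply: bmeasM => //; [exact: bmeas_basisP|exact: bmeas_basisQ].
- by apply: bmeas_integrable; apply: bmeasD; apply: bmeasM => //; [exact: bmeas_basisP|exact: bmeas_basisQ].
by congr (_ * _); apply: eq_Rintegral => th _; ring.
Qed.

Let monBE x y : posPQ x -> posPQ y -> monB x y = \int[mu]_th monB_int x y th.
Proof.
move=> /bmeas_grad[a b c] /bmeas_grad[a' b' c'].
transitivity (\int[mu]_th ((gradB1 y th - gradB1 x th) * trigpoly (y - x).1 th +
    0 * trigpoly (y - x).2 th)); last first.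
  by apply: eq_Rintegral => th _; rewrite mul0r addr0.
rewrite -(@sum_coord_Rintegral _ _ (fun=> 0)); [|exact: bmeasB|exact: bmeas_cst].
apply: eq_bigr => j _; rewrite coordB /momB -RintegralB//; last 2 first.
- by apply: bmeas_integrable; apply: bmeasM => //; exact: bmeas_basisP.
- by apply: bmeas_integrable; apply: bmeasM => //; exact: bmeas_basisP.
by congr (_ * _); apply: eq_Rintegral => th _; ring.
Qed.

Let monA_intE x y th : posPQ x -> posPQ y ->
  monA_int x y th = n%:R^-1 * (denQ y th * bregman n (ratio y th) (ratio x th) +
                               denQ x th * bregman n (ratio x th) (ratio y th)).
Proof.
move=> /(posPQ_gt0 th)[px qx] /(posPQ_gt0 th)[py qy].
rewrite -perspective_grad_mono// /monA_int !trigpolyB /numP /denQ.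
have e (a b : R) : 1 + a - (1 + b) = a - b by ring.
by rewrite e.
Qed.

Let monB_intE x y th : monB_int x y th =
  (- (numP y th)^-1 ^+ n.+1 - - (numP x th)^-1 ^+ n.+1) * (numP y th - numP x th).
Proof. by rewrite /monB_int !trigpolyB /numP opprD addrACA subrr add0r. Qed.

Lemma ratio_gt0 x th : posPQ x -> 0 < ratio x th.
Proof. by move=> /(posPQ_gt0 th)[? ?]; rewrite /ratio divr_gt0. Qed.

Let monA_int_ge0 x y th : posPQ x -> posPQ y -> 0 <= monA_int x y th.
Proof.
move=> Dx Dy; rewrite monA_intE//.
have [_ qx] := posPQ_gt0 th Dx; have [_ qy] := posPQ_gt0 th Dy.
by rewrite mulr_ge0 ?invr_ge0// addr_ge0// mulr_ge0 ?bregman_ge0 ?ratio_gt0// ltW.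
Qed.

Let monB_int_ge0 x y th : posPQ x -> posPQ y -> 0 <= monB_int x y th.
Proof.
move=> /(posPQ_gt0 th)[px _] /(posPQ_gt0 th)[py _]; rewrite monB_intE.
by have [] := inv_pow_mono n px py.
Qed.

Lemma monA_ge0 x y : posPQ x -> posPQ y -> 0 <= monA x y.
Proof. by move=> Dx Dy; rewrite monAE//; apply: Rintegral_ge0 => th _; exact: monA_int_ge0. Qed.

Lemma monB_ge0 x y : posPQ x -> posPQ y -> 0 <= monB x y.
Proof. by move=> Dx Dy; rewrite monBE//; apply: Rintegral_ge0 => th _; exact: monB_int_ge0. Qed.

(** The main integrand is homogeneous of degree 1 in (P, Q), so its monotonicity is blind where the
    ratio is unchanged. Where the values of P differ the regularizing term is positive; where they
    agree but those of Q differ, the ratios differ and the main term is positive. *)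
Lemma mon_gt0 (lam : R) x y : 0 < lam -> sym2 x -> sym2 y -> posPQ x -> posPQ y ->
  x != y -> 0 < monA x y + lam * monB x y.
Proof.
move=> lam0 sx sy Dx Dy xy; have [bA bB] := bmeas_mon_int Dx Dy.
rewrite monAE// monBE// -RintegralZl//; last exact: bmeas_integrable.
have blB : bmeas (fun th => lam * monB_int x y th).
  by apply: bmeasM => //; exact: bmeas_cst.
rewrite -RintegralD//; try exact: bmeas_integrable.
apply: (@sym2_Rintegral_gt0 (y - x)).
- exact: sym2B.
- by rewrite subr_eq0 eq_sym.
- move=> th th' H /=; rewrite !monA_intE// !monB_intE /ratio.
  by rewrite !(numP_torus_fun _ H) !(denQ_torus_fun _ H).
- exact: bmeasD.
- move=> th; apply: addr_ge0; first exact: monA_int_ge0.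
  by apply: mulr_ge0; [exact: ltW|exact: monB_int_ge0].
move=> th H.
have [px qx] := posPQ_gt0 th Dx; have [py qy] := posPQ_gt0 th Dy.
have A0 := monA_int_ge0 th Dx Dy; have B0 := monB_int_ge0 th Dx Dy.
have [e|pxy] := eqVneq (numP x th) (numP y th).
  have qxy : denQ x th != denQ y th.
    case: H; rewrite trigpolyB subr_eq0; last by rewrite eq_sym.
    by move: e; rewrite /numP => /addrI ->; rewrite eqxx.
  apply: ltr_pwDl; last by rewrite mulr_ge0// ltW.
  rewrite monA_intE// mulr_gt0 ?invr_gt0 ?ltr0n//.
  have rr : ratio x th != ratio y th.
    rewrite /ratio e; apply: contra_neq qxy => /mulfI.
    by rewrite gt_eqF// => /(_ isT)/invr_inj.
  case: (n) n_gt0 => // n' _.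
  apply: addr_gt0; rewrite mulr_gt0// bregman_gt0 ?ratio_gt0//.
  by rewrite eq_sym.
apply: ltr_wpDl => //; rewrite mulr_gt0// monB_intE.
have [h1 h2] := inv_pow_mono n px py.
by rewrite lt_neqAle h1 andbT eq_sym; apply/negP => /eqP e0; move: pxy; rewrite -h2 e0 eqxx.
Qed.

(** [dratio], [hessA] and [hessB] keep the unsimplified form produced by the rules for [cara], so
    that [cara_ratio], [cara_momA] and [cara_momB] follow by mere application of these rules. *)
Definition dratio i x th : R :=
  basisP i th * (denQ x th)^-1 +
  numP x th * (- basisQ i th * ((denQ x th)^-1 * (denQ x th)^-1)).
Definition hessA i j x th : R :=
  n.+1%:R / n%:R * (n%:R * ratio x th ^+ n.-1 * dratio i x th) * basisP j th +
  - (n.+1%:R * ratio x th ^+ n * dratio i x th) * basisQ j th.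
Definition hessB i j x th : R :=
  - (n.+1%:R * (numP x th)^-1 ^+ n *
     (- basisP i th * ((numP x th)^-1 * (numP x th)^-1))) * basisP j th.

Let integrand_dratio i : integrand (dratio i).
Proof.
apply: integrandD; apply: integrandM; try exact: integrand_numP; try exact: integrand_denQV.
  exact: integrand_basisP.
apply: integrandM; first by apply: integrandN; exact: integrand_basisQ.
by apply: integrandM; exact: integrand_denQV.
Qed.

Lemma integrand_hessA i j : integrand (hessA i j).
Proof.
apply: integrandD; apply: integrandM; try exact: integrand_basisP; try exact: integrand_basisQ.
  apply: integrandZ; apply: integrandM => //; apply: integrandZ.
  by apply: integrandX; exact: integrand_ratio.
apply: integrandN; apply: integrandM => //; apply: integrandZ.
by apply: integrandX; exact: integrand_ratio.
Qed.

Lemma integrand_hessB i j : integrand (hessB i j).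
Proof.
apply: integrandM; last exact: integrand_basisP.
apply: integrandN; apply: integrandM.
  by apply: integrandZ; apply: integrandX; exact: integrand_numPV.
apply: integrandM; first by apply: integrandN; exact: integrand_basisP.
by apply: integrandM; exact: integrand_numPV.
Qed.

Lemma caraN x Phi dPhi : posPQ x -> cara x Phi dPhi ->
  cara x (fun y th => - Phi y th) (fun i th => - dPhi i th).
Proof.
move=> Dx c; have := caraM Dx (near_posPQ Dx) (cara_cst x (bmeas_cst (-1))) c.
move=> H; apply: cara_eqf (cara_eq _ H).
  by move=> y th; rewrite mulN1r.
by move=> i th; rewrite mul0r add0r mulN1r.
Qed.

Lemma caraMr x Phi dPhi (psi : T -> R) : bmeas psi -> posPQ x -> cara x Phi dPhi ->
  cara x (fun y th => Phi y th * psi th) (fun i th => dPhi i th * psi th).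
Proof.
move=> b Dx c; have H := caraM Dx (near_posPQ Dx) c (cara_cst x b).
by apply: cara_eq H => i th; rewrite mulr0 addr0.
Qed.

Lemma caraZ x Phi dPhi (a : R) : posPQ x -> cara x Phi dPhi ->
  cara x (fun y th => a * Phi y th) (fun i th => a * dPhi i th).
Proof.
move=> Dx c; have H := caraM Dx (near_posPQ Dx) (cara_cst x (bmeas_cst a)) c.
by apply: cara_eq H => i th; rewrite mul0r add0r.
Qed.

Lemma cara_ratio x : posPQ x -> cara x ratio (fun i => dratio i x).
Proof.
move=> Dx; apply: caraM => //; [exact: near_posPQ|exact: cara_numP|exact: cara_denQV].
Qed.

Lemma cara_momA j x : posPQ x ->
  cara x (fun y th => gradA1 y th * basisP j th + gradA2 y th * basisQ j th)
    (fun i => hessA i j x).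
Proof.
move=> Dx; have cr m := caraX Dx (near_posPQ Dx) m (cara_ratio Dx).
apply: caraD.
  by apply: caraMr => //; [exact: bmeas_basisP|exact: caraZ (cr n)].
by apply: caraMr => //; [exact: bmeas_basisQ|exact: caraN (cr n.+1)].
Qed.

Lemma cara_momB j x : posPQ x ->
  cara x (fun y th => gradB1 y th * basisP j th) (fun i => hessB i j x).
Proof.
move=> Dx; have cp := caraX Dx (near_posPQ Dx) n.+1 (cara_numPV Dx).
by apply: caraMr => //; [exact: bmeas_basisP|exact: caraN cp].
Qed.

Definition hess (lam : R) x i j : R :=
  \int[mu]_th hessA i j x th + lam * \int[mu]_th hessB i j x th.

(** The pointwise second variation; the main term has rank one, its square being proportional to the
    variation of the ratio. *)
Let hess_form (lam : R) x u th : R :=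
  n.+1%:R * ratio x th ^+ n.-1 * (denQ x th)^-1 *
    (trigpoly u.1 th - ratio x th * trigpoly u.2 th) ^+ 2 +
  lam * (n.+1%:R * (numP x th)^-1 ^+ n.+2 * trigpoly u.1 th ^+ 2).

Let hess_quadE (lam : R) x u : posPQ x ->
  \sum_i \sum_j coord u i * coord u j * hess lam x i j =
    \int[mu]_th hess_form lam x u th /\ bmeas (hess_form lam x u).
Proof.
move=> Dx.
pose rho th := (denQ x th)^-1 * (trigpoly u.1 th - ratio x th * trigpoly u.2 th).
have bA i j : bmeas (hessA i j x) by exact: integrand_bmeas (integrand_hessA i j) Dx.
have bB i j : bmeas (hessB i j x) by exact: integrand_bmeas (integrand_hessB i j) Dx.
have bh i j : bmeas (fun th => coord u i * coord u j * (hessA i j x th + lam * hessB i j x th)).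
  apply: bmeasM; first exact: bmeas_cst.
  by apply: bmeasD => //; apply: bmeasM => //; exact: bmeas_cst.
have fE th : \sum_i \sum_j coord u i * coord u j * (hessA i j x th + lam * hessB i j x th) =
    hess_form lam x u th.
  transitivity (\sum_i coord u i * (n.+1%:R * ratio x th ^+ n.-1 * dratio i x th *
      (trigpoly u.1 th - ratio x th * trigpoly u.2 th) +
      lam * (n.+1%:R * (numP x th)^-1 ^+ n.+2 * basisP i th * trigpoly u.1 th))).
    apply: eq_bigr => i _; rewrite sum_coordP sum_coordQ !mulr_sumr -sumrB !mulr_sumr -big_split.
    rewrite mulr_sumr; apply: eq_bigr => j _ /=.
    rewrite /hessA /hessB.
    have n0 : n%:R != 0 :> R by rewrite pnatr_eq0 -lt0n.
    have -> : ratio x th ^+ n = ratio x th * ratio x th ^+ n.-1.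
      by rewrite -exprS prednK.
    rewrite !exprS; set a := (numP x th)^-1; set b := ratio x th; by field.
  have -> : hess_form lam x u th = n.+1%:R * ratio x th ^+ n.-1 *
      (\sum_i coord u i * dratio i x th) * (trigpoly u.1 th - ratio x th * trigpoly u.2 th) +
      lam * (n.+1%:R * (numP x th)^-1 ^+ n.+2 * trigpoly u.1 th * trigpoly u.1 th).
    have -> : \sum_i coord u i * dratio i x th = rho th.
      rewrite /rho sum_coordP sum_coordQ !mulr_sumr -sumrB mulr_sumr.
      by apply: eq_bigr => i _; rewrite /dratio /ratio; ring.
    by rewrite /hess_form /rho; ring.
  rewrite {4}sum_coordP !mulr_sumr !mulr_suml mulr_sumr -big_split.
  by apply: eq_bigr => i _ /=; ring.
split.
  transitivity (\int[mu]_th \sum_i \sum_j coord u i * coord u j *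
      (hessA i j x th + lam * hessB i j x th)); last first.
    by apply: eq_Rintegral => th _; exact: fE.
  rewrite Rintegral_sum; last by move=> i; apply: bmeas_integrable; exact: bmeas_sum.
  apply: eq_bigr => i _; rewrite Rintegral_sum; last by move=> j; exact: bmeas_integrable.
  apply: eq_bigr => j _; rewrite RintegralZl//; last first.
    by apply: bmeas_integrable; apply: bmeasD => //; apply: bmeasM => //; exact: bmeas_cst.
  congr (_ * _); rewrite RintegralD//; first last.
  - by apply: bmeas_integrable; apply: bmeasM => //; exact: bmeas_cst.
  - exact: bmeas_integrable.
  by rewrite /hess RintegralZl//; exact: bmeas_integrable.
rewrite (_ : hess_form lam x u = fun th => \sum_i \sum_j coord u i * coord u j *
    (hessA i j x th + lam * hessB i j x th)); last by apply/funext => th; rewrite fE.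
by apply: bmeas_sum => i; exact: bmeas_sum.
Qed.

Let hess_form_coef x th : posPQ x ->
  0 < n.+1%:R * ratio x th ^+ n.-1 * (denQ x th)^-1 /\
  0 < n.+1%:R * (numP x th)^-1 ^+ n.+2.
Proof.
move=> Dx; have [px qx] := posPQ_gt0 th Dx; have r0 := ratio_gt0 th Dx.
have nn : 0 < n.+1%:R :> R by rewrite ltr0n.
split; last by apply: mulr_gt0 => //; rewrite exprn_gt0// invr_gt0.
by apply: mulr_gt0; [apply: mulr_gt0 => //; rewrite exprn_gt0|rewrite invr_gt0].
Qed.

Let hess_form_ge0 (lam : R) x u th : 0 < lam -> posPQ x -> 0 <= hess_form lam x u th.
Proof.
move=> lam0 /(hess_form_coef th)[f1 f2].
by apply: addr_ge0; apply: mulr_ge0; rewrite ?sqr_ge0 ?(ltW lam0) ?(ltW f1)// mulr_ge0 ?sqr_ge0// ltW.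
Qed.

(** This holds in all directions, symmetric or not, as the invertibility of [hessmx] on the whole
    space requires. *)
Lemma hess_quad_ge0 (lam : R) x u : 0 < lam -> posPQ x ->
  0 <= \sum_i \sum_j coord u i * coord u j * hess lam x i j.
Proof.
move=> lam0 Dx; have [-> _] := hess_quadE lam u Dx.
by apply: Rintegral_ge0 => th _; exact: hess_form_ge0.
Qed.

Lemma hess_quad_gt0 (lam : R) x u : 0 < lam -> posPQ x -> sym2 u -> u != 0 ->
  0 < \sum_i \sum_j coord u i * coord u j * hess lam x i j.
Proof.
move=> lam0 Dx su u0; have [-> bf] := hess_quadE lam u Dx.
apply: (sym2_Rintegral_gt0 su u0) => //.
- by move=> th th' H; rewrite /hess_form /ratio !(numP_torus_fun _ H) !(denQ_torus_fun _ H) !(trigpoly_torus_fun _ H).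
- by move=> th; exact: hess_form_ge0.
move=> th H; have [f1 f2] := hess_form_coef th Dx.
have [u1|u1] := eqVneq (trigpoly u.1 th) 0; last first.
  apply: ltr_wpDl; first by rewrite mulr_ge0 ?sqr_ge0 ?(ltW f1).
  by apply: mulr_gt0 => //; apply: mulr_gt0 => //; rewrite exprn_even_gt0.
have u2 : trigpoly u.2 th != 0 by case: H => //; rewrite u1 eqxx.
rewrite /hess_form u1; apply: ltr_pwDl; last by rewrite expr0n mulr0 mulr0.
have r0 := ratio_gt0 th Dx.
apply: mulr_gt0 => //.
by rewrite exprn_even_gt0//= sub0r oppr_eq0 mulf_neq0// gt_eqF.
Qed.

End moment_coordinates.

(** * Invertibility of the completed Hessian *)

Section hessian_matrix.
Variables (R : realType) (d : nat) (L0 L1 : {fset 'rV[int]_d}) (n : nat).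
Hypothesis n_gt0 : (0 < n)%N.
Hypothesis L0_sym : forall k, k \in L0 -> - k \in L0.
Hypothesis L1_sym : forall k, k \in L1 -> - k \in L1.
Local Notation V := (mseq R L0 * mseq R L1)%type.
Local Notation J := ('I_#|{: L0}| + 'I_#|{: L1}|)%type.
Local Notation N := #|{: J}|.
Implicit Types (x u : V) (i j : J) (a b : 'I_N).

Definition unvec (v : 'rV[R]_N) : V :=
  (\row_i v 0 (enum_rank (inl i : J)), \row_i v 0 (enum_rank (inr i : J))).

Lemma coord_unvec v j : coord (unvec v) j = v 0 (enum_rank j).
Proof. by case: j => i; rewrite /= mxE. Qed.

Lemma sum_enum (F : J -> R) : \sum_(a < N) F (enum_val a) = \sum_j F j.
Proof.
rewrite [RHS](reindex (fun a : 'I_N => enum_val a))//=.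
by exists enum_rank => i _; rewrite ?enum_valK ?enum_rankK.
Qed.

Lemma unvec_sum u : u = \sum_a coord u (enum_val a) *: unvec (delta_mx 0 a).
Proof.
have cD j (v w : V) : coord (v + w) j = coord v j + coord w j.
  by case: j => i /=; rewrite mxE.
apply: coord_eq => j.
have -> : coord (\sum_a coord u (enum_val a) *: unvec (delta_mx 0 a)) j =
    \sum_a coord (coord u (enum_val a) *: unvec (delta_mx 0 a)) j.
  elim/big_ind2 : _ => // [|v r w s <- <-]; last exact: cD.
  by case: j => i /=; rewrite mxE.
rewrite (bigD1 (enum_rank j))//= coordZ coord_unvec enum_rankK mxE !eqxx mulr1.
rewrite big1 ?addr0// => a aj; rewrite coordZ coord_unvec mxE eqxx/=.
by rewrite eq_sym (negPf aj) mulr0.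
Qed.

Definition negidx (L : {fset 'rV[int]_d}) (Ls : forall k, k \in L -> - k \in L)
  (i : 'I_#|{: L}|) : 'I_#|{: L}| :=
  enum_rank (FSetSub (Ls _ (freq_in i))).

Lemma freq_inj (L : {fset 'rV[int]_d}) : injective (@freq d L).
Proof. by move=> i i' /val_inj /enum_val_inj. Qed.

Lemma freq_negidx (L : {fset 'rV[int]_d}) Ls (i : 'I_#|{: L}|) : freq (@negidx L Ls i) = - freq i.
Proof. by rewrite {1}/freq enum_rankK. Qed.

Lemma negidxK (L : {fset 'rV[int]_d}) Ls : involutive (@negidx L Ls).
Proof. by move=> i; apply: freq_inj; rewrite !freq_negidx opprK. Qed.

Lemma sym_mseqP (L : {fset 'rV[int]_d}) Ls (p : mseq R L) :
  symmetric_mseq R L p <-> forall i : 'I_#|{: L}|, p 0 (@negidx L Ls i) = p 0 i.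
Proof.
split=> [sp i|H k kL].
  by rewrite -!coef_freq freq_negidx sp ?freq_in.
pose i : 'I_#|{: L}| := enum_rank (FSetSub kL).
have -> : k = freq i by rewrite /freq enum_rankK.
by rewrite -(freq_negidx Ls) !coef_freq H.
Qed.

Definition sig j : J :=
  match j with inl i => inl (negidx L0_sym i) | inr i => inr (negidx L1_sym i) end.

Lemma sigK : involutive sig.
Proof. by case=> i; rewrite /= negidxK. Qed.

Lemma sym2P u : sym2 u <-> forall j, coord u (sig j) = coord u j.
Proof.
split=> [[s1 s2] [i|i] /=|H].
- exact: (sym_mseqP L0_sym _).1.
- exact: (sym_mseqP L1_sym _).1.
split.
  by apply/(sym_mseqP L0_sym) => i; exact: (H (inl i)).
by apply/(sym_mseqP L1_sym) => i; exact: (H (inr i)).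
Qed.

(* The projection on the antisymmetric sequences: it vanishes on the subspace of
   interest, and makes the Hessian invertible on the whole space. *)
Definition antisym i j : R := ((i == j)%:R - (sig i == j)%:R) / 2.

Lemma sum_antisym u j : \sum_i coord u i * antisym i j = (coord u j - coord u (sig j)) / 2.
Proof.
transitivity (\sum_i coord u i * (i == j)%:R / 2 - \sum_i coord u i * (sig i == j)%:R / 2).
  by rewrite -sumrB; apply: eq_bigr => i _; rewrite /antisym; ring.
rewrite (bigD1 j)//= eqxx mulr1 big1 ?addr0; last first.
  by move=> i /negPf ->; rewrite mulr0 mul0r.
rewrite (bigD1 (sig j))//= sigK eqxx mulr1 big1 ?addr0 ?mulrBl// => i ij.
by rewrite (inv_eq sigK) (negPf ij) mulr0 mul0r.
Qed.

Definition hessmx (lam : R) x : 'M[R]_N :=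
  \matrix_(a, b) (hess n lam x (enum_val a) (enum_val b) +
                  antisym (enum_val a) (enum_val b)).

(** For [v] in the left kernel, the quadratic form at [v] is the Hessian form plus a quarter of the
    sum of the squares of [coord u j - coord u (sig j)]. Both are nonnegative, so [u] is symmetric,
    and then zero by strict positivity on symmetric pairs. *)
Lemma hessmx_unit (lam : R) x : 0 < lam -> posPQ x -> hessmx lam x \in unitmx.
Proof.
move=> lam0 Dx; rewrite -row_free_unit -kermx_eq0; apply/rowV0P => v /sub_kermxP vM.
pose u := unvec v.
have uE j : coord u j = v 0 (enum_rank j) by exact: coord_unvec.
have : \sum_b (v *m hessmx lam x) 0 b * v 0 b = 0.
  by rewrite vM big1// => b _; rewrite mxE mul0r.
have -> : \sum_b (v *m hessmx lam x) 0 b * v 0 b =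
    \sum_i \sum_j coord u i * coord u j * hess n lam x i j +
    \sum_j (coord u j - coord u (sig j)) / 2 * coord u j.
  rewrite [X in X + _]exchange_big -big_split -sum_enum; apply: eq_bigr => b _ /=.
  rewrite mxE mulr_suml -sum_antisym mulr_suml -!sum_enum -big_split.
  by apply: eq_bigr => a _ /=; rewrite !mxE !uE !enum_valK; ring.
have -> : \sum_j (coord u j - coord u (sig j)) / 2 * coord u j =
    4^-1 * \sum_j (coord u j - coord u (sig j)) ^+ 2.
  have e : \sum_j coord u (sig j) ^+ 2 = \sum_j coord u j ^+ 2.
    by rewrite [RHS](reindex_inj (inv_inj sigK)).
  have -> : \sum_j (coord u j - coord u (sig j)) ^+ 2 =
      \sum_j (coord u j ^+ 2 - 2 * coord u j * coord u (sig j)) + \sum_j coord u (sig j) ^+ 2.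
    by rewrite -big_split; apply: eq_bigr => j _ /=; ring.
  rewrite e -big_split mulr_sumr; apply: eq_bigr => j _ /=.
  by field.
have h0 := hess_quad_ge0 n_gt0 u lam0 Dx.
have s0 : 0 <= \sum_j (coord u j - coord u (sig j)) ^+ 2.
  by apply: sumr_ge0 => j _; exact: sqr_ge0.
move=> e0.
have /eqP : \sum_j (coord u j - coord u (sig j)) ^+ 2 = 0 by lra.
rewrite psumr_eq0; last by move=> j _; exact: sqr_ge0.
move=> /allP H.
have su : sym2 u.
  apply/sym2P => j; have := H j (mem_index_enum j).
  by rewrite /= sqrf_eq0 subr_eq0 => /eqP.
have u0 : u = 0.
  apply: contrapT => /eqP u0.
  by have := hess_quad_gt0 n_gt0 L0_sym L1_sym lam0 Dx su u0; lra.
apply/rowP => a; rewrite mxE.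
have := uE (enum_val a); rewrite enum_valK => <-; rewrite u0.
by case: (enum_val a) => i; rewrite /= mxE.
Qed.

End hessian_matrix.

Section cvg_matrices.
Context {R : realType} {X : Type} {F : set_system X} {FF : Filter F} {n : nat}.
Variables (B : X -> 'M[R]_n) (M : 'M[R]_n).
Hypothesis BM : forall a b, B x a b @[x --> F] --> M a b.

Lemma cvg_det : \det (B x) @[x --> F] --> \det M.
Proof.
rewrite /determinant; apply: cvg_sumr => s _.
by apply: cvgM; [exact: cvg_cst|apply: cvg_prodr => i _; exact: BM].
Qed.

End cvg_matrices.

Section cvg_invmx.
Context {R : realType} {X : Type} {F : set_system X} {FF : Filter F} {n : nat}.
Variables (B : X -> 'M[R]_n) (M : 'M[R]_n).
Hypothesis BM : forall a b, B x a b @[x --> F] --> M a b.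
Hypothesis uM : M \in unitmx.

Lemma near_unitmx : \forall x \near F, B x \in unitmx.
Proof.
have dM : \det M != 0 by rewrite -unitfE -unitmxE.
apply: filterS (cvgr_neq0 _ (cvg_det BM) dM) => x.
by rewrite unitmxE unitfE.
Qed.

(** [invmx] returns a singular matrix unchanged, so Cramer's formula holds only eventually, by
    [near_unitmx]. *)
Lemma cvg_invmx a b : invmx (B x) a b @[x --> F] --> invmx M a b.
Proof.
have dM : \det M != 0 by rewrite -unitfE -unitmxE.
have H : (\det (B x))^-1 * \adj (B x) a b @[x --> F] --> (\det M)^-1 * \adj M a b.
  apply: cvgM; first by apply: cvgV => //; exact: cvg_det.
  rewrite (_ : (fun x => \adj (B x) a b) =
      fun x => (-1) ^+ (b + a) * \det (row' b (col' a (B x)))); last first.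
    by apply/funext => x; rewrite mxE.
  rewrite mxE; apply: cvgM; first exact: cvg_cst.
  apply: cvg_det => i j; rewrite !mxE.
  rewrite (_ : (fun x => _) = fun x => B x (lift b i) (lift a j)); first exact: BM.
  by apply/funext => x; rewrite !mxE.
rewrite {2}/invmx uM mxE.
apply: cvg_near_eq H _; apply: filterS near_unitmx => x uB.
by rewrite /invmx uB mxE.
Qed.

End cvg_invmx.

Lemma cvg_within_nbhs {T U : topologicalType} (K : set T) (f : T -> U) (x : T) (l : U) :
  f y @[y --> x] --> l -> f y @[y --> within K (nbhs x)] --> l.
Proof. by move=> fl; apply: cvg_trans fl; apply: cvg_app; exact: cvg_within. Qed.

Lemma closure_dist {R : realType} {V : normedModType R} (K : set V) (x : V) :
  closure K x -> forall e : R, 0 < e -> exists2 y, K y & `|x - y| <= e.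
Proof.
move=> Kx e e0; have [y [Ky yx]] := Kx _ (near_dist_le x e0).
by exists y.
Qed.

Lemma norm_le_eq0 {R : realType} (a c : R) :
  (forall e, 0 < e -> `|a| <= c * e) -> a = 0.
Proof.
move=> H; apply/eqP; rewrite -normr_le0; apply/ler_addgt0Pr => e e0.
rewrite add0r (le_trans (H (e / (`|c| + 1)) _))//.
  by rewrite divr_gt0// ltr_wpDl.
have c0 : 0 < `|c| + 1 by rewrite ltr_wpDl.
rewrite mulrA ler_pdivrMr// mulrC ler_pM2l//.
by rewrite (le_trans (ler_norm _))// lerDl.
Qed.

(** * Regularity of the solution map *)

Section solution_continuity.
Variables (R : realType) (d : nat) (L0 L1 : {fset 'rV[int]_d}) (n : nat).
Hypothesis n_gt0 : (0 < n)%N.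
Hypothesis L0_sym : forall k, k \in L0 -> - k \in L0.
Hypothesis L1_sym : forall k, k \in L1 -> - k \in L1.
Local Notation V := (mseq R L0 * mseq R L1)%type.
Local Notation W := (mseq R L1 * mseq R L0)%type.
Local Notation J := ('I_#|{: L0}| + 'I_#|{: L1}|)%type.
Implicit Types (x y : V) (j : J).

(** The target lists the moments dual to Q first, so the two blocks are swapped with respect to
    [coord]. *)
Definition dcoord (z : W) j : R :=
  match j with inl i => z.2 0 i | inr i => z.1 0 i end.

Lemma dcoordD (z w : W) j : dcoord (z + w) j = dcoord z j + dcoord w j.
Proof. by case: j => i /=; rewrite mxE. Qed.

Lemma dcoordZ a (z : W) j : dcoord (a *: z) j = a * dcoord z j.
Proof. by case: j => i /=; rewrite mxE. Qed.

Lemma dcoordB (z w : W) j : dcoord (z - w) j = dcoord z j - dcoord w j.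
Proof. by case: j => i /=; rewrite !mxE. Qed.

Lemma norm_dcoord (z : W) j : `|dcoord z j| <= `|z|.
Proof.
case: j => i /=; rewrite (le_trans (norm_coord _ _))// prod_normE le_max lexx ?orbT//.
Qed.

Lemma dcoord_eq (z w : W) : (forall j, dcoord z j = dcoord w j) -> z = w.
Proof.
case: z w => [p q] [p' q'] H; congr (_, _).
  by apply/rowP => i; exact: (H (inr i)).
by apply/rowP => i; exact: (H (inl i)).
Qed.

(** The moment map written as a gradient; it coincides with [moment_map] on [posPQ], see
    [moment_mapE]. Its first block does not involve [lam], since [momB] vanishes on the coordinates
    of Q. *)
Definition omega (lam : R) x : W :=
  (\row_i (momA n (inr i : J) x + lam * momB n (inr i : J) x),
   \row_i (momA n (inl i : J) x + lam * momB n (inl i : J) x)).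

Lemma dcoord_omega lam x j : dcoord (omega lam x) j = momA n j x + lam * momB n j x.
Proof. by case: j => i; rewrite /= mxE. Qed.

Definition sumE (x : V) (z : W) : R := \sum_j coord x j * dcoord z j.

Lemma sumE_omega lam x y :
  sumE (y - x) (omega lam y - omega lam x) = monA n x y + lam * monB n x y.
Proof.
rewrite /monA /monB mulr_sumr -big_split; apply: eq_bigr => j _ /=.
by rewrite coordB dcoordB !dcoord_omega; ring.
Qed.

Lemma sumEZ a x z : sumE (a *: x) z = a * sumE x z.
Proof. by rewrite mulr_sumr; apply: eq_bigr => j _; rewrite coordZ mulrA. Qed.

Lemma sumEB x z w : sumE x (z - w) = sumE x z - sumE x w.
Proof. by rewrite -sumrB; apply: eq_bigr => j _; rewrite dcoordB mulrBr. Qed.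

Lemma sumE_sub_le x z w v : 0 <= sumE x (z - w) -> sumE x (w - v) <= sumE x (z - v).
Proof. by rewrite !sumEB subr_ge0 lerD2r. Qed.

Lemma sumE_le x z : `|sumE x z| <= #|{: J}|%:R * (`|x| * `|z|).
Proof.
rewrite (le_trans (ler_norm_sum _ _ _))//.
have -> : #|{: J}|%:R * (`|x| * `|z|) = \sum_(j : J) `|x| * `|z|.
  by rewrite sumr_const mulr_natl.
apply: ler_sum => j _; rewrite normrM ler_pM//.
  exact: norm_coord_le.
exact: norm_dcoord.
Qed.

Lemma mon_ge0 (lam : R) x y : 0 <= lam -> posPQ x -> posPQ y ->
  0 <= monA n x y + lam * monB n x y.
Proof. by move=> l0 Dx Dy; rewrite addr_ge0 ?mulr_ge0 ?monA_ge0 ?monB_ge0. Qed.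

Lemma omega_inj lam x y : 0 < lam -> sym2 x -> sym2 y -> posPQ x -> posPQ y ->
  omega lam x = omega lam y -> x = y.
Proof.
move=> l0 sx sy Dx Dy e; apply: contrapT => /eqP xy.
have := mon_gt0 n_gt0 L0_sym L1_sym l0 sx sy Dx Dy xy.
rewrite -sumE_omega e subrr /sumE big1 ?ltxx// => j _.
have -> : dcoord 0 j = 0 by case: j => i; rewrite /= mxE.
by rewrite mulr0.
Qed.

Lemma closed_sym2 : closed (@sym2 R d L0 L1).
Proof.
move=> x cx; apply/(sym2P L0_sym L1_sym) => j; apply/eqP; rewrite -subr_eq0; apply/eqP.
apply: (@norm_le_eq0 _ _ 2) => e e0; have [y sy xy] := closure_dist cx e0.
have h k : `|coord x k - coord y k| <= e.
  by rewrite -coordB (le_trans (norm_coord_le _ _)).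
have := h j; have := h (sig L0_sym L1_sym j); rewrite (sym2P L0_sym L1_sym y).1// => h1 h2.
have -> : coord x (sig L0_sym L1_sym j) - coord x j =
  (coord x (sig L0_sym L1_sym j) - coord y j) - (coord x j - coord y j) by ring.
by rewrite (le_trans (ler_normB _ _))//; lra.
Qed.

Lemma bounded_closed_compactV (K : set V) (C : R) :
  (forall x, K x -> `|x| <= C) -> closed K -> compact K.
Proof.
move=> bK cK.
have cb m : compact [set v : 'rV[R]_m | `|v| <= C].
  apply: bounded_closed_compact.
    exists C; split; first exact: num_real.
    by move=> M CM v /= vC; rewrite (le_trans vC)// ltW.
  move=> v cv /=; apply/ler_addgt0Pr => e e0.
  have [w /= wC vw] := closure_dist cv e0.
  by rewrite -{1}(subrK w v) (le_trans (ler_normD _ _))// addrC lerD.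
apply: subclosed_compact cK (compact_setX (cb _) (cb _)) _.
by move=> x /bK xC; split => /=; rewrite (le_trans _ xC)// ?norm_fst ?norm_snd.
Qed.

Lemma momA_continuous j x : posPQ x -> momA n j y @[y --> x] --> momA n j x.
Proof.
move=> Dx; have [k kE kc] := cara_Rintegral Dx (near_posPQ Dx) (@cara_momA _ _ _ _ n j x Dx).
exact: cara_continuous Dx kE kc.
Qed.

Lemma momB_continuous j x : posPQ x -> momB n j y @[y --> x] --> momB n j x.
Proof.
move=> Dx; have [k kE kc] := cara_Rintegral Dx (near_posPQ Dx) (@cara_momB _ _ _ _ n j x Dx).
exact: cara_continuous Dx kE kc.
Qed.

(* The monotone quantity is bounded below on a small sphere around [x0] by
   compactness, and outside the ball by monotonicity along the segments from [x0]. *)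
Lemma omega_escape (lam0 : R) x0 (e : R) : 0 < lam0 -> sym2 x0 -> posPQ x0 -> 0 < e ->
  exists2 eta : R, 0 < eta & forall lam y, lam0 / 2 <= lam -> sym2 y -> posPQ y ->
    e <= `|y - x0| -> eta <= `|omega lam y - omega lam x0|.
Proof.
move=> l0 s0 D0 e0.
have [r /= r0 rD] : exists2 r : R, 0 < r & forall y, `|x0 - y| <= r -> posPQ y.
  have [r /= r0 rD] := (nbhs_ballP _ _).1 (near_posPQ D0).
  exists (r / 2) => [|y xy]; first by lra.
  by apply: rD; rewrite -ball_normE /=; lra.
pose s := Num.min e r; have ss0 : 0 < s by rewrite lt_min e0.
have se : s <= e by rewrite ge_min lexx.
have sr : s <= r by rewrite ge_min lexx orbT.
pose K : set V := [set y | sym2 y /\ `|y - x0| = s].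
have KD y : K y -> posPQ y by move=> [_ ys]; apply: rD; rewrite distrC ys.
pose m y := monA n x0 y + lam0 * monB n x0 y.
have cK : compact K.
  apply: (@bounded_closed_compactV _ (s + `|x0|)).
    by move=> y [_ ys]; rewrite -ys -{1}(subrK x0 y) ler_normD.
  move=> y cy; split.
    by apply: closed_sym2; apply: closureS cy => z [].
  apply/eqP; rewrite -subr_eq0; apply/eqP; apply: (@norm_le_eq0 _ _ 1) => t t0.
  have [z [_ zs] yz] := closure_dist cy t0; rewrite mul1r -zs (le_trans _ yz)//.
  rewrite (le_trans (ler_dist_dist _ _))//.
  by rewrite opprB addrA subrK.
have mc : {within K, continuous m}.
  apply/subspace_continuousP => y Ky; apply: cvg_within_nbhs.
  have Dy := KD y Ky.
  apply: cvgD; [|apply: cvgM; first exact: cvg_cst]; apply: (@cvg_sumr _ _ (nbhs y) _) => j _;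
    apply: cvgM; apply: cvgB; try exact: cvg_cst; try exact: pair_coord_continuous.
    exact: momA_continuous.
  exact: momB_continuous.
have [eta eta0 etaK] : exists2 eta, 0 < eta & forall y, K y -> eta <= m y.
  have [K0|/set0P/negP/negPn/eqP K0] := pselect (K !=set0); last first.
    by exists 1 => // y; rewrite K0.
  have [c cK' cmin] := compact_EVT_min K0 cK mc.
  rewrite inE in cK'; exists (m c); last by move=> y Ky; apply: cmin; rewrite inE.
  apply: mon_gt0 => //; [by case: cK'|exact: KD|].
  by apply/eqP => xc; case: cK' => _; rewrite -xc subrr normr0; lra.
set NJ : R := #|{: J}|%:R; have NJ0 : 0 <= NJ by rewrite ler0n.
(* The half accounts for [lam] being only at least [lam0 / 2]; [NJ * s] comes from bounding the
   pairing by the norms on the sphere, and adding 1 to [NJ] makes the denominator positive. *)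
exists (eta / 2 / ((NJ + 1) * s)).
  by rewrite !divr_gt0// mulr_gt0//; lra.
move=> lam y ll sy Dy ey.
have y0 : 0 < `|y - x0| by lra.
(* [x'] is the point where the segment from [x0] to [y] crosses the sphere of radius [s]. *)
pose t := s / `|y - x0|; pose x' := x0 + t *: (y - x0).
have t0 : 0 < t by rewrite divr_gt0.
have t1 : t <= 1 by rewrite ler_pdivrMr// mul1r; lra.
have Kx' : K x'.
  split; first by apply: sym2D => //; apply: sym2Z; exact: sym2B.
  by rewrite /x' addrAC subrr add0r normrZ gtr0_norm// /t divfK// gt_eqF.
have Dx' := KD _ Kx'.
have lam_gt0 : 0 < lam by lra.
have h1 : eta / 2 <= monA n x0 x' + lam * monB n x0 x'.
  have := etaK _ Kx'; rewrite /m.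
  have := monA_ge0 n_gt0 D0 Dx'; have B0 := monB_ge0 n D0 Dx'.
  have : lam0 / 2 * monB n x0 x' <= lam * monB n x0 x' by rewrite ler_wpM2r.
  lra.
have x'0 : x' - x0 = t *: (y - x0) by rewrite /x' addrAC subrr add0r.
have yx' : y - x' = (1 - t) *: (y - x0).
  by rewrite scalerBl scale1r /x' opprD addrA.
have h2 : sumE (y - x0) (omega lam x' - omega lam x0) <= sumE (y - x0) (omega lam y - omega lam x0).
  have [t1'|t1'] := eqVneq t 1.
    by rewrite (_ : x' = y)// /x' t1' scale1r addrC subrK.
  have t1_gt0 : 0 < 1 - t by rewrite subr_gt0 lt_neqAle t1'.
  apply: sumE_sub_le; rewrite -(pmulr_rge0 _ t1_gt0) -sumEZ -yx' sumE_omega.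
  exact: mon_ge0 (ltW lam_gt0) Dx' Dy.
have h3 : eta / 2 <= t * sumE (y - x0) (omega lam y - omega lam x0).
  apply: le_trans h1 _; rewrite -sumE_omega x'0 sumEZ ler_wpM2l//; exact: ltW.
have h4 : t * sumE (y - x0) (omega lam y - omega lam x0) <=
    (NJ + 1) * s * `|omega lam y - omega lam x0|.
  rewrite -sumEZ -x'0 (le_trans (ler_norm _))// (le_trans (sumE_le _ _))//.
  case: Kx' => _ ->; rewrite mulrA ler_wpM2r// ler_wpM2r ?(ltW ss0)//.
  by rewrite -/NJ lerDl.
by rewrite ler_pdivrMr ?mulr_gt0 ?ltr_wpDl// [leRHS]mulrC (le_trans h3).
Qed.

Variables (A : set (R^o * W)) (G : R^o * W -> V).
Hypothesis A_gt0 : forall y : R^o * W, A y -> 0 < y.1.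
Hypothesis G_sol : forall y : R^o * W, A y -> [/\ sym2 (G y), posPQ (G y) & omega y.1 (G y) = y.2].

(** At the fixed point [G y], [omega] is affine in the parameter with slope [beta], so its value at
    the parameter [z.1] is within [(1 + |beta|) * |y - z|] of [z.2]. If [G z] were far from [G y],
    [omega_escape] would bound the same distance from below. *)
Lemma solution_continuous (y : R^o * W) : A y -> G z @[z --> within A (nbhs y)] --> G y.
Proof.
move=> Ay; have [s0 D0 e0] := G_sol Ay; have l0 := A_gt0 Ay.
apply/cvgrPdist_lt => e egt0.
have [eta eta0 H] := omega_escape l0 s0 D0 egt0.
pose beta : W := (\row_i momB n (inr i : J) (G y), \row_i momB n (inl i : J) (G y)).
have omegaE l : omega l (G y) = omega y.1 (G y) + (l - y.1) *: beta.
  apply: dcoord_eq => j; rewrite dcoordD dcoordZ !dcoord_omega.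
  have -> : dcoord beta j = momB n j (G y) by case: (j) => i; rewrite /= mxE.
  by ring.
have b0 : 0 < 1 + `|beta| by rewrite ltr_pwDl.
have t0 : 0 < Num.min (y.1 / 2) (eta / 2 / (1 + `|beta|)).
  by rewrite lt_min !divr_gt0.
apply: filterS (near_dist_le y t0) => z; rewrite le_min => /andP[z1 z2] Az.
have [sz Dz ez] := G_sol Az.
have n1 : `|y.1 - z.1| <= `|y - z|.
  by rewrite prod_normE le_max lexx.
have n2 : `|y.2 - z.2| <= `|y - z|.
  by rewrite prod_normE le_max lexx orbT.
rewrite distrC ltNge; apply/negP => far.
have lz : y.1 / 2 <= z.1.
  by move: (le_trans n1 z1); rewrite ler_norml => /andP[_]; lra.
have := H z.1 (G z) lz sz Dz far; apply/negP; rewrite -ltNge ez omegaE e0.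
rewrite opprD addrA (le_lt_trans (ler_normB _ _))// normrZ distrC (distrC z.1).
have h : `|y - z| * (1 + `|beta|) <= eta / 2 by rewrite -ler_pdivlMr.
have : `|y.1 - z.1| * `|beta| <= `|y - z| * `|beta| by rewrite ler_wpM2r.
lra.
Qed.

End solution_continuity.

(** * Derivatives of the solution map *)

Section solution_smooth.
Variables (R : realType) (d : nat) (L0 L1 : {fset 'rV[int]_d}) (n : nat).
Hypothesis n_gt0 : (0 < n)%N.
Hypothesis L0_sym : forall k, k \in L0 -> - k \in L0.
Hypothesis L1_sym : forall k, k \in L1 -> - k \in L1.
Local Notation V := (mseq R L0 * mseq R L1)%type.
Local Notation W := (mseq R L1 * mseq R L0)%type.
Local Notation J := ('I_#|{: L0}| + 'I_#|{: L1}|)%type.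
Local Notation N := #|{: J}|.
Local Notation mu := (torus_measure R d).
Implicit Types (x : V) (i j : J) (a b : 'I_N).

Lemma moments_cara x : posPQ x -> exists kA kB : J -> J -> V -> R,
  [/\ forall y, posPQ y -> forall j, momA n j y - momA n j x =
        \sum_i (coord y i - coord x i) * kA j i y,
      forall y, posPQ y -> forall j, momB n j y - momB n j x =
        \sum_i (coord y i - coord x i) * kB j i y,
      forall j i, kA j i y @[y --> x] --> \int[mu]_th hessA n i j x th
    & forall j i, kB j i y @[y --> x] --> \int[mu]_th hessB n i j x th].
Proof.
move=> Dx; have nx := near_posPQ Dx.
have hA j : exists k : J -> V -> R,
    (forall y, posPQ y -> momA n j y - momA n j x = \sum_i (coord y i - coord x i) * k i y) /\
    forall i, k i y @[y --> x] --> \int[mu]_th hessA n i j x th.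
  have [k kE kc] := cara_Rintegral Dx nx (@cara_momA _ _ _ _ n j x Dx).
  by exists k.
have hB j : exists k : J -> V -> R,
    (forall y, posPQ y -> momB n j y - momB n j x = \sum_i (coord y i - coord x i) * k i y) /\
    forall i, k i y @[y --> x] --> \int[mu]_th hessB n i j x th.
  have [k kE kc] := cara_Rintegral Dx nx (@cara_momB _ _ _ _ n j x Dx).
  by exists k.
have [kA HA] := choice hA; have [kB HB] := choice hB.
exists kA, kB; split => [y Dy j|y Dy j|j|j].
- exact: (HA j).1.
- exact: (HB j).1.
- exact: (HA j).2.
- exact: (HB j).2.
Qed.

Variables (S A : set (R^o * W)) (G : R^o * W -> V).
Hypothesis A_gt0 : forall y, A y -> 0 < y.1.
Hypothesis A_open : forall y w, A y -> S w -> \forall h \near (0 : R)^', A (h *: w + y).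
Hypothesis G_sol : forall y, A y -> [/\ sym2 (G y), posPQ (G y) & omega n y.1 (G y) = y.2].

(** The right-hand side obtained by differentiating [omega n y.1 (G y) = y.2] along [w]: the
    parameter contributes its derivative [momB] times [w.1]. *)
Definition newton_rhs (w : R^o * W) x : 'rV[R]_N :=
  \row_b (dcoord w.2 (enum_val b) - w.1 * momB n (enum_val b) x).

Lemma solution_deriv w j y : S w -> A y ->
  has_deriv (fun y => coord (G y) j : R^o) y w
    ((newton_rhs w (G y) *m invmx (hessmx n L0_sym L1_sym y.1 (G y))) 0 (enum_rank j)).
Proof.
move=> Sw Ay; have [sx Dx ex] := G_sol Ay; have l0 := A_gt0 Ay.
set x := G y in sx Dx ex *.
have [kA [kB [kAE kBE kAc kBc]]] := moments_cara Dx.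
pose F := (0 : R)^'.
have FF : Filter F by exact: dnbhs_filter.
have yF : h *: w + y @[h --> F] --> within A (nbhs y) by exact: (line_within A_open).
have xF : G (h *: w + y) @[h --> F] --> x.
  exact: cvg_comp yF (solution_continuous n_gt0 L0_sym L1_sym A_gt0 G_sol Ay).
have lF : (h *: w + y).1 @[h --> F] --> y.1.
  have H : (h *: w + y) @[h --> F] --> y by apply: cvg_trans yF _; exact: cvg_within.
  exact: cvg_comp H cvg_fst.
(* The secant matrix between [G y] and [G (h *: w + y)]; it tends to the Hessian because [G] is
   continuous within [A]. *)
pose B (h : R) : 'M[R]_N := \matrix_(a, b)
  (kA (enum_val b) (enum_val a) (G (h *: w + y)) +
   (h *: w + y).1 * kB (enum_val b) (enum_val a) (G (h *: w + y)) +
   antisym R L0_sym L1_sym (enum_val a) (enum_val b)).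
have BM a b : B h a b @[h --> F] --> hessmx n L0_sym L1_sym y.1 x a b.
  rewrite [hessmx _ _ _ _ _ _ _]mxE.
  rewrite (_ : (fun h => B h a b) = fun h =>
    (kA (enum_val b) (enum_val a) (G (h *: w + y)) +
     (h *: w + y).1 * kB (enum_val b) (enum_val a) (G (h *: w + y)) +
     antisym R L0_sym L1_sym (enum_val a) (enum_val b))); last first.
    by apply/funext => h; rewrite mxE.
  apply: cvgD; last exact: cvg_cst.
  apply: cvgD; first exact: cvg_comp xF (kAc _ _).
  by apply: cvgM => //; exact: cvg_comp xF (kBc _ _).
have uM := hessmx_unit n_gt0 L0_sym L1_sym l0 Dx.
(* Next, [stepE] is an exact linear equation for the increment of [G]. The [antisym] block does not
   affect it, because the difference of two solutions is symmetric. *)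
have nA := A_open Ay Sw.
have stepE h : A (h *: w + y) ->
    (\row_a (coord (G (h *: w + y)) (enum_val a) - coord x (enum_val a))) *m B h =
    h *: newton_rhs w x.
  move=> Ah; have [sh Dh eh] := G_sol Ah.
  apply/rowP => b; rewrite !mxE; set k := enum_val b.
  transitivity (\sum_i (coord (G (h *: w + y)) i - coord x i) * kA k i (G (h *: w + y)) +
    (h *: w + y).1 * \sum_i (coord (G (h *: w + y)) i - coord x i) * kB k i (G (h *: w + y)) +
    \sum_i coord (G (h *: w + y) - x) i * antisym R L0_sym L1_sym i k).
    rewrite mulr_sumr -!big_split -sum_enum; apply: eq_bigr => a _ /=.
    by rewrite !mxE coordB; ring.
  rewrite -kAE// -kBE// sum_antisym.
  rewrite (sym2P L0_sym L1_sym _).1; last exact: sym2B.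
  rewrite subrr mul0r addr0.
  have e1 := dcoord_omega n (h *: w + y).1 (G (h *: w + y)) k.
  have e2 := dcoord_omega n y.1 x k.
  rewrite eh in e1; rewrite ex in e2.
  have e3 : dcoord (h *: w + y).2 k = h * dcoord w.2 k + dcoord y.2 k.
    by rewrite -dcoordZ -dcoordD.
  have e4 : (h *: w + y).1 = h * w.1 + y.1 by [].
  have -> : h * (dcoord w.2 k - w.1 * momB n k x) =
    dcoord (h *: w + y).2 k - dcoord y.2 k - ((h *: w + y).1 - y.1) * momB n k x.
    by rewrite e3 e4; ring.
  by rewrite e1 e2; ring.
apply: (@cvg_near_eq _ _ F _ (fun h => (newton_rhs w x *m invmx (B h)) 0 (enum_rank j))).
  rewrite [X in _ --> X]mxE.
  rewrite (_ : (fun h => _) = fun h => \sum_a newton_rhs w x 0 a * invmx (B h) a (enum_rank j)); last first.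
    by apply/funext => h; rewrite mxE.
  apply: cvg_sumr => a _; apply: cvgM; first exact: cvg_cst.
  exact: cvg_invmx.
have hn0 : \forall h \near F, h != 0 by exact: nbhs_dnbhs_neq.
apply: (@filterS _ F FF _ _ _ (filterI hn0 (filterI nA (near_unitmx BM uM)))) => h [h0 [Ah uB]].
have e := stepE h Ah.
have -> : newton_rhs w x = h^-1 *: (h *: newton_rhs w x).
  by rewrite scalerA mulVf// scale1r.
rewrite -e -!scalemxAl mulmxK//.
by rewrite !mxE enum_rankK.
Qed.

Let lamf (y : R^o * W) : R := y.1.

(** The derivatives belong to the algebra generated by [lamf], the coordinates of [G] and integrals
    along [G]; this closes the loop required by [integral_alg_deriv]. *)
Lemma solution_deriv_alg w : S w -> forall j, exists2 f, integral_alg A G lamf f &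
  forall y, A y -> has_deriv (fun y => coord (G y) j : R^o) y w (f y).
Proof.
move=> Sw j.
have uM y : A y -> hessmx n L0_sym L1_sym (lamf y) (G y) \in unitmx.
  by move=> Ay; apply: hessmx_unit => //; [exact: A_gt0|case: (G_sol Ay)].
have aM a b : integral_alg A G lamf (fun y => hessmx n L0_sym L1_sym (lamf y) (G y) a b).
  rewrite (_ : (fun y => _) = fun y =>
      \int[mu]_th hessA n (enum_val a) (enum_val b) (G y) th +
      lamf y * \int[mu]_th hessB n (enum_val a) (enum_val b) (G y) th +
      antisym R L0_sym L1_sym (enum_val a) (enum_val b)); last first.
    by apply/funext => y; rewrite mxE.
  apply: ialgD; last exact: ialg_cst.
  apply: ialgD; first by apply: ialg_int; exact: integrand_hessA.
  by apply: ialgM; [exact: ialg_lam|apply: ialg_int; exact: integrand_hessB].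
have [f Hf] := choice (fun a => let: ex_intro2 f p q := ialg_invmx aM uM a (enum_rank j) in
  ex_intro (fun f => integral_alg A G lamf f /\ forall y, A y ->
    invmx (hessmx n L0_sym L1_sym (lamf y) (G y)) a (enum_rank j) = f y) f (conj p q)).
exists (fun y => \sum_a (dcoord w.2 (enum_val a) + (- w.1) * momB n (enum_val a) (G y)) * f a y).
  apply: ialg_sum => a; apply: ialgM; last exact: (Hf a).1.
  apply: ialgD; first exact: ialg_cst.
  apply: ialgM; first exact: ialg_cst.
  apply: (@ialg_int _ _ _ _ _ _ _ _ (fun x th => gradB1 n x th * basisP (enum_val a) th)).
  by apply: integrandM; [exact: integrand_gradB1|exact: integrand_basisP].
move=> y Ay; have := @solution_deriv w j y Sw Ay; rewrite mxE.
congr (has_deriv _ _ _ _); apply: eq_bigr => a _.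
by rewrite mxE mulNr (Hf a).2.
Qed.

Lemma solution_smooth : smooth_on S A G.
Proof.
apply: (@smooth_on_integral_alg R d L0 L1 _ S A G lamf A_open _ _ _ _ _ _ N
    (fun a y => coord (G y) (enum_val a)) (fun a => unvec (delta_mx 0 a))).
- by move=> y /G_sol[].
- move=> y Ay; exact: (solution_continuous n_gt0 L0_sym L1_sym A_gt0 G_sol Ay).
- by move=> y Ay; apply: cvg_within_nbhs; exact: cvg_fst.
- exact: solution_deriv_alg.
- move=> w Sw; exists (fun=> w.1); first exact: ialg_cst.
  move=> y Ay; rewrite /has_deriv /lamf.
  apply: (@cvg_near_eq _ _ _ _ (fun=> w.1)); first exact: cvg_cst.
  apply: filterS (@nbhs_dnbhs_neq R 0) => h h0.
  by rewrite /= addrK scalerA mulVf// scale1r.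
- move=> a; exists (fun y => coord (G y) (enum_val a)) => //.
  exact: ialg_coord.
- by move=> y _; exact: unvec_sum.
Qed.

End solution_smooth.

Section omega_smooth.
Variables (R : realType) (d : nat) (L0 L1 : {fset 'rV[int]_d}) (n : nat).
Local Notation V := (mseq R L0 * mseq R L1)%type.
Local Notation W := (mseq R L1 * mseq R L0)%type.
Local Notation J := ('I_#|{: L0}| + 'I_#|{: L1}|)%type.
Local Notation N := #|{: J}|.
Variables (S A : set V).
Hypothesis A_open : forall y w, A y -> S w -> \forall h \near (0 : R)^', A (h *: w + y).
Hypothesis A_pos : forall y, A y -> posPQ y.

Definition swap_unvec (v : 'rV[R]_N) : W := ((unvec v).2, (unvec v).1).

Lemma omega_smooth (lam : R) : smooth_on S A (@omega R d L0 L1 n lam).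
Proof.
apply: (@smooth_on_integral_alg R d L0 L1 _ S A id (fun=> lam) A_open _ _ _ _ _ _ N
    (fun a y => dcoord (omega n lam y) (enum_val a))
    (fun a => swap_unvec (delta_mx 0 a))) => //.
- by move=> y _; exact: cvg_within.
- by move=> y _; exact: cvg_cst.
- move=> w Sw j; exists (fun=> coord w j); first exact: ialg_cst.
  move=> y _; apply: (@cvg_near_eq _ _ _ _ (fun=> coord w j)); first exact: cvg_cst.
  apply: filterS (@nbhs_dnbhs_neq R 0) => h h0.
  rewrite -coordB addrK coordZ /GRing.scale/=.
  by rewrite mulrA mulVf// mul1r.
- by move=> w _; exists (fun=> 0); [exact: ialg_cst|move=> y _; exact: has_deriv_cst].
- move=> a; exists (fun y => momA n (enum_val a) y + lam * momB n (enum_val a) y); last first.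
    by move=> y _; exact: dcoord_omega.
  apply: ialgD; last apply: ialgM.
  + apply: (@ialg_int _ _ _ _ _ _ id _ (fun x th => gradA1 n x th * basisP (enum_val a) th +
      gradA2 n x th * basisQ (enum_val a) th)).
    apply: integrandD; apply: integrandM.
    * exact: integrand_gradA1.
    * exact: integrand_basisP.
    * exact: integrand_gradA2.
    * exact: integrand_basisQ.
  + exact: ialg_cst.
  + apply: (@ialg_int _ _ _ _ _ _ id _ (fun x th => gradB1 n x th * basisP (enum_val a) th)).
    by apply: integrandM; [exact: integrand_gradB1|exact: integrand_basisP].
move=> y _; set z := omega n lam y.
apply: dcoord_eq => j.
have -> : dcoord (\sum_a dcoord z (enum_val a) *: swap_unvec (delta_mx 0 a)) j =
    \sum_a dcoord (dcoord z (enum_val a) *: swap_unvec (delta_mx 0 a)) j.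
  elim/big_ind2 : _ => // [|v r w s <- <-]; last by rewrite dcoordD.
  by case: j => i /=; rewrite mxE.
have sE v : dcoord (swap_unvec v) j = v 0 (enum_rank j) by case: j => i; rewrite /= mxE.
rewrite (bigD1 (enum_rank j))//= dcoordZ sE enum_rankK mxE !eqxx mulr1.
rewrite big1 ?addr0// => a aj; rewrite dcoordZ sE mxE eqxx/=.
by rewrite eq_sym (negPf aj) mulr0.
Qed.

End omega_smooth.

(** * The dual problem *)

Section data_facts.
Variables (R : realType) (d : nat) (Lam : {fset 'rV[int]_d}).
Hypothesis Lam_0 : 0 \in Lam.
Hypothesis Lam_sym : forall k, k \in Lam -> - k \in Lam.
Local Notation L0 := (Lam0 Lam).
Local Notation V := (mseq R L0 * mseq R Lam)%type.
Local Notation T := (d.-tuple R).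
Local Notation mu := (torus_measure R d).

Lemma Lam0_sym k : k \in L0 -> - k \in L0.
Proof. by rewrite !in_fsetD1 oppr_eq0 => /andP[-> /Lam_sym ->]. Qed.

Lemma Lam0_sub k : k \in L0 -> k \in Lam.
Proof. by rewrite in_fsetD1 => /andP[]. Qed.

Lemma coef_extend a (p : mseq R L0) k : k \in Lam ->
  coef (extend a p) k = if k == 0 then a else coef p k.
Proof. by move=> kL; rewrite /extend coef_mkmseq. Qed.

Lemma sum_Lam (F : 'rV[int]_d -> R) : \sum_(k <- Lam) F k = F 0 + \sum_(k <- L0) F k.
Proof. by rewrite (big_fsetD1 0). Qed.

Lemma trigpoly_extend a (p : mseq R L0) th :
  trigpoly (extend a p) th = a + trigpoly p th.
Proof.
rewrite !trigpolyE sum_Lam coef_extend// eqxx; congr (_ + _).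
  rewrite (_ : dotp 0 th = 0) ?cos0 ?mulr1// /dotp big1// => j _.
  by rewrite mxE mul0r.
rewrite big_seq [RHS]big_seq; apply: eq_bigr => k kL.
rewrite coef_extend; last exact: Lam0_sub.
by move: kL; rewrite in_fsetD1 => /andP[/negPf ->].
Qed.

Lemma numPE (x : V) th : numP x th = trigpoly (extend 1 x.1) th.
Proof. by rewrite trigpoly_extend. Qed.

Lemma sym_extend a (p : mseq R L0) :
  symmetric_mseq R Lam (extend a p) <-> symmetric_mseq R L0 p.
Proof.
split=> sp k kL.
  have := sp k (Lam0_sub kL); rewrite !coef_extend ?(Lam0_sub kL) ?(Lam_sym (Lam0_sub kL))//.
  by move: kL; rewrite in_fsetD1 oppr_eq0 => /andP[/negPf ->].
rewrite !coef_extend ?Lam_sym// oppr_eq0; case: eqP => // /eqP k0.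
by apply: sp; rewrite in_fsetD1 k0.
Qed.

Lemma trigpoly_lb (L : {fset 'rV[int]_d}) (q : mseq R L) :
  (forall th, torus th -> 0 < trigpoly q th) ->
  exists2 de, 0 < de & forall th, de <= trigpoly q th.
Proof.
by move=> q0; have [th0 tth0 H] := trigpoly_min q; exists (trigpoly q th0) => //; exact: q0.
Qed.

(** Positive polynomials attain their minimum, so pointwise positivity on the torus is a uniform
    lower bound. *)
Lemma domainP (x : V) :
  (Pplus_o R Lam `*` Pplus R Lam) x <-> sym2 x /\ posPQ x.
Proof.
split=> [[[s1 /trigpoly_lb[de de0 P0]] [s2 /trigpoly_lb[de' de'0 Q0]]]|[[s1 s2] [de de0 H]]].
  split; first by split => //; exact: (sym_extend _ _).1 s1.
  exists (Num.min de de') => [|th]; first by rewrite lt_min de0.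
  by rewrite numPE /denQ !ge_min P0 Q0 orbT.
split; split => //; first exact: (sym_extend _ _).2 s1.
  by move=> th _; have [h _] := H th; rewrite -numPE (lt_le_trans de0).
by move=> th _; have [_ h] := H th; rewrite (lt_le_trans de0).
Qed.

Lemma Re_moment (Phi : T -> R) k :
  complex.Re (moment Phi k) = \int[mu]_th (cos (dotp k th) * Phi th).
Proof. by apply: eq_Rintegral => th _ /=; rewrite mulr0 subr0. Qed.

Lemma Im_moment (Phi : T -> R) k :
  complex.Im (moment Phi k) = \int[mu]_th (sin (dotp k th) * Phi th).
Proof. by apply: eq_Rintegral => th _ /=; rewrite mulr0 add0r. Qed.

Lemma Gamma_coord (L : {fset 'rV[int]_d}) (Phi : T -> R) i :
  (Gamma L Phi) 0 i = \int[mu]_th (cos (dotp (freq i) th) * Phi th).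
Proof. by rewrite mxE Re_moment. Qed.

Lemma Gamma_is_moments (L : {fset 'rV[int]_d}) (Phi : T -> R) :
  torus_fun Phi -> bmeas Phi -> (forall th, Phi (opp_angle th) = Phi th) ->
  is_moments Phi (Gamma L Phi).
Proof.
move=> tP bP eP k kL; rewrite coef_mkmseq//.
have : complex.Im (moment Phi k) = 0.
  rewrite Im_moment; apply: Rintegral_odd.
  - by move=> th th' H; rewrite (tP _ _ H) (sin_torus_fun _ H).
  - by apply: bmeasM => //; exact: bmeas_sin.
  by move=> th; rewrite dotp_opp sinN eP mulNr.
by case: (moment Phi k) => a b /= ->.
Qed.

Lemma pairingE (L : {fset 'rV[int]_d}) (p q : mseq R L) :
  pairing p q = \sum_i p 0 i * q 0 i.
Proof. by rewrite /pairing sum_freq; apply: eq_bigr => i _; rewrite !coef_freq. Qed.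

Lemma pairing_le (L : {fset 'rV[int]_d}) (p q : mseq R L) :
  `|pairing p q| <= #|{: L}|%:R * (`|p| * `|q|).
Proof.
rewrite pairingE (le_trans (ler_norm_sum _ _ _))//.
rewrite mulr_natl -[X in _ *+ X]card_ord -sumr_const.
by apply: ler_sum => i _; rewrite normrM ler_pM// norm_coord.
Qed.

Lemma pairingB (L : {fset 'rV[int]_d}) (p q r : mseq R L) :
  pairing p q - pairing p r = pairing p (q - r : mseq R L).
Proof. by rewrite !pairingE -sumrB; apply: eq_bigr => i _; rewrite !mxE mulrBr. Qed.

Lemma pairingZ (L : {fset 'rV[int]_d}) a (p q : mseq R L) :
  pairing (a *: p : mseq R L) q = a * pairing p q.
Proof. by rewrite !pairingE mulr_sumr; apply: eq_bigr => i _; rewrite mxE mulrA. Qed.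

Lemma closed_Pge : closed (@Pge R d Lam).
Proof.
move=> q cq; split.
  apply/(sym_mseqP Lam_sym) => i; apply/eqP; rewrite -subr_eq0; apply/eqP.
  apply: (@norm_le_eq0 _ _ 2) => e e0; have [y [sy _] xy] := closure_dist cq e0.
  have h k : `|q 0 k - y 0 k| <= e.
    have := norm_coord (q - y) k; rewrite !mxE => H; exact: le_trans H xy.
  have := h i; have := h (negidx Lam_sym i); rewrite (sym_mseqP Lam_sym y).1// => h1 h2.
  have -> : q 0 (negidx Lam_sym i) - q 0 i =
    (q 0 (negidx Lam_sym i) - y 0 i) - (q 0 i - y 0 i) by ring.
  by rewrite (le_trans (ler_normB _ _))//; lra.
move=> th; rewrite leNgt; apply/negP => neg.
pose N : R := #|{: Lam}|%:R + 1.
have N0 : 0 < N by rewrite ltr_wpDl.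
have e0 : 0 < - trigpoly q th / 2 / N by rewrite !divr_gt0// oppr_gt0.
have [y [_ y0] qy] := closure_dist cq e0.
have h1 : `|trigpoly (q - y) th| <= - trigpoly q th / 2.
  rewrite (le_trans (trigpoly_le_norm _ _))//.
  have -> : - trigpoly q th / 2 = N * (- trigpoly q th / 2 / N).
    by rewrite [RHS]mulrC divfK// gt_eqF.
  by rewrite ler_pM// lerDl.
move: h1; rewrite trigpolyB ler_norml => /andP[h1 _].
by have := y0 th; lra.
Qed.

Lemma Pplus_Pge (q : mseq R Lam) : Pplus R Lam q -> Pge q.
Proof. by move=> [sq /trigpoly_lb[de de0 H]]; split => // th; rewrite (le_trans _ (H th))// ltW. Qed.

Lemma closure_Pplus (q : mseq R Lam) : closure (Pplus R Lam) q -> Pge q.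
Proof. by move=> cq; apply: closed_Pge; apply: closureS cq => r; exact: Pplus_Pge. Qed.

(** Restoring the constant coefficient does not increase distances, so it maps the closure into the
    closed cone [Pge]. *)
Lemma closure_Pplus_o (p : mseq R L0) : closure (Pplus_o R Lam) p -> Pge (extend 1 p).
Proof.
move=> cp; apply: closed_Pge => B /nbhs_ballP[e /= e0 eB].
have e20 : 0 < e / 2 by lra.
have [p' Pp' pp'] := closure_dist cp e20.
exists (extend 1 p'); split; first exact: Pplus_Pge.
apply: eB; rewrite -ball_normE /= (le_lt_trans (_ : _ <= e / 2))//; last by lra.
apply: norm_rV_le => [|i]; first exact: ltW.
rewrite !mxE; case: ifP => _; first by rewrite subrr normr0 ltW.
rewrite -coefN -coefD /coef; case: insubP => [k _ _|_]; last by rewrite normr0 ltW.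
by rewrite (le_trans _ pp')//; exact: norm_coord.
Qed.

Definition cone_pos (c : mseq R Lam) := forall q, Pge q -> q != 0 -> 0 < pairing q c.

(** The positive linear functional attains its minimum on the compact set of nonnegative polynomials
    of norm 1; homogeneity extends the bound. *)
Lemma cone_pos_lb c : cone_pos c ->
  exists2 de, 0 < de & forall q, Pge q -> de * `|q| <= pairing q c.
Proof.
move=> cc; pose K : set (mseq R Lam) := [set q | Pge q /\ `|q| = 1].
have cK : compact K.
  apply: bounded_closed_compact.
    exists 1; split; first exact: num_real.
    move=> M M1 q [_ q1]; apply: le_trans (ltW M1).
    by rewrite le_eqVlt; apply/orP; left; apply/eqP; exact: q1.
  move=> q cq; split.
    by apply: closed_Pge; apply: closureS cq => z [].
  apply/eqP; rewrite -subr_eq0; apply/eqP; apply: (@norm_le_eq0 _ _ 1) => t t0.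
  have [z [_ z1] yz] := closure_dist cq t0; rewrite mul1r -z1 (le_trans _ yz)//.
  exact: ler_dist_dist.
have pc : {within K, continuous (fun q : mseq R Lam => pairing q c)}.
  apply: continuous_subspaceT => q.
  rewrite (_ : (fun q : mseq R Lam => pairing q c) = fun q : mseq R Lam => \sum_i q 0 i * c 0 i).
    apply: (@cvg_sumr _ _ (nbhs q) _) => i _; apply: cvgM; last exact: cvg_cst.
    exact: coord_continuous.
  by apply/funext => r; exact: pairingE.
have [de de0 deK] : exists2 de, 0 < de & forall q, K q -> de <= pairing q c.
  have [K0|/set0P/negP/negPn/eqP K0] := pselect (K !=set0); last first.
    by exists 1 => // y; rewrite K0.
  have [q qK qmin] := compact_EVT_min K0 cK pc.
  move: qK; rewrite inE => -[Pq q1].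
  exists (pairing q c); last by move=> y Ky; apply: qmin; rewrite inE.
  by apply: cc => //; rewrite -normr_eq0 q1 oner_eq0.
exists de => // q [sq q0].
have [->|qn0] := eqVneq q 0.
  by rewrite normr0 mulr0 pairingE big1// => i _; rewrite mxE mul0r.
have nq : 0 < `|q| by rewrite normr_gt0.
have Kq : K (`|q|^-1 *: q).
  split; last by rewrite normrZ ger0_norm ?invr_ge0// mulVf// gt_eqF.
  split; first exact: sym_mseqZ.
  by move=> th; rewrite trigpolyZ mulr_ge0// invr_ge0.
by have := deK _ Kq; rewrite pairingZ mulrC ler_pdivlMr.
Qed.

(** The sequence consists of the moments of the constant 1; pairing with it extracts the constant
    coefficient. With [cone_pos_lb] this bounds a nonnegative polynomial by that coefficient, hence
    [extend_bounded]. *)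
Lemma cone_pos_unit : cone_pos (mkmseq Lam (fun k => (k == 0)%:R)).
Proof.
move=> q Pq q0; rewrite /pairing sum_Lam coef_mkmseq// eqxx mulr1.
rewrite big_seq big1 ?addr0; first exact: Pge_coef0_gt0.
move=> k; rewrite in_fsetD1 => /andP[/negPf k0 kL].
by rewrite coef_mkmseq// k0 mulr0.
Qed.

Lemma extend_bounded : exists B : R, forall p : mseq R L0, Pge (extend 1 p) -> `|extend 1 p| <= B.
Proof.
have [de de0 H] := cone_pos_lb cone_pos_unit.
exists de^-1 => p Pp; have := H _ Pp.
rewrite /pairing sum_Lam coef_mkmseq// eqxx mulr1 coef_extend// eqxx.
rewrite big_seq big1 ?addr0 => [|k].
  by rewrite mulrC -ler_pdivlMr// mul1r.
rewrite in_fsetD1 => /andP[/negPf k0 kL].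
by rewrite coef_mkmseq// k0 mulr0.
Qed.

Lemma norm_extend (p : mseq R L0) a : `|p| <= `|extend a p|.
Proof.
apply: norm_rV_le => // i; have kL := Lam0_sub (freq_in i).
have -> : p 0 i = coef (extend a p) (freq i).
  rewrite coef_extend// -coef_freq; have := freq_in i.
  by rewrite in_fsetD1 => /andP[/negPf ->].
rewrite /coef; case: insubP => [k _ _|_]; last by rewrite normr0.
exact: norm_coord.
Qed.

Lemma Cplus_coef (c : mseq R Lam) (Phi : T -> R) k : k \in Lam -> is_moments Phi c ->
  coef c k = \int[mu]_th (cos (dotp k th) * Phi th).
Proof. by move=> kL mc; rewrite -Re_moment (mc k kL). Qed.

Lemma Cplus_sym (c : mseq R Lam) : Cplus R Lam c -> symmetric_mseq R Lam c.
Proof.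
move=> [Phi [_ mc]] k kL; rewrite !(Cplus_coef _ mc) ?Lam_sym//.
by apply: eq_Rintegral => th _; rewrite dotp_oppl cosN.
Qed.

Lemma open_ball_shift (a : T) r : 0 < r -> exists2 s, 0 < s &
  forall x : 'I_d -> R, (forall j, `|x j| < s) -> open_ball a r (shift a x).
Proof.
move=> r0; have d1 : 0 < d%:R + 1 :> R by rewrite ltr_wpDl.
(* A cube of half-side [r / (d + 1)] lies in the ball because [d < (d + 1) ^ 2]. *)
exists (r / (d%:R + 1)) => [|x xs]; first by rewrite divr_gt0.
rewrite /open_ball /=.
have h j : (tnth (shift a x) j - tnth a j) ^+ 2 <= (r / (d%:R + 1)) ^+ 2.
  rewrite tnth_mktuple addrAC subrr add0r -real_normK ?num_real//.
  by rewrite lerXn2r// ?nnegrE ?divr_ge0 ?(ltW r0) ?(ltW d1)// ltW.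
apply: le_lt_trans (ler_sum _ (fun j _ => h j)) _.
have -> : \sum_(j < d) (r / (d%:R + 1)) ^+ 2 = d%:R * r ^+ 2 / (d%:R + 1) ^+ 2.
  rewrite sumr_const card_ord; set D := d%:R + 1 in d1 *.
  by rewrite -[LHS]mulr_natl; field; rewrite gt_eqF.
rewrite ltr_pdivrMr ?exprn_gt0// mulrC ltr_pM2l ?exprn_gt0//.
by rewrite expr2; have := ler0n R d; nra.
Qed.

(** The pairing is the integral of Q times the density, which is positive on a small cube except
    where Q vanishes. *)
Lemma Cplus_cone_pos (c : mseq R Lam) : Cplus R Lam c -> cone_pos c.
Proof.
move=> [Phi [[tP iP P0 [a [r [r0 Pa]]] _] mc]] q [sq q0] qn0.
have iQ : mu.-integrable setT (EFin \o (fun th => trigpoly q th * Phi th)).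
  by apply: bmeas_integrableM => //; exact: bmeas_trigpoly.
have -> : pairing q c = \int[mu]_th (trigpoly q th * Phi th).
  transitivity (\int[mu]_th (\sum_i q 0 i * (cos (dotp (freq i) th) * Phi th))); last first.
    apply: eq_Rintegral => th _; rewrite trigpoly_freq mulr_suml.
    by apply: eq_bigr => i _; rewrite mulrA.
  rewrite Rintegral_sum; last first.
    move=> i; apply: (@bmeas_integrableM _ _ _ mu (fun=> q 0 i)
      (fun th => cos (dotp (freq i) th) * Phi th)); [exact: bmeas_cst|].
    by apply: bmeas_integrableM => //; exact: bmeas_cos.
  rewrite pairingE; apply: eq_bigr => i _; rewrite RintegralZl//; last first.
    by apply: bmeas_integrableM => //; exact: bmeas_cos.
  by rewrite -(Cplus_coef _ mc) ?coef_freq// freq_in.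
have [s s0 Hs] := open_ball_shift a r0.
apply: (@trigpoly_Rintegral_gt0 R d Lam Lam_sym q _ a s) => //.
- by move=> th th' H; rewrite (tP _ _ H) (trigpoly_torus_fun _ H).
- by move=> th; rewrite mulr_ge0.
move=> x xs qx; rewrite mulr_gt0//; last by apply: Pa; exact: Hs.
by rewrite lt_neqAle eq_sym qx q0.
Qed.

End data_facts.

(** * The dual function and its critical points *)

Section dual_problem.
Variables (R : realType) (d : nat) (Lam : {fset 'rV[int]_d}) (n : nat).
Hypothesis d_gt0 : (0 < d)%N.
Hypothesis Lam_0 : 0 \in Lam.
Hypothesis Lam_sym : forall k, k \in Lam -> - k \in Lam.
Hypothesis n_gt0 : (0 < n)%N.
Hypothesis d_le : (d <= n.*2)%N.
Local Notation L0 := (Lam0 Lam).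
Local Notation V := (mseq R L0 * mseq R Lam)%type.
Local Notation W := (mseq R Lam * mseq R L0)%type.
Local Notation J := ('I_#|{: L0}| + 'I_#|{: Lam}|)%type.
Local Notation mu := (torus_measure R d).
Local Notation L0_sym := (Lam0_sym Lam_sym).
Implicit Types (x y u : V) (z : W).

Let n0 : (0 : R) < n%:R. Proof. by rewrite ltr0n. Qed.

Definition costA x th : R := n%:R^-1 * (numP x th * ratio x th ^+ n).
Definition costB x th : R := n%:R^-1 * (numP x th)^-1 ^+ n.

Lemma cara_costA x : posPQ x -> cara x costA
  (fun j th => gradA1 n x th * basisP j th + gradA2 n x th * basisQ j th).
Proof.
move=> Dx; have nx := near_posPQ Dx.
have := caraZ n%:R^-1 Dx (caraM Dx nx (cara_numP x) (caraX Dx nx n (cara_ratio Dx))).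
apply: cara_eq => j th; rewrite /gradA1 /gradA2 /dratio.
have e : ratio x th ^+ n = ratio x th * ratio x th ^+ n.-1 by rewrite -exprS prednK.
rewrite exprS !e -natr1.
move: (ratio x th ^+ n.-1) => r'; rewrite /ratio.
have [px qx] := posPQ_gt0 th Dx.
by field; rewrite !gt_eqF.
Qed.

Lemma cara_costB x : posPQ x -> cara x costB (fun j th => gradB1 n x th * basisP j th).
Proof.
move=> Dx; have nx := near_posPQ Dx.
have := caraZ n%:R^-1 Dx (caraX Dx nx n (cara_numPV Dx)).
apply: cara_eq => j th; rewrite /gradB1.
have -> : (numP x th)^-1 ^+ n.+1 = (numP x th)^-1 * ((numP x th)^-1 * (numP x th)^-1 ^+ n.-1).
  by rewrite -!exprS prednK.
move: (_ ^+ n.-1) => r'; have [px qx] := posPQ_gt0 th Dx.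
by field; rewrite !gt_eqF.
Qed.

Definition dual_lin (m0 : R) z x : R :=
  pairing x.2 z.1 - pairing (extend 1 x.1) (extend m0 z.2).

Definition dual_real (lam m0 : R) z x : R :=
  \int[mu]_th costA x th + dual_lin m0 z x + lam * \int[mu]_th costB x th.

(** The data enter as a linear form with vector [(- z.1, z.2)], the prescribed value of the moment
    map; [m0] contributes a constant. *)
Lemma dual_linE m0 z x : dual_lin m0 z x = - m0 - sumE x ((- z.1, z.2) : W).
Proof.
rewrite /dual_lin /sumE big_sumType /= pairingE.
have -> : pairing (extend 1 x.1) (extend m0 z.2) = m0 + pairing x.1 z.2.
  rewrite /pairing sum_Lam// !coef_extend// eqxx mul1r; congr (_ + _).
  rewrite big_seq [RHS]big_seq; apply: eq_bigr => k kL.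
  rewrite (coef_extend 1 x.1 (Lam0_sub kL)) (coef_extend m0 z.2 (Lam0_sub kL)).
  by move: kL; rewrite in_fsetD1 => /andP[/negPf ->].
rewrite pairingE.
have -> : \sum_i x.2 0 i * (- z.1) 0 i = - \sum_i x.2 0 i * z.1 0 i.
  by rewrite -sumrN; apply: eq_bigr => i _; rewrite mxE mulrN.
by ring.
Qed.

Lemma dual_funE (lam m0 : R) z x : posPQ x ->
  dual_fun n.+1 lam m0 z x = (dual_real lam m0 z x)%:E.
Proof.
move=> Dx; rewrite /dual_fun /dual_real /=.
have nn : n.+1%:R - 1 = n%:R :> R by rewrite -natr1 addrK.
rewrite nn.
have bA : bmeas (costA x) by have [b _ _] := cara_costA Dx; exact: b.
have bB : bmeas (costB x) by have [b _ _] := cara_costB Dx; exact: b.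
have bA' : bmeas (fun th => n%:R * costA x th) by apply: bmeasM => //; exact: bmeas_cst.
have bB' : bmeas (fun th => n%:R * costB x th) by apply: bmeasM => //; exact: bmeas_cst.
have -> : (\int[mu]_th ((trigpoly (extend 1 x.1) th ^+ n.+1)%:E / (trigpoly x.2 th ^+ n)%:E) =
    (n%:R * \int[mu]_th costA x th)%:E)%E.
  rewrite -RintegralZl//; last exact: bmeas_integrable.
  rewrite EFin_Rintegral; last exact: bmeas_integrable.
  apply: eq_integral => th _; have [px qx] := posPQ_gt0 th Dx.
  rewrite inver (gt_eqF (exprn_gt0 _ qx)) -EFinM; congr (_%:E).
  rewrite /costA -numPE// /denQ /ratio exprS exprMn exprVn mulrA divff ?gt_eqF// mul1r.
  by rewrite mulrA.
have -> : (\int[mu]_th ((trigpoly (extend 1 x.1) th ^+ n)%:E)^-1 =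
    (n%:R * \int[mu]_th costB x th)%:E)%E.
  rewrite -RintegralZl//; last exact: bmeas_integrable.
  rewrite EFin_Rintegral; last exact: bmeas_integrable.
  apply: eq_integral => th _; have [px qx] := posPQ_gt0 th Dx.
  rewrite inver -numPE// (gt_eqF (exprn_gt0 _ px)); congr (_%:E).
  by rewrite /costB mulrA divff ?gt_eqF// mul1r exprVn.
rewrite -!EFinM -!EFinD; congr (_%:E); rewrite /dual_lin.
by field; rewrite gt_eqF.
Qed.

Lemma dual_real_cara (lam m0 : R) z x : posPQ x -> exists k : J -> V -> R,
  (forall y, posPQ y -> dual_real lam m0 z y - dual_real lam m0 z x =
     \sum_j (coord y j - coord x j) * k j y) /\
  forall j, k j y @[y --> x] --> dcoord (omega n lam x) j - dcoord ((- z.1, z.2) : W) j.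
Proof.
move=> Dx; have nx := near_posPQ Dx.
have [kA kAE kAc] := cara_Rintegral Dx nx (cara_costA Dx).
have [kB kBE kBc] := cara_Rintegral Dx nx (cara_costB Dx).
exists (fun j y => kA j y + lam * kB j y - dcoord ((- z.1, z.2) : W) j); split.
  move=> y Dy.
  transitivity ((\int[mu]_th costA y th - \int[mu]_th costA x th) +
    lam * (\int[mu]_th costB y th - \int[mu]_th costB x th) +
    (dual_lin m0 z y - dual_lin m0 z x)); first by rewrite /dual_real; ring.
  rewrite kAE// kBE// !dual_linE.
  have -> : - m0 - sumE y (- z.1, z.2) - (- m0 - sumE x (- z.1, z.2)) =
      \sum_j (coord y j - coord x j) * - dcoord ((- z.1, z.2) : W) j.
    transitivity (sumE x (- z.1, z.2) - sumE y (- z.1, z.2)); first by ring.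
    rewrite /sumE -sumrB.
    by apply: eq_bigr => j _; ring.
  by rewrite mulr_sumr -!big_split; apply: eq_bigr => j _ /=; ring.
move=> j; rewrite dcoord_omega; apply: cvgB; last exact: cvg_cst.
by apply: cvgD; [exact: kAc|apply: cvgM; [exact: cvg_cst|exact: kBc]].
Qed.

Lemma dual_real_continuous (lam m0 : R) z x : posPQ x ->
  dual_real lam m0 z y @[y --> x] --> dual_real lam m0 z x.
Proof.
by move=> Dx; have [k [kE kc]] := dual_real_cara lam m0 z Dx; exact: cara_continuous Dx kE kc.
Qed.

Lemma basisP_sig j th : basisP (sig L0_sym Lam_sym j) th = basisP j th :> R.
Proof. by case: j => i //=; rewrite freq_negidx dotp_oppl cosN. Qed.

Lemma basisQ_sig j th : basisQ (sig L0_sym Lam_sym j) th = basisQ j th :> R.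
Proof. by case: j => i //=; rewrite freq_negidx dotp_oppl cosN. Qed.

Lemma omega_sym (lam : R) x j :
  dcoord (omega n lam x) (sig L0_sym Lam_sym j) = dcoord (omega n lam x) j.
Proof.
rewrite !dcoord_omega; congr (_ + _ * _); apply: eq_Rintegral => th _.
  by rewrite basisP_sig basisQ_sig.
by rewrite basisP_sig.
Qed.

(** The negative gradient [u] is symmetric, since both the moment map and the data are, so it is an
    admissible direction; a small step along it would decrease the function unless the gradient is
    zero. *)
Lemma min_critical (lam m0 : R) z x : sym2 x -> posPQ x ->
  symmetric_mseq R Lam z.1 -> symmetric_mseq R L0 z.2 ->
  (forall y, sym2 y -> posPQ y -> dual_real lam m0 z x <= dual_real lam m0 z y) ->
  omega n lam x = (- z.1, z.2).
Proof.
move=> sx Dx s1 s2 xmin; pose z' : W := (- z.1, z.2).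
pose g j := dcoord (omega n lam x) j - dcoord z' j.
have gs j : g (sig L0_sym Lam_sym j) = g j.
  rewrite /g omega_sym; congr (_ - _); case: j => i /=.
    exact: ((sym_mseqP L0_sym _).1 s2).
  by rewrite !mxE; congr (- _); exact: ((sym_mseqP Lam_sym _).1 s1).
pose u : V := (\row_i - g (inl i), \row_i - g (inr i)).
have uE j : coord u j = - g j by case: j => i; rewrite /= mxE.
have su : sym2 u by apply/(sym2P L0_sym Lam_sym) => j; rewrite !uE gs.
have [k [kE kc]] := dual_real_cara lam m0 z Dx.
have Sc : \sum_j coord u j * k j y @[y --> x] --> \sum_j coord u j * g j.
  apply: (@cvg_sumr _ _ (nbhs x) _) => j _; apply: cvgM; first exact: cvg_cst.
  exact: kc.
have sq : \sum_j coord u j * g j = - \sum_j g j ^+ 2.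
  by rewrite -sumrN; apply: eq_bigr => j _; rewrite uE expr2 mulNr.
have g0 : \sum_j g j ^+ 2 = 0.
  apply/eqP; rewrite eq_le sumr_ge0 ?andbT => [|j _]; last exact: sqr_ge0.
  rewrite leNgt; apply/negP => gpos.
  have neg : \forall y \near x, \sum_j coord u j * k j y < 0 /\ posPQ y.
    apply: filterI; last exact: near_posPQ.
    by apply: (cvgr_lt (\sum_j coord u j * g j) Sc 0); rewrite sq oppr_lt0.
  have [e /= e0 eH] := (nbhs_ballP _ _).1 neg.
  (* The step keeps [x + h *: u] in the ball where the slope is negative and positivity holds;
     adding 1 to the norm makes the denominator positive. *)
  pose h := e / 2 / (`|u| + 1).
  have u1 : 0 < `|u| + 1 by rewrite ltr_wpDl.
  have h0 : 0 < h by rewrite !divr_gt0.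
  pose y := x + h *: u.
  have [ylt Dy] : \sum_j coord u j * k j y < 0 /\ posPQ y.
    apply: eH; rewrite -ball_normE /= /y opprD addrA subrr add0r normrN normrZ.
    rewrite gtr0_norm// (le_lt_trans (_ : _ <= h * (`|u| + 1)))//.
      by rewrite ler_wpM2l ?(ltW h0)// lerDl.
    by rewrite /h divfK ?gt_eqF//; lra.
  have := xmin y (sym2D sx (sym2Z h su)) Dy; rewrite leNgt => /negP; apply.
  rewrite -subr_lt0 kE//.
  have -> : \sum_j (coord y j - coord x j) * k j y = h * \sum_j coord u j * k j y.
    rewrite mulr_sumr; apply: eq_bigr => j _.
    by rewrite -coordB /y addrAC subrr add0r coordZ mulrA.
  by rewrite pmulr_rlt0.
apply: dcoord_eq => j; apply/eqP; rewrite -subr_eq0 -/(g j) -sqrf_eq0.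
move/eqP: g0; rewrite psumr_eq0; last by move=> i _; exact: sqr_ge0.
by move=> /allP/(_ j (mem_index_enum j)).
Qed.

End dual_problem.

Lemma ereal_sum3_le {R : realType} (c1 c2 l M : R) (I1 I2 : \bar R) :
  0 < c1 -> 0 < c2 -> (0 <= I1)%E -> (0 <= I2)%E ->
  (c1%:E * I1 + l%:E + c2%:E * I2 <= M%:E)%E ->
  exists r1 r2, [/\ I1 = r1%:E, I2 = r2%:E, 0 <= r1, 0 <= r2 & c1 * r1 + l + c2 * r2 <= M].
Proof.
move=> c10 c20; case: I1 => [r1| |] //; case: I2 => [r2| |] //.
- by rewrite !lee_fin => h1 h2 h; exists r1, r2.
- by move=> _ _; rewrite gt0_muley ?lte_fin// addey// leye_eq.
- by move=> _ _; rewrite gt0_muley ?lte_fin.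
- by move=> _ _; rewrite !gt0_muley ?lte_fin.
Qed.

(** * Existence of minimizers and description of the data cone *)

Section dual_minimizer.
Variables (R : realType) (d : nat) (Lam : {fset 'rV[int]_d}) (n : nat).
Hypothesis d_gt0 : (0 < d)%N.
Hypothesis Lam_0 : 0 \in Lam.
Hypothesis Lam_sym : forall k, k \in Lam -> - k \in Lam.
Hypothesis n_gt0 : (0 < n)%N.
Hypothesis d_le : (d <= n.*2)%N.
Local Notation L0 := (Lam0 Lam).
Local Notation V := (mseq R L0 * mseq R Lam)%type.
Local Notation W := (mseq R Lam * mseq R L0)%type.
Local Notation mu := (torus_measure R d).
Local Notation L0_sym := (Lam0_sym Lam_sym).
Implicit Types (x y : V) (z : W).

Let n0 : (0 : R) < n%:R. Proof. by rewrite ltr0n. Qed.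

(** Since P is bounded a priori, the linear term in [p] is at least [- C1]; the two integrals and
    the term in [q] are nonnegative, so each is at most [M + C1]. The finite integrals then exclude
    zeros, of P first and of Q next. *)
Lemma dual_coercive (lam m0 M : R) z : 0 < lam -> cone_pos z.1 ->
  exists de C : R, 0 < de /\ forall x, Pge (extend 1 x.1) -> Pge x.2 ->
    (dual_fun n.+1 lam m0 z x <= M%:E)%E ->
    [/\ sym2 x, forall th, de <= numP x th /\ de <= denQ x th & `|x| <= C].
Proof.
move=> lam0 cz.
have [B HB] := extend_bounded R Lam_0 Lam_sym.
have [e0 e0_gt0 He0] := cone_pos_lb Lam_sym cz.
pose C1 := #|{: Lam}|%:R * (`|B| * `|extend m0 z.2|).
pose c1 : R := n%:R^-1; pose c2 := lam / n%:R.
have c10 : 0 < c1 by rewrite invr_gt0.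
have c20 : 0 < c2 by rewrite divr_gt0.
have [de1 de1_gt0 H1] := @trigpoly_lb_of_integral R d Lam d_gt0 B ((M + C1) / c2) n d_le.
have [de2 de2_gt0 H2] := @trigpoly_lb_of_integral R d Lam d_gt0 ((M + C1) / e0)
  ((M + C1) / c1 / de1 ^+ n.+1) n d_le.
exists (Num.min de1 de2), (Num.max B ((M + C1) / e0)).
split; first by rewrite lt_min de1_gt0.
move=> x Px Qx.
have nn : n.+1%:R - 1 = n%:R :> R by rewrite -natr1 addrK.
rewrite /dual_fun /= nn -/c1 -/c2.
set I1 := (\int[_]_th (_ / _))%E; set I2 := (\int[_]_th _)%E.
have P0 th := Px.2 th; have Q0 th := Qx.2 th.
have inv0 (u : R) : 0 <= u -> (0 <= (u%:E)^-1)%E by move=> u0; rewrite inve_ge0 lee_fin.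
have I10 : (0 <= I1)%E.
  apply: integral_ge0 => th _; apply: mule_ge0; first by rewrite lee_fin exprn_ge0.
  by apply: inv0; rewrite exprn_ge0.
have I20 : (0 <= I2)%E.
  by apply: integral_ge0 => th _; apply: inv0; rewrite exprn_ge0.
move=> /(ereal_sum3_le c10 c20 I10 I20)[r1 [r2 [e1 e2 r10 r20 le]]].
have pl : `|pairing (extend 1 x.1) (extend m0 z.2)| <= C1.
  rewrite (le_trans (pairing_le _ _))// /C1 ler_wpM2l// ler_wpM2r//.
  by rewrite (le_trans (HB _ Px))// ler_norm.
have ql := He0 _ Qx.
have c1r1 : 0 <= c1 * r1 by rewrite mulr_ge0// ltW.
have c2r2 : 0 <= c2 * r2 by rewrite mulr_ge0// ltW.
have eq0 : 0 <= e0 * `|x.2| by rewrite mulr_ge0// ltW.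
have [pl1 pl2] := (ler_normlP _ _ pl).
have b0 : e0 * `|x.2| <= M + C1 by lra.
have b1 : c1 * r1 <= M + C1 by lra.
have b2 : c2 * r2 <= M + C1 by lra.
have qB : `|x.2| <= (M + C1) / e0 by rewrite ler_pdivlMr// mulrC.
have {}H1 : forall th, de1 <= numP x th.
  move=> th; rewrite numPE//; apply: H1 => //; first exact: HB.
  by rewrite -/I2 e2 lee_fin ler_pdivlMr// mulrC.
have {}H2 : forall th, de2 <= denQ x th.
  apply: H2 => //.
  have mP : measurable_fun setT (fun th => (trigpoly (extend 1 x.1) th ^+ n.+1)%:E).
    by apply/measurable_EFinP; have [] := bmeasX n.+1 (bmeas_trigpoly (extend 1 x.1)).
  have mQ : measurable_fun setT (fun th => ((trigpoly x.2 th ^+ n)%:E)^-1)%E.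
    by apply: measurable_inveE; have [] := bmeasX n (bmeas_trigpoly x.2).
  have d1 : 0 < de1 ^+ n.+1 by rewrite exprn_gt0.
  (* The lower bound on P turns the first integral into a bound on the integral of [1 / Q ^ n]. *)
  have : ((de1 ^+ n.+1)%:E * \int[mu]_th ((trigpoly x.2 th ^+ n)%:E)^-1 <= I1)%E.
    rewrite -ge0_integralZl_EFin//; last 2 first.
    - by move=> th _; apply: inv0; rewrite exprn_ge0.
    - exact: ltW.
    apply: ge0_le_integral => //.
    - by move=> th _; apply: mule_ge0; [rewrite lee_fin ltW|apply: inv0; rewrite exprn_ge0].
    - exact: measurable_funeM.
    - exact: emeasurable_funM.
    move=> th _; apply: lee_wpmul2r; first by apply: inv0; rewrite exprn_ge0.
    rewrite lee_fin lerXn2r// ?nnegrE; [exact: ltW|exact: P0|].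
    by rewrite -numPE.
  rewrite e1; have : (0 <= \int[mu]_th ((trigpoly x.2 th ^+ n)%:E)^-1)%E.
    by apply: integral_ge0 => th _; apply: inv0; rewrite exprn_ge0.
  case: (\int[mu]_th _)%E => [r| |]//; last by rewrite gt0_muley ?lte_fin.
  rewrite -EFinM !lee_fin => r0; rewrite mulrC => h.
  by rewrite ler_pdivlMr// (le_trans h)// ler_pdivlMr// mulrC.
split.
- by split; [exact: (sym_extend Lam_sym 1 x.1).1 Px.1|exact: Qx.1].
- by move=> th; rewrite !ge_min H1 H2 orbT.
rewrite prod_normE ge_max !le_max qB orbT andbT.
by rewrite (le_trans (norm_extend x.1 1))// HB.
Qed.

(** The point P = Q = 1; its cost fixes a finite level whose sublevel set is nonempty. *)
Definition flat : V := (0, mkmseq Lam (fun k => (k == 0)%:R)).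

Lemma flatE th : numP flat th = 1 /\ denQ flat th = 1.
Proof.
split.
  by rewrite /numP /= trigpoly_freq big1 ?addr0// => i _; rewrite mxE mul0r.
rewrite /denQ /= trigpolyE sum_Lam// coef_mkmseq// eqxx mul1r.
rewrite big_seq big1 ?addr0 => [|k].
  by rewrite (_ : dotp 0 th = 0) ?cos0// /dotp big1// => j _; rewrite mxE mul0r.
by rewrite in_fsetD1 => /andP[/negPf k0 kL]; rewrite coef_mkmseq// k0 mul0r.
Qed.

Lemma flat_dom : sym2 flat /\ posPQ flat.
Proof.
split; last by exists 1 => // th; have [-> ->] := flatE th.
split; first by apply/(sym_mseqP L0_sym) => i; rewrite !mxE.
by move=> k kL; rewrite !coef_mkmseq ?Lam_sym// oppr_eq0.
Qed.

Lemma dom_Pge x : sym2 x -> posPQ x -> Pge (extend 1 x.1) /\ Pge x.2.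
Proof.
move=> [s1 s2] Dx; split; split => //.
- exact: (sym_extend Lam_sym 1 x.1).2.
- by move=> th; rewrite -numPE// ltW//; case: (posPQ_gt0 th Dx).
- by move=> th; rewrite ltW//; case: (posPQ_gt0 th Dx).
Qed.

(** The minimum is taken on a compact part [K] of the open domain that contains the sublevel set of
    [flat]. The last clause confines every competing minimizer to the open domain, where criticality
    identifies it. *)
Lemma dual_min_exists (lam m0 : R) z : 0 < lam -> cone_pos z.1 ->
  exists x, [/\ sym2 x, posPQ x,
    forall y, Pge (extend 1 y.1) -> Pge y.2 ->
      (dual_fun n.+1 lam m0 z x <= dual_fun n.+1 lam m0 z y)%E
  & forall y, Pge (extend 1 y.1) -> Pge y.2 ->
      (dual_fun n.+1 lam m0 z y <= dual_fun n.+1 lam m0 z x)%E -> sym2 y /\ posPQ y].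
Proof.
move=> lam0 cz; have [sf Df] := flat_dom; have [Pf Qf] := dom_Pge sf Df.
pose M := dual_real n lam m0 z flat.
have [de [C [de0 H]]] := dual_coercive m0 M lam0 cz.
pose K : set V := [set x | [/\ sym2 x, forall th, de <= numP x th /\ de <= denQ x th & `|x| <= C]].
have KD x : K x -> posPQ x by move=> [_ h _]; exists de.
have cK : compact K.
  apply: (@bounded_closed_compactV _ _ _ _ K C) => [x []//|x cx].
  pose N : R := #|{: L0}|%:R + #|{: Lam}|%:R + 1.
  have N0 : 0 < N by rewrite /N ltr_wpDl// addr_ge0.
  have near_lb th (e : R) : 0 < e -> de <= numP x th + N * e /\ de <= denQ x th + N * e.
    move=> egt0; have [y [_ yde _] xy] := closure_dist cx egt0.
    have [h1 h2] := yde th.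
    have nle m (u : R) : m%:R <= N -> u <= `|x - y| -> 0 <= u -> m%:R * u <= N * e.
      by move=> mN ux u0; apply: ler_pM => //; exact: le_trans xy.
    have k1 : `|trigpoly (x - y).1 th| <= N * e.
      rewrite (le_trans (trigpoly_le_norm _ _))// nle ?norm_fst// /N.
      by rewrite -addrA lerDl addr_ge0.
    have k2 : `|trigpoly (x - y).2 th| <= N * e.
      rewrite (le_trans (trigpoly_le_norm _ _))// nle ?norm_snd// /N.
      by rewrite addrC addrA lerDr addr_ge0.
    rewrite /numP /denQ in h1 h2 *.
    move: k1 k2; rewrite !trigpolyB !ler_norml => /andP[k1 _] /andP[k2 _]; split; lra.
  split.
  - by apply: closed_sym2; [exact: L0_sym|exact: Lam_sym|apply: closureS cx => y []].
  - move=> th; split; apply/ler_addgt0Pr => e e0.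
      have [h _] := near_lb th (e / N) (divr_gt0 e0 N0).
      by move: h; rewrite mulrC divfK// gt_eqF.
    have [_ h] := near_lb th (e / N) (divr_gt0 e0 N0).
    by move: h; rewrite mulrC divfK// gt_eqF.
  apply/ler_addgt0Pr => e e0; have [y [_ _ yC] xy] := closure_dist cx e0.
  by rewrite -(subrK y x) (le_trans (ler_normD _ _))// addrC lerD.
have Kf : K flat by apply: H => //; rewrite dual_funE.
have cJ : {within K, continuous (dual_real n lam m0 z)}.
  apply/subspace_continuousP => x Kx; apply: cvg_within_nbhs.
  by apply: dual_real_continuous => //; exact: KD.
have [x + xmin] := compact_EVT_min (ex_intro _ _ Kf) cK cJ.
rewrite inE => Kx; have [sx _ _] := Kx; have Dx := KD _ Kx.
have xM : dual_real n lam m0 z x <= M by apply: xmin; rewrite inE.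
exists x; split => // y Py Qy; rewrite [dual_fun _ _ _ _ x]dual_funE//.
  (* Above the level of [flat] there is nothing to compare; at or below it, coercivity places [y] in
     [K]. *)
  have [yM|yM] := leP (dual_fun n.+1 lam m0 z y) M%:E; last first.
    by rewrite ltW// (le_lt_trans _ yM)// lee_fin.
  have Ky : K y by exact: H.
  by rewrite dual_funE ?lee_fin//; [apply: xmin; rewrite inE|exact: KD].
move=> yx; have Ky : K y by apply: H => //; rewrite (le_trans yx)// lee_fin.
by split; [case: Ky|exact: KD].
Qed.

Lemma solution_exists (lam : R) z : 0 < lam -> cone_pos z.1 ->
  symmetric_mseq R Lam z.1 -> symmetric_mseq R L0 z.2 ->
  exists x, [/\ sym2 x, posPQ x & omega n lam x = (- z.1, z.2)].
Proof.
move=> lam0 cz s1 s2; have [x [sx Dx xmin _]] := dual_min_exists 0 lam0 cz.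
exists x; split => //; apply: (@min_critical R d Lam n Lam_0 Lam_sym n_gt0 lam 0) => // y sy Dy.
have [Py Qy] := dom_Pge sy Dy.
by have := xmin y Py Qy; rewrite !dual_funE// lee_fin.
Qed.

Lemma densityE x th : density n.+1 x.1 x.2 th = ratio x th ^+ n.+1.
Proof. by rewrite /density /ratio numPE. Qed.

Lemma cepstralE (lam : R) x th :
  cepstral n.+1 x.1 x.2 lam th = gradA1 n x th + lam * gradB1 n x th.
Proof.
rewrite /cepstral /gradA1 /gradB1 /ratio -numPE//=.
by rewrite -natr1 addrK exprVn mulrN.
Qed.

Lemma moment_mapE (lam : R) x : posPQ x -> moment_map n.+1 lam x = omega n lam x.
Proof.
move=> Dx; have [bA1 bA2 bB1] := bmeas_grad n Dx.
apply: dcoord_eq => j; rewrite dcoord_omega; case: j => i.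
  rewrite /dcoord /moment_map /= Gamma_coord /momA /momB -RintegralZl//; last first.
    by apply: bmeas_integrable; apply: bmeasM => //; exact: bmeas_basisP.
  rewrite -RintegralD//; first last.
  - apply: bmeas_integrable; apply: bmeasM; first exact: bmeas_cst.
    by apply: bmeasM => //; exact: bmeas_basisP.
  - apply: bmeas_integrable; apply: bmeasD; apply: bmeasM => //.
      exact: bmeas_basisP.
    exact: bmeas_basisQ.
  by apply: eq_Rintegral => th _; rewrite cepstralE /=; ring.
rewrite /dcoord /moment_map /= mxE Gamma_coord /momA /momB.
have -> : \int[mu]_th (gradB1 n x th * basisP (inr i) th) = 0.
  transitivity (\int[mu]_th (fun=> 0) th); last exact: Rintegral_cstT.
  by apply: eq_Rintegral => th _; rewrite /= mulr0.
rewrite mulr0 addr0 -mulN1r -RintegralZl//; last first.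
  apply: bmeas_integrable; apply: bmeasM; first exact: bmeas_cos.
  rewrite (_ : density _ _ _ = fun th => - gradA2 n x th); first exact: bmeasN.
  by apply/funext => th; rewrite densityE /gradA2 opprK.
by apply: eq_Rintegral => th _; rewrite densityE /gradA2 /=; ring.
Qed.

Lemma density_regular x : posPQ x ->
  [/\ torus_fun (density n.+1 x.1 x.2), bmeas (density n.+1 x.1 x.2),
      forall th, density n.+1 x.1 x.2 (opp_angle th) = density n.+1 x.1 x.2 th &
      forall th, 0 < density n.+1 x.1 x.2 th].
Proof.
move=> Dx; have [bA1 bA2 bB1] := bmeas_grad n Dx; split.
- move=> th th' H; rewrite !densityE /ratio.
  by rewrite (numP_torus_fun _ H) (denQ_torus_fun _ H).
- rewrite (_ : density _ _ _ = fun th => - gradA2 n x th); first exact: bmeasN.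
  by apply/funext => th; rewrite densityE /gradA2 opprK.
- by move=> th; rewrite !densityE /ratio /numP /denQ !trigpoly_opp.
by move=> th; rewrite densityE exprn_gt0// ratio_gt0.
Qed.

Lemma cepstral_regular (lam : R) x : posPQ x ->
  [/\ torus_fun (cepstral n.+1 x.1 x.2 lam), bmeas (cepstral n.+1 x.1 x.2 lam) &
      forall th, cepstral n.+1 x.1 x.2 lam (opp_angle th) = cepstral n.+1 x.1 x.2 lam th].
Proof.
move=> Dx; have [bA1 bA2 bB1] := bmeas_grad n Dx; split.
- move=> th th' H; rewrite !cepstralE /gradA1 /gradB1 /ratio.
  by rewrite !(numP_torus_fun _ H) (denQ_torus_fun _ H).
- rewrite (_ : cepstral _ _ _ _ = fun th => gradA1 n x th + lam * gradB1 n x th).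
    by apply: bmeasD => //; apply: bmeasM => //; exact: bmeas_cst.
  by apply/funext => th; rewrite cepstralE.
by move=> th; rewrite !cepstralE /gradA1 /gradB1 /ratio /numP /denQ !trigpoly_opp.
Qed.

Lemma Cplus_density x : posPQ x -> Cplus R Lam (Gamma Lam (density n.+1 x.1 x.2)).
Proof.
move=> Dx; have [td bd ed dpos] := density_regular Dx.
exists (density n.+1 x.1 x.2); split; last exact: Gamma_is_moments.
split => //.
- exact: bmeas_integrable.
- by move=> th; exact: ltW.
by exists [tuple 0 | j < d], 1.
Qed.

(** For the converse, the dual problem is solved at parameter 1 for the data [(c, 0)]: the first
    block of the equation exhibits [c] as the moments of a strictly positive density. *)
Lemma CplusP c : Cplus R Lam c <-> symmetric_mseq R Lam c /\ cone_pos c.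
Proof.
split=> [Cc|[sc cc]].
  by split; [exact: (Cplus_sym Lam_sym Cc)|exact: (Cplus_cone_pos Lam_sym Cc)].
have s0 : symmetric_mseq R L0 (0 : mseq R L0).
  by apply/(sym_mseqP L0_sym) => i; rewrite !mxE.
have [x [sx Dx]] := @solution_exists 1 (c, 0) ltr01 cc sc s0.
rewrite -moment_mapE// => -[/oppr_inj <- _].
exact: Cplus_density.
Qed.

Lemma cone_pos_open c : cone_pos c -> \forall c' \near (c : mseq R Lam), cone_pos c'.
Proof.
move=> /(cone_pos_lb Lam_sym)[de de0 H].
pose N : R := #|{: Lam}|%:R + 1; have N0 : 0 < N by rewrite ltr_wpDl.
have e0 : 0 < de / 2 / N by rewrite !divr_gt0.
apply: filterS (near_dist_le c e0) => c' cc' q Pq q0.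
have nq : 0 < `|q| by rewrite normr_gt0.
have h : `|pairing q (c - c' : mseq R Lam)| <= de / 2 * `|q|.
  rewrite (le_trans (pairing_le _ _))//.
  have -> : de / 2 * `|q| = N * (`|q| * (de / 2 / N)).
    by field; rewrite gt_eqF.
  apply: ler_pM => //; first by rewrite /N lerDl.
  by rewrite ler_wpM2l.
have := H q Pq; have : 0 < de * `|q| by rewrite mulr_gt0.
move: h; rewrite -pairingB ler_norml => /andP[_ h]; lra.
Qed.

End dual_minimizer.

(** * Restriction of smooth maps along affine maps *)

Section affine_composition.
Context {R : realType} {Y Z W : normedModType R}.
Variables (iota l : Y -> Z) (S A : set Y) (S' A' : set Z).
Hypothesis iota_affine : forall y w (h : R), iota (h *: w + y) = h *: l w + iota y.
Hypothesis iota_cont : continuous iota.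
Hypothesis l_sub : forall w, S w -> S' (l w).
Hypothesis iota_sub : forall y, A y -> A' (iota y).

(** For an affine [iota] the difference quotients themselves coincide, so derivatives of all orders
    are transported from direction [w] to direction [l w]. *)
Lemma C_on_affine n (f : Z -> W) : C_on n S' A' f -> C_on n S A (f \o iota).
Proof.
have cont (g : Z -> W) : {within A', continuous g} -> {within A, continuous (g \o iota)}.
  move=> /subspace_continuousP cg; apply/subspace_continuousP => y Ay.
  apply: cvg_comp (cg _ (iota_sub Ay)) => B HB.
  have H : nbhs y [set z | A' (iota z) -> B (iota z)] by exact: (@iota_cont y _ HB).
  by apply: filterS H => z H /iota_sub; exact: H.
have DE (g : Z -> W) w y :
    (fun h : R => h^-1 *: (((g \o iota) \o +%R^~ y) (h *: w) - (g \o iota) y)) =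
    (fun h : R => h^-1 *: ((g \o +%R^~ (iota y)) (h *: l w) - g (iota y))).
  by apply/funext => h /=; rewrite iota_affine.
elim: n f => [|n IH] f [cf Df]; split; try exact: cont; first by [].
move=> w Sw; have [df Cf] := Df _ (l_sub Sw); split.
  by move=> y Ay; have := df _ (iota_sub Ay); rewrite /derivable DE.
rewrite (_ : (fun y => _) = (fun z => 'D_(l w) f z) \o iota); first exact: IH.
by apply/funext => y; rewrite /= /derive DE.
Qed.

Lemma smooth_on_affine (f : Z -> W) : smooth_on S' A' f -> smooth_on S A (f \o iota).
Proof. by move=> sf n; apply: C_on_affine; exact: sf. Qed.

End affine_composition.

Lemma near_line {R : realType} {Y : normedModType R} (P : set Y) (y w : Y) :
  (\forall z \near y, P z) -> \forall h \near (0 : R)^', P (h *: w + y).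
Proof.
move=> nP.
have H : (h *: w + y) @[h --> (0 : R)^'] --> y.
  rewrite -[X in _ --> X](_ : 0 *: w + y = y); last by rewrite scale0r add0r.
  by apply: cvgD; [apply: cvgZr_tmp; exact: nbhs_dnbhs|exact: cvg_cst].
exact: H.
Qed.

Lemma continuous_pair {T U V : topologicalType} (f : T -> U) (g : T -> V) :
  continuous f -> continuous g -> continuous (fun x => (f x, g x)).
Proof. by move=> cf cg x; apply: cvg_pair; [exact: cf|exact: cg]. Qed.

Theorem theorem6p1 (R : realType) (d : nat) (Lam : {fset 'rV[int]_d})
    (nu : nat) (d_ge1 : (1 <= d)%N) (Lam_0 : 0 \in Lam)
    (Lam_sym : forall k, k \in Lam -> - k \in Lam)
    (nu_ge : d%:R / 2 + 1 <= nu%:R :> R) :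
  let L0 := Lam0 Lam in
  let D := Pplus_o R Lam `*` Pplus R Lam in
  let E := negCplus R Lam `*` symmetric_mseq R L0 in
  (forall lam : R, 0 < lam ->
    [/\ (forall p q, D (p, q) ->
          is_moments (density nu p q) (Gamma Lam (density nu p q)) /\
          is_moments (cepstral nu p q lam) (Gamma L0 (cepstral nu p q lam))),
        diffeomorphism
          (symmetric_mseq R L0 `*` symmetric_mseq R Lam) D
          (symmetric_mseq R Lam `*` symmetric_mseq R L0) E
          (moment_map nu lam)
      & forall m0 : R,
          hadamard_well_posed
            (Cplus R Lam `*` symmetric_mseq R L0)
            (closure (Pplus_o R Lam) `*` closure (Pplus R Lam))
            (dual_fun nu lam m0)]) /\
  (forall c m, Cplus R Lam c -> symmetric_mseq R L0 m ->
    exists2 sol : R -> mseq R L0 * mseq R Lam,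
      forall lam, 0 < lam ->
        [/\ D (sol lam), moment_map nu lam (sol lam) = (- c, m)
          & forall x, D x -> moment_map nu lam x = (- c, m) -> x = sol lam]
      & smooth_on [set: R^o] [set lam : R^o | 0 < lam] sol).
Proof.
(* With [n = nu - 1] the hypothesis on [nu] reads [d <= n.*2], and [1 <= d] then makes [n]
   positive. *)
have [n n_gt0 [nuE dn]] : exists2 n, (0 < n)%N & nu = n.+1 /\ (d <= n.*2)%N.
  have h : (d + 2 <= nu.*2)%N.
    by rewrite -(ler_nat R) -addnn !natrD; lra.
  case: nu nu_ge h => [|n] _ h; first by move: h; rewrite addn2.
  have dn : (d <= n.*2)%N by move: h; rewrite doubleS addn2.
  by exists n => //; rewrite lt0n; apply: contraTneq dn => ->; rewrite -ltnNge.
subst nu => {nu_ge} L0 D E.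
pose L0_sym := Lam0_sym Lam_sym.
pose W := (mseq R Lam * mseq R L0)%type.
pose V := (mseq R L0 * mseq R Lam)%type.
have ED (z : W) : E z <->
    [/\ symmetric_mseq R Lam z.1, symmetric_mseq R L0 z.2 & cone_pos (- z.1 : mseq R Lam)].
  split=> [[/(CplusP d_ge1 Lam_0 Lam_sym n_gt0 dn)[s c] s2]|[s1 s2 c]].
    by split => //; rewrite -[z.1]opprK; exact: sym_mseqN.
  split => //; apply/(CplusP d_ge1 Lam_0 Lam_sym n_gt0 dn); split => //.
  exact: sym_mseqN.
have DP := @domainP R d Lam Lam_0 Lam_sym.
pose S' : set (R^o * W) := setT `*` (symmetric_mseq R Lam `*` symmetric_mseq R L0).
(* Parameter and data are treated jointly: both parts of the statement come from one map [G] on [A],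
   composed with affine embeddings. *)
pose A : set (R^o * W) := [set y | 0 < y.1 /\ E y.2].
have A_gt0 (y : R^o * W) : A y -> 0 < y.1 by case.
have near_cone (z : W) : cone_pos (- z.1 : mseq R Lam) ->
    \forall z' \near z, cone_pos (- z'.1 : mseq R Lam).
  move=> c.
  have H : (fun z' : W => - z'.1 : mseq R Lam) z' @[z' --> z] --> (- z.1 : mseq R Lam).
    by apply: cvgN; exact: cvg_fst.
  exact: H _ (cone_pos_open Lam_sym c).
have A_open (y w : R^o * W) : A y -> S' w -> \forall h \near (0 : R)^', A (h *: w + y).
  move=> [y0 Ey] [_ [sw1 sw2]]; have /ED[s1 s2 cy] := Ey.
  have n1 : \forall z \near y, 0 < z.1.
    by apply: (@cvgr_gt _ _ (nbhs y) _ (fun z : R^o * W => z.1) y.1) => //; exact: cvg_fst.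
  have n2 : \forall z \near y, cone_pos (- z.2.1 : mseq R Lam).
    have H : (fun z : R^o * W => z.2) z @[z --> y] --> y.2 by exact: cvg_snd.
    exact: H _ (near_cone _ cy).
  apply: filterS (near_line w (filterI n1 n2)) => h [h1 h2].
  split => //; apply/ED; split => //.
  - by apply: sym_mseqD => //; exact: sym_mseqZ.
  - by apply: sym_mseqD => //; exact: sym_mseqZ.
(* The solution is made total, with value 0 off [A], so that [choice] yields a function on the whole
   space. *)
have exG (y : R^o * W) : exists x : V, A y -> [/\ sym2 x, posPQ x & omega n y.1 x = y.2].
  have [[y0 /ED[s1 s2 c]]|nA] := pselect (A y); last by exists 0.
  have sN : symmetric_mseq R Lam (- y.2.1 : mseq R Lam) by exact: sym_mseqN.
  have [x [sx Dx ex]] := @solution_exists R d Lam n d_ge1 Lam_0 Lam_sym n_gt0 dn y.1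
    ((- y.2.1, y.2.2) : W) y0 c sN s2.
  by exists x => _; split => //; rewrite ex /= opprK -surjective_pairing.
have [G HG] := choice exG.
have smG : smooth_on S' A G.
  exact: (@solution_smooth R d L0 Lam n n_gt0 L0_sym Lam_sym S' A G A_gt0 A_open HG).
have G_uniq (lam : R) (z : W) (x : V) : 0 < lam -> E z -> D x ->
    moment_map n.+1 lam x = z -> x = G (lam, z).
  move=> lam0 Ez /DP[sx Dx]; rewrite moment_mapE// => ex.
  have [sG DG eG] := HG (lam, z) (conj lam0 Ez).
  by apply: (@omega_inj R d L0 Lam n n_gt0 L0_sym Lam_sym lam) => //; rewrite ex; exact/esym/eG.
have G_sol (lam : R) (z : W) : 0 < lam -> E z ->
    D (G (lam, z)) /\ moment_map n.+1 lam (G (lam, z)) = z.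
  move=> lam0 Ez; have [sG DG eG] := HG (lam, z) (conj lam0 Ez).
  by split; [exact/DP|rewrite moment_mapE].
have fE (lam : R) x : D x -> E (moment_map n.+1 lam x).
  move=> /DP[sx Dx]; split.
    rewrite /negCplus /moment_map /= opprK.
    by apply: Cplus_density.
  rewrite moment_mapE//; apply/(sym_mseqP L0_sym) => i.
  exact: (omega_sym n Lam_sym lam x (inl i)).
have EN (t : W) : (Cplus R Lam `*` symmetric_mseq R L0) t -> E (- t.1, t.2).
  by move=> [Ct st]; split => //; rewrite /negCplus /= opprK.
split=> [lam lam0|c m Cc sm].
  split.
  - move=> p q /DP[_ Dx].
    have [td bd ed _] := density_regular n Lam_0 Dx.
    have [tc bc ec] := cepstral_regular n Lam_0 lam Dx.
    by split; exact: Gamma_is_moments.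
  - have D_open (x w : V) : D x -> (symmetric_mseq R L0 `*` symmetric_mseq R Lam) w ->
        \forall h \near (0 : R)^', D (h *: w + x).
      move=> /DP[sx Dx] sw; apply: filterS (near_line w (near_posPQ Dx)) => h Dh.
      by apply/DP; split => //; apply: sym2D => //; exact: sym2Z.
    split.
    + exists (@posPQ R d L0 Lam); first exact: open_posPQ.
      by apply/seteqP; split=> x /DP.
    + exists [set z : W | cone_pos (- z.1 : mseq R Lam)].
        by rewrite openE => z; exact: near_cone.
      by apply/seteqP; split=> z => [/ED[]|[[s1 s2] c]]; [|apply/ED].
    + split.
      * by move=> x; exact: fE.
      * move=> x y; rewrite !inE => /DP[sx Dx] /DP[sy Dy]; rewrite !moment_mapE//.
        exact: omega_inj.
      * by move=> z Ez; have [DG eG] := G_sol lam z lam0 Ez; exists (G (lam, z)).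
    + move=> k; apply: (C_on_eq D_open) (omega_smooth n D_open _ lam k) => [x /DP[_ Dx]|x /DP[]//].
      exact: moment_mapE.
    + exists (fun z => G (lam, z)).
        move=> x; rewrite inE => Dx; apply/esym/G_uniq => //; exact: fE.
      apply: (@smooth_on_affine _ _ _ _ (fun z : W => (lam, z) : R^o * W)
        (fun w : W => (0, w) : R^o * W) _ _ S' A) => //.
      * by move=> y w h; rewrite -[RHS]/(h * 0 + lam, h *: w + y) mulr0 add0r.
      * by apply: continuous_pair => z; [exact: cvg_cst|exact: cvg_id].
  - move=> m0; exists (fun t => G (lam, (- t.1, t.2))).
      move=> t tdata; have Et := EN t tdata.
      have [Ct st] := tdata.
      have /(CplusP d_ge1 Lam_0 Lam_sym n_gt0 dn)[sc cc] := Ct.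
      have [x [sx Dx xmin xuniq]] :=
        @dual_min_exists R d Lam n d_ge1 Lam_0 Lam_sym n_gt0 dn lam m0 t lam0 cc.
      (* A minimizer in the open domain is critical, hence equal to the value of [G]; this serves
         for the minimizer just found and for any other one. *)
      have crit (y : V) : sym2 y -> posPQ y ->
          (forall y', sym2 y' -> posPQ y' -> (dual_fun n.+1 lam m0 t y <= dual_fun n.+1 lam m0 t y')%E) ->
          y = G (lam, (- t.1, t.2)).
        move=> sy Dy ymin; apply: G_uniq => //; first exact/DP.
        rewrite moment_mapE//.
        apply: (@min_critical R d Lam n Lam_0 Lam_sym n_gt0 lam m0 t) => // y' sy' Dy'.
        by have := ymin y' sy' Dy'; rewrite !dual_funE// lee_fin.
      have xG : x = G (lam, (- t.1, t.2)).
        apply: crit => // y' sy' Dy'.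
        have [Py Qy] := dom_Pge Lam_0 Lam_sym sy' Dy'.
        exact: xmin.
      rewrite -xG.
      have Xx : (closure (Pplus_o R Lam) `*` closure (Pplus R Lam)) x.
        have [Dx1 Dx2] : D x by exact/DP.
        by split; exact: subset_closure.
      have xm : forall y, (closure (Pplus_o R Lam) `*` closure (Pplus R Lam)) y ->
          (dual_fun n.+1 lam m0 t x <= dual_fun n.+1 lam m0 t y)%E.
        move=> y [c1 c2]; apply: xmin; first exact: closure_Pplus_o.
        exact: closure_Pplus.
      split => // y [[c1 c2] ymin].
      (* A minimizer on the closures has a value at most that of [x], which forces it into the open
         domain. *)
      have [sy Dy] : sym2 y /\ posPQ y.
        apply: xuniq; [exact: closure_Pplus_o|exact: closure_Pplus|exact: ymin].
      rewrite xG; apply: crit => // y' sy' Dy'; apply: ymin.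
      have [Dy1 Dy2] : D y' by exact/DP.
      by split; exact: subset_closure.
    (* Continuity is smoothness of order 0, where no direction occurs; hence [setT] can stand for
       the space of directions. *)
    have [] : C_on 0 setT (Cplus R Lam `*` symmetric_mseq R L0) (fun t : W => G (lam, (- t.1, t.2))).
      apply: (@C_on_affine _ _ _ _ (fun t : W => (lam, (- t.1, t.2)) : R^o * W)
        (fun w : W => (0, (- w.1, w.2)) : R^o * W) setT _ setT A) => //.
      * move=> y w h; rewrite -[RHS]/(h * 0 + lam, (h *: - w.1 + - y.1, h *: w.2 + y.2)).
        by rewrite mulr0 add0r scalerN -opprD.
      * apply: continuous_pair => [t|]; first exact: cvg_cst.
        by apply: continuous_pair => t; [apply: cvgN; exact: cvg_fst|exact: cvg_snd].
      * by move=> t /EN.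
      * by have [cG _] := smG 0%N.
    by [].
exists (fun lam : R => G (lam, (- c, m))).
  move=> lam lam0; have Ecm : E (- c, m) by exact: (EN (c, m)).
  have [DG eG] := G_sol lam _ lam0 Ecm; split => // x Dx ex.
  exact: G_uniq.
have Ecm : E (- c, m) by exact: (EN (c, m)).
apply: (@smooth_on_affine _ _ _ _ (fun l : R^o => (l, (- c, m)) : R^o * W)
  (fun w : R^o => (w, 0) : R^o * W) _ _ S' A) => //.
- by move=> y w h; rewrite -[RHS]/(h * w + y, h *: 0 + (- c, m)) scaler0 add0r.
- by apply: continuous_pair => l; [exact: cvg_id|exact: cvg_cst].
- move=> w _; split => //; split.
    by apply/(sym_mseqP Lam_sym) => i; rewrite !mxE.
  by apply/(sym_mseqP L0_sym) => i; rewrite !mxE.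
Qed.
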